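(* In the terminology of the context, let $\tilde\omega$ denote any symplectic form on $G/\Gamma$ induced by a left-invariant symplectic form on the modified group $\tilde G$. (1) If $G/\Gamma$ is one of $G_{6.10}^{a=0}/\Gamma_{2\pi}$, $(G_{5.14}^{0}\times\mathbb{R})/\Gamma_{2\pi}$, $(G_{5.18}^{0}\times\mathbb{R})/\Gamma_{2\pi}$, then the hard Lefschetz property does not hold for $\tilde\omega$. More in general, these solvmanifolds (with $\tilde\omega$) are $0$-Lefschetz but not $1$-Lefschetz and not $2$-Lefschetz. (2) If $G/\Gamma$ is $(G_{5.17}^{p,-p,r}\times\mathbb{R})/\Gamma_{2\pi r_2}$ with $r=\frac{r_1}{r_2}\in\mathbb{Q}\setminus\{0\}$ ($r_1,r_2$ integers, $r_2>0$) and $p\in\mathbb{R}$ such that a lattice $\Gamma_{2\pi r_2}$ exists, or $(G_{3.5}^{0}\times\mathbb{R}^3)/\Gamma_{2\pi}$, then the hard Lefschetz property holds for $\tilde\omega$.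
   Context: Groups. Each group $G$ is the connected and simply connected six-dimensional Lie group whose Lie algebra $\mathfrak{g}$ has basis $X_1,\dots,X_6$ and the following nonzero brackets (up to antisymmetry). Next to it we list the nonzero brackets of the ''modified'' Lie algebra $\tilde{\mathfrak g}$ on the same vector space. $X_*$ is the indicated basis vector; the other five basis vectors span an abelian ideal $\mathbb{R}^5$ in both $\mathfrak{g}$ and $\tilde{\mathfrak g}$. - $G_{6.10}^{a=0}$, $X_*=X_6$, $\bar t=2\pi$: $[X_2,X_6]=X_1$, $[X_3,X_6]=X_2$, $[X_4,X_6]=-X_5$, $[X_5,X_6]=X_4$. Modified: $[X_2,X_6]=X_1$, $[X_3,X_6]=X_2$. - $G_{5.14}^{0}\times\mathbb{R}$, $X_*=X_5$, $\bar t=2\pi$: $[X_2,X_5]=X_1$, $[X_3,X_5]=-X_4$, $[X_4,X_5]=X_3$. Modified: $[X_2,X_5]=X_1$. - $G_{5.17}^{p,-p,r}\times\mathbb{R}$ ($r\ne0$), $X_*=X_5$, $\bar t=2\pi r_2$: $[X_1,X_5]=pX_1-X_2$, $[X_2,X_5]=X_1+pX_2$, $[X_3,X_5]=-pX_3-rX_4$, $[X_4,X_5]=rX_3-pX_4$. Modified: $[X_1,X_5]=pX_1$, $[X_2,X_5]=pX_2$, $[X_3,X_5]=-pX_3$, $[X_4,X_5]=-pX_4$ (abelian if $p=0$). - $G_{5.18}^{0}\times\mathbb{R}$, $X_*=X_5$, $\bar t=2\pi$: $[X_1,X_5]=-X_2$, $[X_2,X_5]=X_1$, $[X_3,X_5]=X_1-X_4$,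 $[X_4,X_5]=X_2+X_3$. Modified: $[X_3,X_5]=X_1$, $[X_4,X_5]=X_2$. - $G_{3.5}^{0}\times\mathbb{R}^3$, $X_*=X_3$, $\bar t=2\pi$: $[X_1,X_3]=-X_2$, $[X_2,X_3]=X_1$. Modified: abelian. Lattices and modified groups. Let $B,\tilde B:\mathbb{R}^5\to\mathbb{R}^5$ be $X\mapsto[X,X_*]$ computed in $\mathfrak g$, respectively $\tilde{\mathfrak g}$, and $\varphi(t)=\exp(tB)$, $\tilde\varphi(t)=\exp(t\tilde B)$. Then $G=\mathbb{R}\ltimes_\varphi\mathbb{R}^5$ and $\tilde G=\mathbb{R}\ltimes_{\tilde\varphi}\mathbb{R}^5$, with products $(t,x)(t',x')=(t+t',x+\varphi(t)x')$, respectively with $\tilde\varphi$. For the indicated $\bar t$ one has $\varphi(\bar t)=\tilde\varphi(\bar t)$. $\Gamma_{\bar t}$ denotes a lattice $\bar t\,\mathbb{Z}\ltimes\Lambda$, where $\Lambda\subset\mathbb{R}^5$ is a lattice with $\varphi(\bar t)\Lambda=\Lambda$. It is a lattice in both $G$ and $\tilde G$, its left translations on $\mathbb{R}\times\mathbb{R}^5$ are the same for both group structures, and so the quotient by left translations, denoted $G/\Gamma_{\bar t}$, is the same manifold as $\tilde G/\Gamma_{\bar t}$; left-invariant forms on $\tilde G$ therefore induce forms on $G/\Gamma_{\bar t}$. Lefschetz properties. For a symplectic manifold $(M^{2n},\omega)$ and $0\le k\le n$ let $L^{n-k}:H^k(M)\to H^{2n-k}(M)$, $[\alpha]\mapsto[\omega^{n-k}\wedge\alpha]$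 (de Rham cohomology). The hard Lefschetz property holds if $L^{n-k}$ is an isomorphism for every $0\le k\le n$. $(M,\omega)$ is $s$-Lefschetz if $L^{n-k}$ is an isomorphism for all $k\le s$. *)

(* Defs.v *)
From HB Require Import structures.
From mathcomp Require Import all_boot all_order all_algebra all_fingroup.
From mathcomp Require Import all_classical all_reals all_analysis.
Set Implicit Arguments.
Unset Strict Implicit.
Unset Printing Implicit Defensive.
Import Order.TTheory GRing.Theory Num.Theory.
Import numFieldNormedType.Exports.

Local Open Scope classical_set_scope.
Local Open Scope ring_scope.

(* A k-form on R^n takes a point p and k tangent vectors, given as the rows of
   a k x n matrix. *)
Definition diff_form (R : realType) (n k : nat) : Type :=
  'rV[R]_n -> 'M[R]_(k, n) -> R.

(* C^oo: every iterated directional derivative is Frechet differentiable. *)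
Definition smooth (R : realType) (n : nat) (f : 'rV[R]_n -> R) : Prop :=
  forall (vs : seq 'rV[R]_n) (p : 'rV[R]_n),
    differentiable (foldr (fun v g => 'D_v g) f vs) p.

(* Same formulations as [determinant_multilinear] and
   [determinant_alternate]. *)
Definition multilinear (R : realType) (n k : nat) (a : 'M[R]_(k, n) -> R) :
    Prop :=
  forall (u v w : 'M[R]_(k, n)) (i : 'I_k) (b c : R),
    row i u = b *: row i v + c *: row i w ->
    row' i v = row' i u -> row' i w = row' i u ->
    a u = b * a v + c * a w.

Definition alternating (R : realType) (n k : nat) (a : 'M[R]_(k, n) -> R) :
    Prop :=
  forall (v : 'M[R]_(k, n)) (i j : 'I_k), i != j -> row i v = row j v -> a v = 0.

Definition smooth_form (R : realType) (n k : nat) (a : diff_form R n k) :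
    Prop :=
  (forall p, multilinear (a p) /\ alternating (a p)) /\
  (forall v, smooth (fun p => a p v)).

Definition extd (R : realType) (n k : nat) (a : diff_form R n k) :
    diff_form R n k.+1 :=
  fun p v => \sum_(i < k.+1) (-1) ^+ i * 'D_(row i v) (a ^~ (row' i v)) p.

Definition wedge (R : realType) (n k l : nat) (a : diff_form R n k)
    (b : diff_form R n l) : diff_form R n (k + l) :=
  fun p v => (k`! * l`!)%:R^-1 *
    \sum_(s : 'S_(k + l)) (-1) ^+ s *
      (a p (usubmx (row_perm s v)) * b p (dsubmx (row_perm s v))).

(* The m-th power of a 2-form; the degree 2 + m.*2 is convertible to
   m.+1.*2. *)
Fixpoint wpow (R : realType) (n : nat) (w : diff_form R n 2) (m : nat) :
    diff_form R n m.*2 :=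
  if m is m'.+1 return diff_form R n m.*2 then wedge w (@wpow R n w m')
  else fun _ _ => 1.
Arguments wpow {R n} w m.

Definition pullback (R : realType) (n k : nat) (f : 'rV[R]_n -> 'rV[R]_n)
    (a : diff_form R n k) : diff_form R n k :=
  fun p v => a (f p) (\matrix_(i < k) 'd f p (row i v)).

(* For a group D of diffeomorphisms of R^n acting freely and properly
   discontinuously, pulling back along R^n -> R^n/D identifies the smooth
   k-forms on the manifold R^n/D with the D-invariant smooth k-forms on R^n. *)
Definition invariant_form (R : realType) (n : nat)
    (D : set ('rV[R]_n -> 'rV[R]_n)) (k : nat) : set (diff_form R n k) :=
  [set a | smooth_form a /\ (forall f, D f -> pullback f a = a)].
Arguments invariant_form {R n} D k.

Definition closed_form (R : realType) (n : nat)
    (D : set ('rV[R]_n -> 'rV[R]_n)) (k : nat) : set (diff_form R n k) :=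
  [set a | invariant_form D k a /\ extd a = fun _ _ => 0].
Arguments closed_form {R n} D k.

(* The only exact 0-form is 0. *)
Definition exact_form (R : realType) (n : nat)
    (D : set ('rV[R]_n -> 'rV[R]_n)) (k : nat) : set (diff_form R n k) :=
  match k return set (diff_form R n k) with
  | 0 => [set a | a = fun _ _ => 0]
  | k'.+1 => [set extd b | b in invariant_form D k']
  end.
Arguments exact_form {R n} D k.

Definition dR_class (R : realType) (n : nat)
    (D : set ('rV[R]_n -> 'rV[R]_n)) (k : nat) (a : diff_form R n k) :
    set (diff_form R n k) :=
  [set b | closed_form D k b /\ exact_form D k (fun p v => b p v - a p v)].
Arguments dR_class {R n} D {k} a.

(* The de Rham cohomology H^k(R^n/D), as the set of cosets of the exact forms
   in the closed forms. *)
Definition dR_cohomology (R : realType) (n : nat)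
    (D : set ('rV[R]_n -> 'rV[R]_n)) (k : nat) :
    set (set (diff_form R n k)) :=
  [set dR_class D a | a in closed_form D k].
Arguments dR_cohomology {R n} D k.

(* [a] |-> [w^m /\ a]: the union of the classes of w^m /\ a over the
   representatives a of c; for an invariant closed w these all coincide. *)
Definition lefschetz_map (R : realType) (n : nat)
    (D : set ('rV[R]_n -> 'rV[R]_n)) (w : diff_form R n 2) (m k : nat)
    (c : set (diff_form R n k)) : set (diff_form R n (m.*2 + k)) :=
  \bigcup_(a in c) dR_class D (wedge (wpow w m) a).
Arguments lefschetz_map {R n} D w m {k} c.

(* L^(3-k) : H^k -> H^(6-k) is an isomorphism; the degree 6 - k is written
   (3 - k).*2 + k, and L^(3-k) is linear, so bijectivity is what is asked. *)
Definition lefschetz_iso (R : realType) (D : set ('rV[R]_6 -> 'rV[R]_6))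
    (w : diff_form R 6 2) (k : nat) : Prop :=
  set_bij (dR_cohomology D k) (dR_cohomology D ((3 - k).*2 + k))
    (lefschetz_map D w (3 - k)).

Definition s_lefschetz (R : realType) (D : set ('rV[R]_6 -> 'rV[R]_6))
    (w : diff_form R 6 2) (s : nat) : Prop :=
  forall k : nat, (k <= 3)%N -> (k <= s)%N -> lefschetz_iso D w k.

Definition hard_lefschetz (R : realType) (D : set ('rV[R]_6 -> 'rV[R]_6))
    (w : diff_form R 6 2) : Prop :=
  forall k : nat, (k <= 3)%N -> lefschetz_iso D w k.

Definition nondegenerate (R : realType) (n : nat) (w : diff_form R n 2) :
    Prop :=
  forall p u, (forall v, w p (col_mx u v : 'M[R]_(1 + 1, n)) = 0) -> u = 0.

Definition symplectic (R : realType) (n : nat)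
    (D : set ('rV[R]_n -> 'rV[R]_n)) (w : diff_form R n 2) : Prop :=
  closed_form D 2 w /\ nondegenerate w.

Definition mexp (R : realType) (n : nat) (A : 'M[R]_n.+1) : 'M[R]_n.+1 :=
  limn (series (fun k => k`!%:R^-1 *: A ^+ k)).

(* The product of R x_phi R^5, phi(t) = exp(tB). Elements (t, x) are row
   vectors with t in coordinate 0; endomorphisms of R^5 act on row vectors from
   the right, so row i of B holds the image of the i-th basis vector. *)
Definition sdmul (R : realType) (B : 'M[R]_5) (g h : 'rV[R]_(1 + 5)) :
    'rV[R]_(1 + 5) :=
  row_mx (lsubmx g + lsubmx h)
         (rsubmx g + rsubmx h *m mexp (lsubmx g 0 0 *: B)).

Definition left_translations (R : realType) (B : 'M[R]_5)
    (S : set 'rV[R]_(1 + 5)) : set ('rV[R]_6 -> 'rV[R]_6) :=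
  [set sdmul B g | g in S].

Definition is_lattice (R : realType) (n : nat) (L : set 'rV[R]_n) : Prop :=
  exists2 P : 'M[R]_n, P \in unitmx &
    L = [set map_mx intr z *m P | z in [set: 'rV[int]_n]].

Definition Gamma (R : realType) (t : R) (L : set 'rV[R]_5) :
    set 'rV[R]_(1 + 5) :=
  [set g | (exists m : int, lsubmx g 0 0 = t * m%:~R) /\ L (rsubmx g)].

(* The matrix of X |-> [X, X_star] on the five X_i with i <> star, in increasing
   order of i = 1, ..., 6, where [X_i, X_star] = \sum_j c i j X_j. *)
Definition ad_star (R : realType) (star : nat) (c : nat -> nat -> R) :
    'M[R]_5 :=
  \matrix_(i, j) c (bump star i.+1) (bump star j.+1).

(* A group G and its modification, given by B and by B tilde. *)
Record modified_pair (R : realType) := ModifiedPair {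
  ad_orig : 'M[R]_5;
  ad_mod : 'M[R]_5 }.

Definition G6_10 (R : realType) : modified_pair R := ModifiedPair
  (ad_star 6 (fun i j => match i, j with
     | 2, 1 => 1 | 3, 2 => 1 | 4, 5 => -1 | 5, 4 => 1 | _, _ => 0 end))
  (ad_star 6 (fun i j => match i, j with
     | 2, 1 => 1 | 3, 2 => 1 | _, _ => 0 end)).

Definition G5_14_x_R (R : realType) : modified_pair R := ModifiedPair
  (ad_star 5 (fun i j => match i, j with
     | 2, 1 => 1 | 3, 4 => -1 | 4, 3 => 1 | _, _ => 0 end))
  (ad_star 5 (fun i j => match i, j with
     | 2, 1 => 1 | _, _ => 0 end)).

Definition G5_17_x_R (R : realType) (p r : R) : modified_pair R := ModifiedPair
  (ad_star 5 (fun i j => match i, j with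
     | 1, 1 => p | 1, 2 => -1 | 2, 1 => 1 | 2, 2 => p
     | 3, 3 => -p | 3, 4 => -r | 4, 3 => r | 4, 4 => -p | _, _ => 0 end))
  (ad_star 5 (fun i j => match i, j with
     | 1, 1 => p | 2, 2 => p | 3, 3 => -p | 4, 4 => -p | _, _ => 0 end)).

Definition G5_18_x_R (R : realType) : modified_pair R := ModifiedPair
  (ad_star 5 (fun i j => match i, j with
     | 1, 2 => -1 | 2, 1 => 1 | 3, 1 => 1 | 3, 4 => -1
     | 4, 2 => 1 | 4, 3 => 1 | _, _ => 0 end))
  (ad_star 5 (fun i j => match i, j with
     | 3, 1 => 1 | 4, 2 => 1 | _, _ => 0 end)).

Definition G3_5_x_R3 (R : realType) : modified_pair R := ModifiedPair
  (ad_star 3 (fun i j => match i, j with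
     | 1, 2 => -1 | 2, 1 => 1 | _, _ => 0 end))
  (ad_star 3 (fun _ _ => 0)).

(* phi(t) L = L for a lattice L, so that Gamma t L is a lattice in G. *)
Definition invariant_lattice (R : realType) (G : modified_pair R) (t : R)
    (L : set 'rV[R]_5) : Prop :=
  is_lattice L /\ [set x *m mexp (t *: ad_orig G) | x in L] = L.

(* The deck group of G -> G/Gamma: the left translations of G by Gamma. *)
Definition deck (R : realType) (G : modified_pair R) (t : R)
    (L : set 'rV[R]_5) : set ('rV[R]_6 -> 'rV[R]_6) :=
  left_translations (ad_orig G) (Gamma t L).

Definition modified_symplectic (R : realType) (G : modified_pair R)
    (w : diff_form R 6 2) : Prop :=
  symplectic (left_translations (ad_mod G) [set: 'rV[R]_(1 + 5)]) w.

(* Main.v *)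
(* The solvmanifold is the mapping torus of the torus R^5/Lambda, with coordinate
   t on the base.  On left-invariant forms of the modified group the holonomy
   over the base circle is unipotent or diagonal.

   Averaging a closed form over the torus fibres changes it by an exact form up
   to a multiple of dt; the primitive is glued along the base by a smooth
   partition of unity.  So every class has a representative whose coefficients
   depend on t only.  Writing its dt-component as a holonomy-invariant part plus
   a coboundary, which is always possible in top degree and for a diagonal
   holonomy, makes the coefficients constant.  Conversely, averaging a primitive
   shows that a constant form which is exact has the form dt /\ (B - tau B), tau
   being the holonomy.

   Diagonal holonomy: the cohomology is that of the constant invariant forms, w
   is cohomologous to a constant w0, w0^3 <> 0 because w^3 is not exact, and the
   sl2-relations of exterior algebra give hard Lefschetz for w0.

   Unipotent holonomy: w^3 is a constant volume form, whence the isomorphism in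
   degree 0.  If eps = [y, X_star] is central, then alpha = iota_eps w is closed
   and not exact, but 3 w^2 /\ alpha = iota_eps w^3 is, up to sign, the
   differential of iota_(y + t eps) iota_(d/dt) w^3. *)
Require Import Defs.
From HB Require Import structures.
From mathcomp Require Import all_boot all_order all_algebra all_fingroup.
From mathcomp Require Import all_classical all_reals all_analysis.
From mathcomp Require Import ring lra zify.
Import Order.TTheory GRing.Theory Num.Theory.
Import numFieldNormedType.Exports.

Local Open Scope classical_set_scope.
Local Open Scope ring_scope.
Set Implicit Arguments.
Unset Strict Implicit.

(** * Exterior algebra of row vectors *)

Section Contraction.
Context {R : realType} {n : nat}.
Implicit Types e u : 'rV[R]_n.

(** The primitive produced by fibre averaging integrates along the lattice basis [e], which the
    holonomy sends to another basis. Hence it is periodic but not invariant under the generator of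
    the base, and it has to be glued. The gluing error is dt /\ (difference of translates), so it is
    closed and divisible by dt. Averaging that error gives a primitive which inherits the factor dt,
    and the second gluing error contains dt /\ dt and vanishes.

    [w] is invariant under the modified group only, so its coefficients may vary with t. What stays
    constant is w^3, because the left translations of the modified group have linear parts of
    determinant 1. In the diagonal case the constant w0 that replaces [w] does not inherit
    nondegeneracy pointwise; it has to be read off in cohomology. In the unipotent case the failure
    in degree 1 refutes s-Lefschetz for s = 1 and s = 2 and hard Lefschetz at once.

    Exterior algebra is done by induction on the degree, contracting with the first row; [wedge], a
    sum over permutations, is reduced to products with covectors. *)

Definition contr k e (a : 'M[R]_(k.+1, n) -> R) (v : 'M[R]_(k, n)) : R :=
  a (col_mx e v).

(* The exterior product of the covector x with a. *)
Definition cowedge k (x : 'rV[R]_n -> R) (a : 'M[R]_(k, n) -> R)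
    (v : 'M[R]_(k.+1, n)) : R :=
  \sum_(i < k.+1) (-1) ^+ i * (x (row i v) * a (row' i v)).

Lemma col_mx_0 k e (v : 'M[R]_(k, n)) j : (col_mx e v : 'M[R]_(k.+1, n)) ord0 j = e ord0 j.
Proof. by rewrite -[RHS](col_mxEu e v) lshift0. Qed.

Lemma col_mx_S k e (v : 'M[R]_(k, n)) i j :
  (col_mx e v : 'M[R]_(k.+1, n)) (lift ord0 i) j = v i j.
Proof. by rewrite -[RHS](col_mxEd e v) rshift1. Qed.

Definition col_mx_recE := (col_mx_0, col_mx_S).

Lemma row0_col_mx k e (v : 'M[R]_(k, n)) :
  row (ord0 : 'I_k.+1) (col_mx e v) = e.
Proof. by apply/rowP => j; rewrite mxE col_mx_0. Qed.

Lemma rowS_col_mx k e (v : 'M[R]_(k, n)) i :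
  row (lift ord0 i : 'I_k.+1) (col_mx e v) = row i v.
Proof. by apply/rowP => j; rewrite mxE col_mx_S mxE. Qed.

Lemma row'0_col_mx k e (v : 'M[R]_(k, n)) :
  row' (ord0 : 'I_k.+1) (col_mx e v) = v.
Proof.
by apply/matrixP => i j; rewrite mxE col_mx_S. Qed.

Lemma lift_lift0 k (i : 'I_k.+1) (l : 'I_k) :
  lift (lift ord0 i) (lift ord0 l) = lift ord0 (lift i l).
Proof. by apply/val_inj; rewrite /= /bump /= !add1n ltnS addnS. Qed.

Lemma lift_lift00 k (i : 'I_k.+1) : lift (lift ord0 i) ord0 = ord0.
Proof. exact/val_inj. Qed.

Lemma row'S_col_mx k e (v : 'M[R]_(k.+1, n)) i :
  row' (lift ord0 i : 'I_k.+2) (col_mx e v) = col_mx e (row' i v).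
Proof.
apply/matrixP => l j; case: (unliftP ord0 l) => [l'|] ->.
- by rewrite [RHS]col_mx_S [LHS]mxE lift_lift0 col_mx_S mxE.
- by rewrite [RHS]col_mx_0 [LHS]mxE lift_lift00 col_mx_0.
Qed.

Lemma col_mx_row k (v : 'M[R]_(k.+1, n)) :
  v = col_mx (row ord0 v) (row' ord0 v) :> 'M[R]_(k.+1, n).
Proof.
by apply/matrixP => i j; case: (unliftP ord0 i) => [l|] ->;
  rewrite col_mx_recE mxE.
Qed.

(** In positive degree a function is known once all its contractions are. This turns identities
    between forms into inductions on the degree, with no permutation in sight. *)
Lemma contr_ext k (a b : 'M[R]_(k.+1, n) -> R) :
  (forall e, contr e a = contr e b) -> a = b.
Proof.
move=> ab; apply/funext => v; rewrite (col_mx_row v).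
exact: (congr1 (@^~ (row' ord0 v)) (ab _)).
Qed.

Lemma contr_cowedge0 e x (a : 'M[R]_(0, n) -> R) :
  contr e (cowedge x a) = fun v => x e * a v.
Proof.
apply/funext => v; rewrite /contr /cowedge big_ord_recl big_ord0 addr0 mul1r.
by rewrite row0_col_mx row'0_col_mx.
Qed.

(** The antiderivation rule of interior multiplication; the minus sign comes from moving the
    contraction past a form of degree one. Degree zero is separate because no further contraction
    can be taken there. *)
Lemma contr_cowedge k e x (a : 'M[R]_(k.+1, n) -> R) :
  contr e (cowedge x a) = fun v => x e * a v - cowedge x (contr e a) v.
Proof.
apply/funext => v; rewrite /contr /cowedge big_ord_recl mul1r.
rewrite row0_col_mx row'0_col_mx -sumrN; congr (_ + _); apply: eq_bigr => i _.
rewrite rowS_col_mx row'S_col_mx lift0 exprS !mulN1r !mulNr; congr (- (_ * _)).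
Qed.

Lemma cowedge_lin k x (a b : 'M[R]_(k, n) -> R) r s :
  cowedge x (fun v => r * a v + s * b v) =
  fun v => r * cowedge x a v + s * cowedge x b v.
Proof.
apply/funext => v; rewrite /cowedge !mulr_sumr -big_split; apply: eq_bigr => i _ /=.
by ring.
Qed.

Lemma cowedgeD k x (a b : 'M[R]_(k, n) -> R) :
  cowedge x (fun v => a v + b v) = fun v => cowedge x a v + cowedge x b v.
Proof.
apply/funext => v; rewrite /cowedge -big_split; apply: eq_bigr => i _ /=.
by ring.
Qed.

Lemma cowedgeZ k x (a : 'M[R]_(k, n) -> R) r :
  cowedge x (fun v => r * a v) = fun v => r * cowedge x a v.
Proof.
apply/funext => v; rewrite /cowedge mulr_sumr; apply: eq_bigr => i _.
by ring.
Qed.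

Lemma cowedgeB k x (a b : 'M[R]_(k, n) -> R) :
  cowedge x (fun v => a v - b v) = fun v => cowedge x a v - cowedge x b v.
Proof.
apply/funext => v; rewrite /cowedge -sumrB; apply: eq_bigr => i _ /=.
by ring.
Qed.

Lemma cowedge0 k x : cowedge x (fun _ : 'M[R]_(k, n) => 0) = fun=> 0.
Proof.
by apply/funext => v; rewrite /cowedge big1// => i _; rewrite !mulr0.
Qed.

Lemma cowedge_sum k x I (s : seq I) (P : pred I) (a : I -> 'M[R]_(k, n) -> R) :
  cowedge x (fun v => \sum_(i <- s | P i) a i v) =
  fun v => \sum_(i <- s | P i) cowedge x (a i) v.
Proof.
apply/funext => v; rewrite /cowedge exchange_big; apply: eq_bigr => i _ /=.
by rewrite !mulr_sumr.
Qed.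

Lemma cowedge_suml k I (s : seq I) (x : I -> 'rV[R]_n -> R) c
    (a : 'M[R]_(k, n) -> R) :
  cowedge (fun u => \sum_(i <- s) c i * x i u) a =
  fun v => \sum_(i <- s) c i * cowedge (x i) a v.
Proof.
apply/funext => v; rewrite /cowedge.
under [RHS]eq_bigr do rewrite mulr_sumr.
rewrite exchange_big; apply: eq_bigr => i _ /=.
by rewrite mulr_suml mulr_sumr; apply: eq_bigr => l _; ring.
Qed.

(** By contraction: the terms with [x e] and [y e] match crosswise, and what remains is the same
    identity one degree lower. *)
Lemma cowedge_anticomm k x y (a : 'M[R]_(k, n) -> R) :
  cowedge x (cowedge y a) = fun v => - cowedge y (cowedge x a) v.
Proof.
elim: k a => [|k IH] a; apply: contr_ext => e.
  rewrite contr_cowedge contr_cowedge0; apply/funext => v.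
  have -> : contr e (fun v => - cowedge y (cowedge x a) v) v =
    - contr e (cowedge y (cowedge x a)) v by [].
  by rewrite contr_cowedge contr_cowedge0 !cowedgeZ /=; ring.
rewrite contr_cowedge contr_cowedge cowedgeB cowedgeZ IH; apply/funext => v.
have -> : contr e (fun v => - cowedge y (cowedge x a) v) v =
  - contr e (cowedge y (cowedge x a)) v by [].
by rewrite contr_cowedge contr_cowedge cowedgeB cowedgeZ; ring.
Qed.

Lemma cowedge_cowedge_same k x (a : 'M[R]_(k, n) -> R) :
  cowedge x (cowedge x a) = fun=> 0.
Proof.
apply/funext => v; apply/eqP; have /eqP := congr1 (@^~ v) (cowedge_anticomm x x a).
by rewrite /= -addr_eq0 -mulr2n mulrn_eq0.
Qed.

End Contraction.

Section Skew.
Context {R : realType} {n : nat}.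
Implicit Types e u : 'rV[R]_n.

(** Multilinearity recast along the first row: linear there, with every contraction again of this
    kind. It is the shape that inductions on the degree need. *)
Fixpoint mlin k : ('M[R]_(k, n) -> R) -> Prop :=
  match k with
  | 0 => fun _ => True
  | k'.+1 => fun a =>
      (forall b c e e' (v : 'M[R]_(k', n)),
        contr (b *: e + c *: e') a v = b * contr e a v + c * contr e' a v) /\
      (forall e, mlin (contr e a))
  end.

Lemma multilinear_contr k (a : 'M[R]_(k.+1, n) -> R) e :
  multilinear a -> multilinear (contr e a).
Proof.
case: k a => [|k] a aM u v w i b c; first by case: i.
move=> uvw vu wu; apply: (aM _ _ _ (lift ord0 i)).
- by rewrite !rowS_col_mx.
- by rewrite !row'S_col_mx vu.
- by rewrite !row'S_col_mx wu.
Qed.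

Lemma row'_row'0 k (u v : 'M[R]_(k.+2, n)) (j : 'I_k.+1) :
  row' (lift ord0 j) u = row' (lift ord0 j) v ->
  row' j (row' ord0 u) = row' j (row' ord0 v).
Proof.
move=> uv; apply/matrixP => i l.
have := congr1 (fun t : 'M[R]_(k.+1, n) => t (lift ord0 i) l) uv.
by rewrite !mxE lift_lift0.
Qed.

Lemma multilinearP k (a : 'M[R]_(k, n) -> R) : multilinear a <-> mlin a.
Proof.
split.
- elim: k a => //= k IH a aM; split; last by move=> e; exact/IH/multilinear_contr.
  by move=> b c e e' v; apply: (aM _ _ _ ord0); rewrite ?row0_col_mx ?row'0_col_mx.
- elim: k a => [a _ u v w []//|k IH a [aL aM] u v w i b c].
  case: (unliftP ord0 i) => [j|] -> uvw vu wu; last first.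
    by rewrite (col_mx_row u) uvw (col_mx_row v) (col_mx_row w) vu wu !row0_col_mx; exact: aL.
  have row0E t : row' (lift ord0 j) t = row' (lift ord0 j) u -> row ord0 t = row ord0 u.
    by move=> tu; apply/rowP => l; rewrite !mxE; apply: (row'_eq tu).
  rewrite (col_mx_row u) (col_mx_row v) (col_mx_row w) (row0E _ vu) (row0E _ wu).
  case: k IH a aL aM u v w i b c j uvw vu wu row0E => [|k] IH a aL aM u v w i b c j uvw vu wu row0E.
    by case: j uvw vu wu row0E.
  apply: (IH _ (aM (row ord0 u)) _ _ _ j).
  + by apply/rowP => l; have := congr1 (fun t : 'rV[R]_n => t ord0 l) uvw; rewrite !mxE.
  + exact: row'_row'0.
  + exact: row'_row'0.
Qed.

Lemma contr_linear k (a : 'M[R]_(k.+1, n) -> R) b c e e' v : multilinear a ->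
  contr (b *: e + c *: e') a v = b * contr e a v + c * contr e' a v.
Proof. by case/multilinearP. Qed.

Lemma alternating_contr k (a : 'M[R]_(k.+1, n) -> R) e :
  Defs.alternating a -> Defs.alternating (contr e a).
Proof.
move=> aA v i j ij vij; apply: (aA _ (lift ord0 i) (lift ord0 j)).
  by rewrite (inj_eq lift_inj).
by rewrite !rowS_col_mx.
Qed.

Lemma contr_contr_same k (a : 'M[R]_(k.+2, n) -> R) e :
  Defs.alternating a -> contr e (contr e a) = fun=> 0.
Proof.
move=> aA; apply/funext => v; apply: (aA _ ord0 (lift ord0 ord0)) => //.
by rewrite row0_col_mx rowS_col_mx row0_col_mx.
Qed.

(** Polarisation: expand the double contraction with [e + u], whose diagonal terms vanish. *)
Lemma contr_anticomm k (a : 'M[R]_(k.+2, n) -> R) e u v :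
  multilinear a -> (forall e, contr e (contr e a) = fun=> 0) ->
  contr e (contr u a) v = - contr u (contr e a) v.
Proof.
move=> aM a0; have := congr1 (@^~ v) (a0 (1 *: e + 1 *: u)).
rewrite contr_linear; last exact: multilinear_contr.
have H t : contr t (contr (1 *: e + 1 *: u) a) v =
    contr t (contr e a) v + contr t (contr u a) v.
  by rewrite /contr -/(contr _ a _) contr_linear// !mul1r.
rewrite !H !mul1r !(congr1 (@^~ v) (a0 _)) add0r addr0 => /eqP.
by rewrite addr_eq0 => /eqP ->.
Qed.

(** Two equal rows away from the first are seen by a contraction. If the first row is one of them,
    exchanging the first two rows costs a sign and moves it to where a contraction sees the
    coincidence. *)
Lemma alternatingP k (a : 'M[R]_(k.+2, n) -> R) : multilinear a ->
  (forall e, contr e (contr e a) = fun=> 0) ->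
  (forall e, Defs.alternating (contr e a)) -> Defs.alternating a.
Proof.
move=> aM a0 aA; suff H v j : row ord0 v = row (lift ord0 j) v -> a v = 0.
  move=> v i j; case: (unliftP ord0 i) => [i'|] ->; case: (unliftP ord0 j) => [j'|] -> ij vij.
  - rewrite (col_mx_row v); apply: (aA _ _ i' j').
      by move: ij; rewrite (inj_eq lift_inj).
    by apply/rowP => l; have := congr1 (fun t : 'rV[R]_n => t ord0 l) vij; rewrite !mxE.
  - exact/H/esym/vij.
  - exact/H/vij.
  - by rewrite eqxx in ij.
move=> vj; rewrite (col_mx_row v) [X in col_mx _ X]col_mx_row.
set e := row ord0 v; set u := row ord0 _; set w := row' ord0 _.
have -> : a (col_mx e (col_mx u w)) = contr u (contr e a) w by [].
case: (unliftP ord0 j) => [j' jE|jE]; last first.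
  have -> : u = e; last by rewrite a0.
  by rewrite /u /e vj jE; apply/rowP => l; rewrite !mxE.
rewrite contr_anticomm//; apply/eqP; rewrite oppr_eq0; apply/eqP.
rewrite {1}/contr; apply: (aA u _ ord0 (lift ord0 j')) => //.
rewrite row0_col_mx rowS_col_mx /e vj jE.
by apply/rowP => l; rewrite !mxE.
Qed.

Definition skew k (a : 'M[R]_(k, n) -> R) := multilinear a /\ Defs.alternating a.

Lemma skew_deg0 (a : 'M[R]_(0, n) -> R) : skew a.
Proof. by split=> [? ? ? []|? []]. Qed.

Lemma skew_contr k (a : 'M[R]_(k.+1, n) -> R) e : skew a -> skew (contr e a).
Proof.
by move=> [aM aA]; split; [exact: multilinear_contr|exact: alternating_contr].
Qed.

Lemma skew_lin k (a b : 'M[R]_(k, n) -> R) r s : skew a -> skew b ->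
  skew (fun v => r * a v + s * b v).
Proof.
move=> [aM aA] [bM bA]; split.
- move=> u v w i p q uvw vu wu.
  by rewrite (aM _ _ _ _ _ _ uvw vu wu) (bM _ _ _ _ _ _ uvw vu wu); ring.
- by move=> v i j ij vij; rewrite (aA _ _ _ ij vij) (bA _ _ _ ij vij) !mulr0 addr0.
Qed.

Lemma skewZ k (a : 'M[R]_(k, n) -> R) r : skew a -> skew (fun v => r * a v).
Proof.
move=> aS; rewrite (_ : (fun v => _) = fun v => r * a v + 0 * a v).
  exact: skew_lin.
by apply/funext => v; rewrite mul0r addr0.
Qed.

Lemma skew0 k : skew (fun _ : 'M[R]_(k, n) => 0).
Proof. by split=> [u v w i b c _ _ _|v i j _ _] //; rewrite !mulr0 addr0. Qed.

Lemma skew_sum k I (s : seq I) (P : pred I) (a : I -> 'M[R]_(k, n) -> R) :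
  (forall i, skew (a i)) -> skew (fun v => \sum_(i <- s | P i) a i v).
Proof.
move=> aS; elim: s => [|i s IH].
  rewrite (_ : (fun v => _) = fun=> 0); first exact: skew0.
  by apply/funext => v; rewrite big_nil.
rewrite (_ : (fun v => _) = fun v => (P i)%:R * a i v + 1 * \sum_(i <- s | P i) a i v).
  exact: skew_lin.
by apply/funext => v; rewrite big_cons; case: (P i); rewrite ?mul1r// mul0r add0r.
Qed.

Lemma skew_comp k (a : 'M[R]_(k, n) -> R) (T : 'M[R]_n) :
  skew a -> skew (fun v => a (v *m T)).
Proof.
move=> [aM aA]; split=> [u v w i b c uvw vu wu|v i j ij vij].
- apply: (aM _ _ _ i).
  + by rewrite !row_mul uvw mulmxDl !scalemxAl.
  + by rewrite !row'Esub -!mul_rowsub_mx -!row'Esub vu.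
  + by rewrite !row'Esub -!mul_rowsub_mx -!row'Esub wu.
- by apply: (aA _ i j) => //; rewrite !row_mul vij.
Qed.

Definition covector (x : 'rV[R]_n -> R) :=
  forall b c e e', x (b *: e + c *: e') = b * x e + c * x e'.

Lemma multilinear_cowedge k x (a : 'M[R]_(k, n) -> R) : covector x ->
  multilinear a -> multilinear (cowedge x a).
Proof.
move=> xL; elim: k a => [|k IH] a aM; apply/multilinearP; split => //.
- by move=> b c e e' v; rewrite !contr_cowedge0 xL; ring.
- move=> b c e e' v; rewrite !contr_cowedge xL.
  have -> : contr (b *: e + c *: e') a = fun v => b * contr e a v + c * contr e' a v.
    by apply/funext => w; exact: contr_linear.
  by rewrite cowedge_lin; ring.
- move=> e; apply/multilinearP; rewrite contr_cowedge.
  move=> u v w i b c uvw vu wu; rewrite (aM _ _ _ _ _ _ uvw vu wu).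
  by rewrite (IH _ (multilinear_contr e aM) _ _ _ _ _ _ uvw vu wu); ring.
Qed.

Lemma skew_cowedge k x (a : 'M[R]_(k, n) -> R) : covector x ->
  skew a -> skew (cowedge x a).
Proof.
move=> xL [aM aA]; split; first exact: multilinear_cowedge.
elim: k a aM aA => [|k IH] a aM aA.
  by move=> v i j ij; rewrite [i]ord1 [j]ord1 eqxx in ij.
apply: alternatingP; first exact: multilinear_cowedge.
- move=> e; rewrite contr_cowedge; apply/funext => v.
  have -> : contr e (fun v => x e * a v - cowedge x (contr e a) v) v =
    x e * contr e a v - contr e (cowedge x (contr e a)) v by [].
  case: k IH a aM aA v => [|k] IH a aM aA v.
    by rewrite contr_cowedge0 subrr.
  by rewrite contr_cowedge contr_contr_same// cowedge0 subr0 subrr.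
- move=> e v i j ij vij; rewrite contr_cowedge (aA _ _ _ ij vij) mulr0 sub0r.
  rewrite (IH _ (multilinear_contr e aM) (alternating_contr e aA) _ _ _ ij vij).
  exact: oppr0.
Qed.

Lemma contr_sum k (a : 'M[R]_(k.+1, n) -> R) I (s : seq I) (c : I -> R)
    (e : I -> 'rV[R]_n) v : multilinear a ->
  contr (\sum_(i <- s) c i *: e i) a v = \sum_(i <- s) c i * contr (e i) a v.
Proof.
move=> aM; elim: s => [|i s IH].
  have := contr_linear 0 0 0 0 v aM.
  by rewrite !scale0r addr0 !mul0r addr0 !big_nil.
by rewrite !big_cons -IH -[in LHS](scale1r (\sum_(j <- s) _)) contr_linear// mul1r.
Qed.

Lemma contr_delta k (a : 'M[R]_(k.+1, n) -> R) e v : multilinear a ->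
  contr e a v = \sum_(j < n) e ord0 j * contr (delta_mx 0 j) a v.
Proof. by move=> aM; rewrite -contr_sum// -row_sum_delta. Qed.

Definition basis_rows k (f : 'I_k -> 'I_n) : 'M[R]_(k, n) :=
  \matrix_(i < k) delta_mx 0 (f i).

Lemma multilinear_basis k (a b : 'M[R]_(k, n) -> R) :
  multilinear a -> multilinear b ->
  (forall f, a (basis_rows f) = b (basis_rows f)) -> a = b.
Proof.
elim: k a b => [|k IH] a b aM bM ab.
  apply/funext => v; rewrite (_ : v = basis_rows (fun i : 'I_0 => False_rect 'I_n (notF (ltn_ord i)))) ?ab//.
  by apply/matrixP => - [].
apply/funext => v; rewrite (col_mx_row v) -/(contr _ a _) -/(contr _ b _).
rewrite (contr_delta _ _ aM) (contr_delta _ _ bM); apply: eq_bigr => j _; congr (_ * _).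
congr (_ _); apply: IH; [exact: multilinear_contr|exact: multilinear_contr|].
move=> f; rewrite /contr.
suff -> : col_mx (delta_mx 0 j : 'rV_n) (basis_rows f) =
    basis_rows (fun i => if unlift ord0 i is Some i' then f i' else j)
    :> 'M[R]_(k.+1, n) by exact: ab.
apply/matrixP => i l; case: (unliftP ord0 i) => [i'|] ->.
  by rewrite col_mx_S !mxE liftK.
by rewrite col_mx_0 !mxE unlift_none.
Qed.

End Skew.

(** * The wedge product through products with covectors *)

Section WedgeProduct.
Context {R : realType} {n : nat}.
Implicit Types e u : 'rV[R]_n.

(** A permutation of k + 1 letters is the image of one letter together with a permutation of the
    others. Injectivity and the count (k + 1) k! make the map a bijection. *)
Lemma sum_lift_perm k (i : 'I_k.+1) (F : 'S_k.+1 -> R) :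
  \sum_s F s = \sum_(j < k.+1) \sum_(s : 'S_k) F (lift_perm i j s).
Proof.
pose f (js : 'I_k.+1 * 'S_k) := lift_perm i js.1 js.2.
have f_inj : injective f.
  move=> [j s] [j' s'] /permP E.
  have jj' : j = j' by have := E i; rewrite !lift_perm_id.
  rewrite -{j'}jj' in E *; congr (_, _); apply/permP => l.
  by have := E (lift i l); rewrite !lift_perm_lift => /lift_inj.
have f_bij : bijective f.
  apply: inj_card_bij => //.
  by rewrite card_prod card_ord !card_Sn factS.
rewrite (reindex f) /=; last exact: onW_bij.
by rewrite [RHS]pair_bigA.
Qed.

Lemma row_perm_lift k l (v : 'M[R]_(k.+1 + l, n)) (i : 'I_k.+1)
    (j : 'I_(k + l).+1) (s : 'S_(k + l)) :
  let u : 'M[R]_(k.+1 + l, n) :=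
    row_perm (lift_perm (lshift l i : 'I_(k + l).+1) j s) v in
  [/\ row i (usubmx u) = row j v,
      row' i (usubmx u) = usubmx (row_perm s (row' j v)) &
      dsubmx u = dsubmx (row_perm s (row' j v))].
Proof.
move=> u; split; apply/matrixP => p q; rewrite !mxE.
- by rewrite (lift_perm_id (lshift l i : 'I_(k + l).+1)).
- have -> : lshift l (lift i p) = lift (lshift l i : 'I_(k + l).+1) (lshift l p).
    exact/val_inj.
  by rewrite lift_perm_lift.
- have -> : rshift k.+1 p = lift (lshift l i : 'I_(k + l).+1) (rshift k p).
    apply/val_inj => /=; rewrite /bump.
    by rewrite (leq_trans (leq_ord i) (leq_addr _ _)).
  by rewrite lift_perm_lift.
Qed.

(** Laplace expansion along the row that is fed to [x]. The k + 1 places of that row in the first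
    block give equal sums, and they cancel the new factor of (k + 1)!. *)
Lemma wedge_cowedge k l (x : 'rV[R]_n -> 'rV[R]_n -> R) (a : diff_form R n k)
    (b : diff_form R n l) :
  wedge (fun p => cowedge (x p) (a p)) b = fun p => cowedge (x p) (wedge a b p).
Proof.
apply/funext => p; apply/funext => v; rewrite /wedge.
under eq_bigr do rewrite mulr_suml mulr_sumr.
rewrite exchange_big /=.
have signM (s1 s2 s3 y c d : R) : s1 * s1 = 1 ->
    s1 * s2 * s3 * (s1 * (y * c) * d) = s2 * (y * (s3 * (c * d))).
  by move=> s1E; rewrite -[RHS]mul1r -s1E; ring.
have E (i : 'I_k.+1) : \sum_(s : 'S_(k.+1 + l)) (-1) ^+ s *
    ((-1) ^+ i * (x p (row i (usubmx (row_perm s v))) *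
       a p (row' i (usubmx (row_perm s v)))) * b p (dsubmx (row_perm s v))) =
    \sum_(j < (k + l).+1) (-1) ^+ j * (x p (row j v) *
      \sum_(s : 'S_(k + l)) (-1) ^+ s * (a p (usubmx (row_perm s (row' j v))) *
         b p (dsubmx (row_perm s (row' j v))))).
  rewrite (sum_lift_perm (lshift l i : 'I_(k + l).+1)); apply: eq_bigr => j _.
  rewrite !mulr_sumr; apply: eq_bigr => s _.
  have [-> -> ->] := row_perm_lift v i j s.
  rewrite odd_lift_perm !signr_addb !signr_odd /=.
  by rewrite signM// -signr_odd -expr2 sqrr_sign.
rewrite (eq_bigr _ (fun i _ => E i)) sumr_const card_ord /cowedge.
rewrite factS -mulnA natrM invfM -[X in _ * X = _]mulr_natl mulrACA mulVf ?pnatr_eq0// mul1r.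
rewrite mulr_sumr; apply: eq_bigr => j _; rewrite /wedge mulrCA; congr (_ * _).
exact: mulrCA.
Qed.

(** Polarisation again: [r x y] puts x and y in places i and j, and the form vanishes when both
    places hold the sum of the two rows. *)
Lemma skew_swap k (a : 'M[R]_(k, n) -> R) i j v : skew a -> i != j ->
  a (row_perm (tperm i j) v) = - a v.
Proof.
move=> [aM aA] ij.
pose r (x y : 'rV[R]_n) : 'M[R]_(k, n) :=
  \matrix_l (if l == i then x else if l == j then y else row l v).
have ri x y : row i (r x y) = x by rewrite rowK eqxx.
have rj x y : row j (r x y) = y by rewrite rowK eqxx eq_sym (negbTE ij).
have r1 x x' y : a (r (1 *: x + 1 *: x') y) = a (r x y) + a (r x' y).
  rewrite (aM _ (r x y) (r x' y) i 1 1) ?ri ?mul1r//;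
  by apply/row_matrixP => l; apply/rowP => c; rewrite !mxE eq_sym (negbTE (neq_lift _ _)).
have r2 x y y' : a (r x (1 *: y + 1 *: y')) = a (r x y) + a (r x y').
  rewrite (aM _ (r x y) (r x y') j 1 1) ?rj ?mul1r//;
  by apply/row_matrixP => l; apply/rowP => c; rewrite !mxE [lift j l == j]eq_sym (negbTE (neq_lift _ _)).
have r0 x : a (r x x) = 0 by apply: (aA _ i j) => //; rewrite ri rj.
have := r0 (1 *: row i v + 1 *: row j v); rewrite r1 !r2 !r0 add0r addr0.
have -> : r (row i v) (row j v) = v.
  by apply/row_matrixP => l; rewrite rowK; case: eqP => [->//|_]; case: eqP => [->//|].
have -> : r (row j v) (row i v) = row_perm (tperm i j) v.
  apply/row_matrixP => l; rewrite rowK.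
  have -> : row l (row_perm (tperm i j) v) = row (tperm i j l) v.
    by apply/rowP => c; rewrite !mxE.
  case: (eqVneq l i) => [->|li]; first by rewrite tpermL.
  by case: (eqVneq l j) => [->|lj]; rewrite ?tpermR// tpermD// eq_sym.
by move/eqP; rewrite addrC addr_eq0 => /eqP ->.
Qed.

Lemma skew_perm k (a : 'M[R]_(k, n) -> R) s v : skew a ->
  a (row_perm s v) = (-1) ^+ s * a v.
Proof.
move=> aS; have [ts -> tsP] := prod_tpermP s; rewrite odd_perm_prod// signr_odd.
elim: ts tsP => [|[i j] ts IH] /=.
  by rewrite big_nil row_perm1 mul1r.
by move=> /andP[ij tsP]; rewrite big_cons row_permM skew_swap// IH// exprS; ring.
Qed.

Lemma wedge_one k (a : diff_form R n k) p : skew (a p) ->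
  wedge ((fun _ _ => 1) : diff_form R n 0) a p = a p.
Proof.
move=> aS; apply/funext => v; rewrite /wedge.
have E (s : 'S_(0 + k)) : (-1) ^+ s * (1 * a p (dsubmx (row_perm s v))) = a p v.
  have -> : dsubmx (row_perm s v) = row_perm s v.
    by apply/matrixP => i j; rewrite [LHS]mxE; congr (fun_of_matrix _ _); exact/val_inj.
  by rewrite mul1r skew_perm// mulrA -expr2 sqrr_sign mul1r.
rewrite (eq_bigr _ (fun i _ => E i)) sumr_const card_Sn fact0 mul1n.
by rewrite -[X in _ * X]mulr_natl mulrA mulVf ?mul1r// pnatr_eq0 -lt0n fact_gt0.
Qed.

Definition crd (j : 'I_n) : 'rV[R]_n -> R := fun v => v ord0 j.

Lemma covector_crd j : covector (crd j).
Proof. by move=> b c e e'; rewrite /crd !mxE. Qed.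

(** Moving any of the k + 1 rows to the front restores [a v] up to the sign that [cowedge] supplies,
    so each row contributes [a v] once. *)
Lemma euler k (a : 'M[R]_(k.+1, n) -> R) v : skew a ->
  \sum_(j < n) cowedge (crd j) (contr (delta_mx 0 j) a) v = k.+1%:R * a v.
Proof.
move=> aS; rewrite /cowedge exchange_big /=.
have E (i : 'I_k.+1) : \sum_(j < n) (-1) ^+ i *
    (crd j (row i v) * contr (delta_mx 0 j) a (row' i v)) = a v.
  rewrite -mulr_sumr -contr_delta; last by case: aS.
  rewrite /contr; have -> : col_mx (row i v) (row' i v) =
    row_perm (lift_perm ord0 i 1) v :> 'M[R]_(k.+1, n); last first.
    rewrite skew_perm// mulrA odd_lift_perm odd_perm1 addbF /= signr_odd -expr2 -signr_odd.
    by rewrite sqrr_sign mul1r.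
  apply/matrixP => l c; case: (unliftP ord0 l) => [l'|] ->.
    by rewrite [LHS]col_mx_S !mxE lift_perm_lift perm1.
  by rewrite [LHS]col_mx_0 !mxE lift_perm_id.
by rewrite (eq_bigr _ (fun i _ => E i)) sumr_const card_ord mulr_natl.
Qed.

Lemma skew_overdim k (a : 'M[R]_(k, n) -> R) : (n < k)%N -> skew a -> a = fun=> 0.
Proof.
move=> nk [aM aA]; apply: multilinear_basis => //; first by case: (skew0 (R:=R) (n:=n) k).
move=> f; have : ~~ injectiveb f.
  by apply/negP => /injectiveP /leq_card; rewrite !card_ord leqNgt nk.
move=> /injectivePn[i [j ij fij]].
by apply: (aA _ i j) => //; rewrite !rowK fij.
Qed.

End WedgeProduct.

Lemma skew_top {R : realType} n (a : 'M[R]_n -> R) v : skew a ->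
  a v = a 1%:M * \det v.
Proof.
move=> aS; have [aM aA] := aS.
have E : a = fun v => a 1%:M * \det v; last by rewrite {1}E.
apply: multilinear_basis => //.
  move=> x y z i b c xyz yx zx; rewrite (determinant_multilinear xyz yx zx); ring.
move=> f; case: (boolP (injectiveb f)) => [/injectiveP f_inj|].
  have -> : basis_rows f = row_perm (perm f_inj) 1%:M :> 'M[R]_n.
    by apply/matrixP => i j; rewrite !mxE permE eqxx eq_sym.
  rewrite skew_perm// -/(perm_mx _) det_perm; exact: mulrC.
move=> /injectivePn[i [j ij fij]].
rewrite (aA _ i j)// ?rowK ?fij//.
rewrite (determinant_alternate ij) ?mulr0// => c.
by rewrite !mxE fij.
Qed.

Lemma skew_top_mul {R : realType} n (a : 'M[R]_n -> R) v T : skew a ->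
  a (v *m T) = \det T * a v.
Proof.
by move=> aS; rewrite (skew_top _ aS) [in RHS](skew_top _ aS) det_mulmx; ring.
Qed.

(** * The operator L and the sl2-relations *)

Section Lefschetz.
Context {R : realType} {n : nat}.
Implicit Types (W V : 'M[R]_n) (e : 'rV[R]_n).

(** The contraction with [e] of the 2-form of Gram matrix [W]. *)
Definition mx_covector W e : 'rV[R]_n -> R := fun u => (e *m W *m u^T) 0 0.

(* Exterior product with the 2-form of Gram matrix W; [lam V] is the dual
   contraction by the bivector V. *)
Definition lef W k (a : 'M[R]_(k, n) -> R) : 'M[R]_(k.+2, n) -> R :=
  fun v => 2^-1 * \sum_i \sum_j W i j * cowedge (crd i) (cowedge (crd j) a) v.

Definition lam V k (a : 'M[R]_(k.+2, n) -> R) : 'M[R]_(k, n) -> R :=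
  fun v => 2^-1 * \sum_i \sum_j
    V i j * contr (delta_mx 0 j) (contr (delta_mx 0 i) a) v.

Definition gram (w : 'M[R]_(2, n) -> R) : 'M[R]_n :=
  \matrix_(i, j) w (col_mx (delta_mx 0 i : 'rV_n) (delta_mx 0 j : 'rV_n)).

Lemma skew_lef W k (a : 'M[R]_(k, n) -> R) : skew a -> skew (lef W a).
Proof.
move=> aS; apply: skewZ; apply: skew_sum => i; apply: skew_sum => j.
by apply: skewZ; do 2 (apply: skew_cowedge; first exact: covector_crd).
Qed.

Lemma skew_lam V k (a : 'M[R]_(k.+2, n) -> R) : skew a -> skew (lam V a).
Proof.
move=> aS; apply: skewZ; apply: skew_sum => i; apply: skew_sum => j.
by apply: skewZ; do 2 apply: skew_contr.
Qed.

Lemma lef_lin W k (a b : 'M[R]_(k, n) -> R) r s :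
  lef W (fun v => r * a v + s * b v) = fun v => r * lef W a v + s * lef W b v.
Proof.
apply/funext => v; rewrite /lef.
rewrite [r * _]mulrCA [s * _]mulrCA -mulrDr; congr (_ * _).
rewrite !mulr_sumr -big_split; apply: eq_bigr => i _ /=; rewrite !mulr_sumr -big_split; apply: eq_bigr => j _ /=.
by rewrite !cowedge_lin; ring.
Qed.

Lemma lefZ W k (a : 'M[R]_(k, n) -> R) r :
  lef W (fun v => r * a v) = fun v => r * lef W a v.
Proof.
have -> : (fun v => r * a v) = fun v => r * a v + 0 * a v.
  by apply/funext => v; rewrite mul0r addr0.
by rewrite lef_lin; apply/funext => v; rewrite mul0r addr0.
Qed.

Lemma lefB W k (a b : 'M[R]_(k, n) -> R) :
  lef W (fun v => a v - b v) = fun v => lef W a v - lef W b v.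
Proof.
have -> : (fun v => a v - b v) = fun v => 1 * a v + -1 * b v.
  by apply/funext => v; rewrite mul1r mulN1r.
by rewrite lef_lin; apply/funext => v; rewrite mul1r mulN1r.
Qed.

Lemma lef0 W k : lef W (fun _ : 'M[R]_(k, n) => 0) = fun=> 0.
Proof.
apply/funext => v; rewrite /lef big1 ?mulr0// => i _; rewrite big1// => j _.
by rewrite !cowedge0 mulr0.
Qed.

Lemma lamZ V k (a : 'M[R]_(k.+2, n) -> R) r :
  lam V (fun v => r * a v) = fun v => r * lam V a v.
Proof.
apply/funext => v; rewrite /lam mulrCA; congr (_ * _).
rewrite mulr_sumr; apply: eq_bigr => i _; rewrite mulr_sumr; apply: eq_bigr => j _.
by rewrite /contr; ring.
Qed.

Lemma wedgeZl k l c (a : diff_form R n k) (b : diff_form R n l) p v :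
  wedge (fun q u => c * a q u) b p v = c * wedge a b p v.
Proof.
rewrite /wedge mulrCA; congr (_ * _); rewrite mulr_sumr; apply: eq_bigr => s _.
by rewrite -mulrA mulrCA.
Qed.

Lemma wedge_suml k l I (r : seq I) (a : I -> diff_form R n k)
    (b : diff_form R n l) p v :
  wedge (fun q u => \sum_(i <- r) a i q u) b p v =
  \sum_(i <- r) wedge (a i) b p v.
Proof.
rewrite /wedge -mulr_sumr exchange_big; congr (_ * _); apply: eq_bigr => s _ /=.
by rewrite mulr_suml mulr_sumr.
Qed.

Lemma wedge_lef k l W (b : diff_form R n k) (a : diff_form R n l) p :
  wedge (fun q => lef W (b q)) a p = lef W (wedge b a p).
Proof.
pose A i j : diff_form R n k.+2 := fun q => cowedge (crd i) (cowedge (crd j) (b q)).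
have AE i j : wedge (A i j) a p = cowedge (crd i) (cowedge (crd j) (wedge b a p)).
  by rewrite (wedge_cowedge (fun=> crd i) (fun q => cowedge (crd j) (b q)))
             (wedge_cowedge (fun=> crd j)).
apply/funext => v; rewrite wedgeZl; congr (_ * _).
rewrite (wedge_suml _ (fun i q v => \sum_j W i j * A i j q v)); apply: eq_bigr => i _.
rewrite (wedge_suml _ (fun j q v => W i j * A i j q v)); apply: eq_bigr => j _.
by rewrite wedgeZl AE.
Qed.

(** [wedge] is pointwise, so at a fixed point a form may be traded for one with frozen
    coefficients. *)
Lemma wedge_ext k l (a a' : diff_form R n k) (b b' : diff_form R n l) p :
  a p = a' p -> b p = b' p -> wedge a b p = wedge a' b' p.
Proof. by move=> aE bE; apply/funext => v; rewrite /wedge aE bE. Qed.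

(** Euler's identity in degrees 2 and then 1 rebuilds [w] from its values on basis pairs; its factor
    2 is the one that [lef] divides out. *)
Lemma lef_gram1 (w : 'M[R]_(2, n) -> R) :
  skew w -> lef (gram w) (fun _ : 'M[R]_(0, n) => 1) = w.
Proof.
move=> wS; apply/funext => v; have := euler v wS; rewrite /lef => E.
apply: (@mulfI _ 2) => //; rewrite -E mulrA divff// mul1r.
apply: eq_bigr => i _.
have -> : contr (delta_mx 0 i) w =
    fun v => \sum_j gram w i j * cowedge (crd j) (fun _ : 'M[R]_(0, n) => 1) v.
  apply/funext => u; have := euler u (skew_contr (delta_mx 0 i) wS); rewrite mul1r => <-.
  apply: eq_bigr => j _.
  suff -> : contr (delta_mx 0 j) (contr (delta_mx 0 i) w) =
      fun=> gram w i j * 1 by rewrite cowedgeZ.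
  apply/funext => z; rewrite mulr1 mxE /contr; congr (w _).
  apply/matrixP => s t; case: (unliftP ord0 s) => [s'|] ->; last first.
    by rewrite [LHS]col_mx_0 [RHS]col_mx_0.
  by rewrite [LHS]col_mx_S [RHS]col_mx_S [s']ord1 [LHS]col_mx_0.
by rewrite cowedge_sum; apply: eq_bigr => j _; rewrite cowedgeZ.
Qed.

Lemma wedge2 k (w : diff_form R n 2) (a : diff_form R n k) p :
  skew (w p) -> skew (a p) -> wedge w a p = lef (gram (w p)) (a p).
Proof.
move=> wS aS; pose one : diff_form R n 0 := fun _ _ => 1.
rewrite (wedge_ext (a' := fun q => lef (gram (w p)) (one q)) (b' := a))//.
  by rewrite wedge_lef wedge_one.
by rewrite lef_gram1.
Qed.

End Lefschetz.

Section Sl2.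
Context {R : realType} {n : nat}.
Variables W V : 'M[R]_n.
Hypotheses (W_skew : W^T = - W) (V_skew : V^T = - V) (VW : V *m W = 1%:M).

Lemma cowedge_mx k i (a : 'M[R]_(k, n) -> R) v :
  cowedge (mx_covector W (delta_mx 0 i)) a v =
  \sum_j W i j * cowedge (crd j) a v.
Proof.
have -> : mx_covector W (delta_mx 0 i) = fun u => \sum_j W i j * crd j u.
  apply/funext => u; rewrite /mx_covector -rowE !mxE; apply: eq_bigr => j _.
  by rewrite !mxE.
by rewrite cowedge_suml.
Qed.

Lemma skew_coefE i j : W i j = - W j i.
Proof. by have /matrixP/(_ j i) := W_skew; rewrite !mxE. Qed.

(** Contracting a product of two coordinate covectors leaves two terms, which skewness of [W] makes
    equal after summation; hence no factor 1/2 survives. *)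
Lemma contr_lef_terms k e (a : 'M[R]_(k, n) -> R) v :
  2^-1 * \sum_i \sum_j W i j * (crd i e * cowedge (crd j) a v - crd j e * cowedge (crd i) a v) =
  cowedge (mx_covector W e) a v.
Proof.
have -> : mx_covector W e = fun u => \sum_i crd i e * mx_covector W (delta_mx 0 i) u.
  apply/funext => u; rewrite {1}/mx_covector [e in LHS]row_sum_delta !mulmx_suml summxE.
  by apply: eq_bigr => i _; rewrite -!scalemxAl mxE.
rewrite cowedge_suml.
have -> : \sum_i \sum_j W i j * (crd i e * cowedge (crd j) a v - crd j e * cowedge (crd i) a v) =
    (\sum_i \sum_j W i j * (crd i e * cowedge (crd j) a v)) *+ 2.
  rewrite mulr2n [X in _ = _ + X]exchange_big -big_split; apply: eq_bigr => i _ /=.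
  rewrite -big_split; apply: eq_bigr => j _ /=.
  by rewrite (skew_coefE j i); ring.
rewrite -[X in _ * X = _]mulr_natl mulrA mulVf ?pnatr_eq0// mul1r.
apply: eq_bigr => i _.
by rewrite cowedge_mx mulr_sumr; apply: eq_bigr => j _; ring.
Qed.

Lemma contr_lef0 e (a : 'M[R]_(0, n) -> R) :
  contr e (lef W a) = cowedge (mx_covector W e) a.
Proof.
apply/funext => v; rewrite -contr_lef_terms /contr /lef; congr (_ * _).
apply: eq_bigr => i _; apply: eq_bigr => j _.
rewrite -/(contr e (cowedge (crd i) (cowedge (crd j) a)) v) contr_cowedge contr_cowedge0.
by rewrite cowedgeZ.
Qed.

Lemma contr_lef k e (a : 'M[R]_(k.+1, n) -> R) :
  contr e (lef W a) = fun v => cowedge (mx_covector W e) a v + lef W (contr e a) v.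
Proof.
apply/funext => v; rewrite -contr_lef_terms /contr /lef -mulrDr; congr (_ * _).
rewrite -big_split; apply: eq_bigr => i _; rewrite -big_split; apply: eq_bigr => j _ /=.
rewrite -/(contr e (cowedge (crd i) (cowedge (crd j) a)) v) contr_cowedge contr_cowedge.
by rewrite cowedgeB cowedgeZ; ring.
Qed.

Lemma lef_sum k I (s : seq I) (c : I -> R) (a : I -> 'M[R]_(k, n) -> R) :
  lef W (fun v => \sum_(i <- s) c i * a i v) = fun v => \sum_(i <- s) c i * lef W (a i) v.
Proof.
elim: s => [|i s IH].
  under eq_fun do rewrite big_nil; rewrite lef0.
  by apply/funext => v; rewrite big_nil.
under eq_fun do rewrite big_cons.
have -> : (fun v => c i * a i v + \sum_(j <- s) c j * a j v) =
    fun v => c i * a i v + 1 * \sum_(j <- s) c j * a j v.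
  by apply/funext => v; rewrite mul1r.
by rewrite lef_lin IH; apply/funext => v; rewrite big_cons mul1r.
Qed.

(** The trace of V W = 1 with the indices of W exchanged, which costs a sign. *)
Lemma sum_VW : \sum_i \sum_j V i j * W i j = - n%:R.
Proof.
rewrite -[n in RHS]card_ord -sumr_const -sumrN; apply: eq_bigr => i _.
have /matrixP/(_ i i) := VW; rewrite !mxE eqxx mulr1n => <-.
by rewrite -sumrN; apply: eq_bigr => j _; rewrite (skew_coefE i j); ring.
Qed.

Lemma sum_V_covector_r k (b : 'I_n -> 'M[R]_(k, n) -> R) v :
  \sum_i \sum_j V i j * cowedge (mx_covector W (delta_mx 0 j)) (b i) v =
  \sum_i cowedge (crd i) (b i) v.
Proof.
apply: eq_bigr => i _; under eq_bigr => j _ do rewrite cowedge_mx mulr_sumr.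
rewrite exchange_big /= (bigD1 i) //= [X in _ + X]big1 ?addr0 => [|l li].
  have /matrixP/(_ i i) := VW; rewrite !mxE eqxx mulr1n => E.
  by rewrite -[RHS]mul1r -E mulr_suml; apply: eq_bigr => j _; ring.
have /matrixP/(_ i l) := VW; rewrite !mxE eq_sym (negbTE li) mulr0n => E.
transitivity ((\sum_j V i j * W j l) * cowedge (crd l) (b i) v); last by rewrite E mul0r.
by rewrite mulr_suml; apply: eq_bigr => j _; ring.
Qed.

Lemma sum_V_covector_l k (b : 'I_n -> 'M[R]_(k, n) -> R) v :
  \sum_i \sum_j V i j * cowedge (mx_covector W (delta_mx 0 i)) (b j) v =
  - \sum_i cowedge (crd i) (b i) v.
Proof.
rewrite -sum_V_covector_r exchange_big -sumrN; apply: eq_bigr => i _ /=.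
rewrite -sumrN; apply: eq_bigr => j _; have /matrixP/(_ i j) := V_skew.
by rewrite !mxE => ->; ring.
Qed.

Lemma mx_covector_delta i j : mx_covector W (delta_mx 0 i) (delta_mx 0 j) = W i j.
Proof.
rewrite /mx_covector -rowE !mxE (bigD1 j)//= big1 ?addr0 ?mxE ?eqxx ?mulr1// => l lj.
by rewrite !mxE [l == j](negbTE lj) mulr0.
Qed.

(** Degrees 0 and 1 of the commutation relation are stated apart: there Lambda a would have negative
    degree, and the term L Lambda a is absent. *)
Lemma lam_lef0 (a : 'M[R]_(0, n) -> R) :
  lam V (lef W a) = fun v => - (n%:R / 2) * a v.
Proof.
apply/funext => v; rewrite /lam.
under eq_bigr => i _ do under eq_bigr => j _ do
  rewrite contr_lef0 contr_cowedge0 mx_covector_delta mulrA.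
under eq_bigr => i _ do rewrite -mulr_suml.
by rewrite -mulr_suml sum_VW; field.
Qed.

Lemma lam_lef1 (a : 'M[R]_(1, n) -> R) : skew a ->
  lam V (lef W a) = fun v => (1 - n%:R / 2) * a v.
Proof.
move=> aS; apply/funext => v; rewrite /lam.
under eq_bigr => i _ do under eq_bigr => j _ do rewrite contr_lef.
have E i j : contr (delta_mx 0 j) (fun v => cowedge (mx_covector W (delta_mx 0 i)) a v +
    lef W (contr (delta_mx 0 i) a) v) v =
  W i j * a v - cowedge (mx_covector W (delta_mx 0 i)) (contr (delta_mx 0 j) a) v +
   cowedge (mx_covector W (delta_mx 0 j)) (contr (delta_mx 0 i) a) v.
  rewrite -[LHS]/(contr _ (cowedge _ a) v + contr _ (lef W (contr _ a)) v).
  by rewrite contr_cowedge contr_lef0 mx_covector_delta.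
under eq_bigr => i _ do under eq_bigr => j _ do rewrite E mulrDr mulrBr mulrA.
under eq_bigr => i _ do rewrite big_split sumrB -mulr_suml /=.
rewrite big_split sumrB -mulr_suml /= sum_VW sum_V_covector_l sum_V_covector_r.
by rewrite euler//; field.
Qed.

(* The classical relation is [L, Lambda] = degree - n/2; taking for V the inverse
   of W rather than its opposite reverses the sign. *)
Lemma lam_lef k (a : 'M[R]_(k.+2, n) -> R) : skew a ->
  lam V (lef W a) = fun v => lef W (lam V a) v + (k.+2%:R - n%:R / 2) * a v.
Proof.
move=> aS; apply/funext => v; rewrite {1}/lam.
under eq_bigr => i _ do under eq_bigr => j _ do rewrite contr_lef.
have E i j : contr (delta_mx 0 j) (fun v => cowedge (mx_covector W (delta_mx 0 i)) a v +
    lef W (contr (delta_mx 0 i) a) v) v =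
  W i j * a v - cowedge (mx_covector W (delta_mx 0 i)) (contr (delta_mx 0 j) a) v +
   cowedge (mx_covector W (delta_mx 0 j)) (contr (delta_mx 0 i) a) v +
   lef W (contr (delta_mx 0 j) (contr (delta_mx 0 i) a)) v.
  rewrite -[LHS]/(contr _ (cowedge _ a) v + contr _ (lef W (contr _ a)) v).
  by rewrite contr_cowedge contr_lef mx_covector_delta addrA.
under eq_bigr => i _ do under eq_bigr => j _ do rewrite E !mulrDr mulrN mulrA.
under eq_bigr => i _ do rewrite !big_split sumrN -mulr_suml /=.
rewrite !big_split sumrN -mulr_suml /= sum_VW sum_V_covector_l sum_V_covector_r.
rewrite euler// /lam lefZ.
have -> : lef W (fun u => \sum_i \sum_j V i j *
      contr (delta_mx 0 j) (contr (delta_mx 0 i) a) u) v =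
    \sum_i \sum_j V i j * lef W (contr (delta_mx 0 j) (contr (delta_mx 0 i) a)) v.
  have -> : (fun u => \sum_i \sum_j V i j *
      contr (delta_mx 0 j) (contr (delta_mx 0 i) a) u) = fun u => \sum_i 1 *
      \sum_j V i j * contr (delta_mx 0 j) (contr (delta_mx 0 i) a) u.
    by apply/funext => u; apply: eq_bigr => i _; rewrite mul1r.
  rewrite (lef_sum _ (fun=> 1)).
  by apply: eq_bigr => i _; rewrite mul1r lef_sum.
by field.
Qed.

End Sl2.

(** For a covector x with x(e) nonzero, x /\ a vanishes by degree; contracting with [e] gives x(e) a
    = x /\ iota_e a, which is zero. *)
Lemma skew_top_contr0 {R : realType} n (a : 'M[R]_n.+1 -> R) e :
  skew a -> e != 0 -> contr e a = (fun=> 0) -> a = fun=> 0.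
Proof.
move=> aS e0 ea0; have [j ej] : exists j, e ord0 j != 0.
  by apply/existsP; apply: contraNT e0 => /existsPn ej; apply/eqP/rowP => j;
    rewrite mxE; apply/eqP; rewrite -[_ == _]negbK ej.
apply/funext => v; have := contr_cowedge e (crd j) a.
rewrite (skew_overdim _ (skew_cowedge (covector_crd j) aS))// ea0 cowedge0.
move=> /(congr1 (@^~ v)); rewrite subr0 => /esym/eqP.
by rewrite mulf_eq0 /crd (negbTE ej) => /eqP.
Qed.

Lemma skew_gram {R : realType} n (w : 'M[R]_(2, n) -> R) :
  skew w -> (gram w)^T = - gram w.
Proof.
move=> wS; apply/matrixP => i j; rewrite !mxE.
rewrite -(skew_swap (i := ord0) (j := lift ord0 ord0) _ wS)//; congr (w _).
apply/matrixP => s t; rewrite [RHS]mxE; case: (unliftP ord0 s) => [s'|] ->; last first.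
  by rewrite tpermL [LHS]col_mx_0 [RHS]col_mx_S.
by rewrite [s']ord1 tpermR [LHS]col_mx_S [RHS]col_mx_0.
Qed.

(** * Hard Lefschetz for a nondegenerate 2-form on R^6 *)

Section HardLefschetz6.
Context {R : realType}.
Variable W : 'M[R]_6.
Hypothesis W_skew : W^T = - W.

(** A kernel vector of [W] has zero contraction with the 2-form, so contraction by it passes through
    every L and finds nothing to contract in degree 0. *)
Lemma contr_lef3_0 e (a : 'M[R]_(0, 6) -> R) : e *m W = 0 ->
  contr e (lef W (lef W (lef W a))) = fun=> 0.
Proof.
move=> eW0; have aW0 : mx_covector W e = fun u => \sum_(i <- [::] : seq 'I_6) 0 * crd i u.
  by apply/funext => u; rewrite big_nil /mx_covector eW0 mul0mx mxE.
have cow0 k (b : 'M[R]_(k, 6) -> R) : cowedge (mx_covector W e) b = fun=> 0.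
  by rewrite aW0 cowedge_suml; apply/funext => v; rewrite big_nil.
have lef_contr0 k (b : 'M[R]_(k.+1, 6) -> R) :
    contr e b = (fun=> 0) -> contr e (lef W b) = fun=> 0.
  by move=> b0; rewrite contr_lef// b0 lef0 cow0; apply/funext => v; rewrite addr0.
by do 2 apply: (lef_contr0 _ _); rewrite contr_lef0// cow0.
Qed.

Lemma lef3_unit (a : 'M[R]_(0, 6) -> R) :
  lef W (lef W (lef W a)) <> (fun=> 0) -> W \in unitmx.
Proof.
move=> W3; rewrite -row_free_unit -kermx_eq0; apply/negPn/negP => /rowV0Pn[e].
move=> /sub_kermxP eW0 e0; apply: W3; apply: (skew_top_contr0 _ e0).
  by do 3 apply: skew_lef; exact: skew_deg0.
exact: contr_lef3_0.
Qed.

Variable V : 'M[R]_6.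
Hypotheses (V_skew : V^T = - V) (VW : V *m W = 1%:M).

Lemma lam0 k : lam V (fun _ : 'M[R]_(k.+2, 6) => 0) = fun=> 0.
Proof.
have := lamZ V (fun _ : 'M[R]_(k.+2, 6) => 0) 0.
rewrite (_ : (fun _ => _) = fun=> 0); last by apply/funext => v; rewrite mul0r.
by move=> ->; apply/funext => v; rewrite mul0r.
Qed.

(** Lambda lowers L^3 a, L^2 a and L a to -3, -4 and -3 times the previous power. No coefficient
    vanishes, so one can descend to [a]. *)
Lemma lef3_inj (a : 'M[R]_(0, 6) -> R) :
  lef W (lef W (lef W a)) = (fun=> 0) -> a = fun=> 0.
Proof.
move=> a0; have aS := skew_deg0 a.
have E0 := lam_lef0 W_skew VW a.
have E1 v : lam V (lef W (lef W a)) v = - 4 * lef W a v.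
  rewrite (lam_lef W_skew V_skew VW (skew_lef W aS)) E0 lefZ; lra.
have E2 v : lam V (lef W (lef W (lef W a))) v = - 3 * lef W (lef W a) v.
  rewrite (lam_lef W_skew V_skew VW (skew_lef W (skew_lef W aS))).
  have -> : lam V (lef W (lef W a)) = fun v => - 4 * lef W a v by exact/funext.
  rewrite lefZ; lra.
have La2 : lef W (lef W a) = fun=> 0.
  by apply/funext => v; have := E2 v; rewrite a0 lam0; lra.
have La1 : lef W a = fun=> 0.
  by apply/funext => v; have := E1 v; rewrite La2 lam0; lra.
apply/funext => v; have := congr1 (@^~ v) E0.
by rewrite /= La1 lam0; lra.
Qed.

(** The same descent; in degree 1 both coefficients are -2. *)
Lemma lef2_inj (a : 'M[R]_(1, 6) -> R) : skew a ->
  lef W (lef W a) = (fun=> 0) -> a = fun=> 0.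
Proof.
move=> aS a0.
have E1 := lam_lef1 W_skew V_skew VW aS.
have E2 v : lam V (lef W (lef W a)) v = - 2 * lef W a v.
  rewrite (lam_lef W_skew V_skew VW (skew_lef W aS)) E1 lefZ; lra.
have La1 : lef W a = fun=> 0.
  by apply/funext => v; have := E2 v; rewrite a0 lam0; lra.
by apply/funext => v; have := congr1 (@^~ v) E1; rewrite /= La1 lam0; lra.
Qed.

(** In degree 2 the first step is of another kind, as [a] need not be primitive: L a = 0 gives a = L
    Lambda a, and then the function Lambda a equals -3 times itself. *)
Lemma lef1_inj (a : 'M[R]_(2, 6) -> R) : skew a ->
  lef W a = (fun=> 0) -> a = fun=> 0.
Proof.
move=> aS a0.
have E1 v : a v = lef W (lam V a) v.
  have := congr1 (@^~ v) (lam_lef W_skew V_skew VW aS); rewrite /= a0 lam0; lra.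
have E2 v : lam V a v = - 3 * lam V a v.
  have {1}-> : a = lef W (lam V a) by exact/funext.
  by rewrite (lam_lef0 W_skew VW); lra.
have La0 : lam V a = fun=> 0 by apply/funext => v; have := E2 v; lra.
by apply/funext => v; rewrite E1 La0 lef0.
Qed.

(** L vanishes on degree 5 by dimension, so the relation reads L Lambda c = -2 c. One more step
    gives L^2 Lambda^2 c = 4 c, whence the factor 1/4. *)
Lemma lef2_surj (c : 'M[R]_(5, 6) -> R) : skew c ->
  exists2 a, skew a & lef W (lef W a) = c.
Proof.
move=> cS; have Lc0 : lef W c = fun=> 0 by apply: skew_overdim (skew_lef W cS).
have E v : lef W (lam V c) v = - 2 * c v.
  by have := congr1 (@^~ v) (lam_lef W_skew V_skew VW cS); rewrite /= Lc0 lam0; lra.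
have E1 v : lef W (lam V (lam V c)) v = - 2 * lam V c v.
  have := congr1 (@^~ v) (lam_lef W_skew V_skew VW (skew_lam V cS)).
  have -> : lef W (lam V c) = fun v => - 2 * c v by exact/funext.
  by rewrite /= lamZ; lra.
exists (fun v => 4^-1 * lam V (lam V c) v).
  by apply: skewZ; do 2 apply: skew_lam.
rewrite (lefZ W (lam V (lam V c))) (lefZ W (lef W (lam V (lam V c)))).
have -> : lef W (lam V (lam V c)) = fun v => - 2 * lam V c v by exact/funext.
by rewrite (lefZ W (lam V c)); apply/funext => v; rewrite E; field.
Qed.

Lemma lef_lam_top (s : 'M[R]_6 -> R) v : skew s -> lef W (lam V s) v = - 3 * s v.
Proof.
move=> sS; have := congr1 (@^~ v) (lam_lef W_skew V_skew VW sS).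
have -> : lef W s = fun=> 0 by apply: skew_overdim (skew_lef W sS).
by rewrite /= lam0; lra.
Qed.

Lemma lef_lam2_top (s : 'M[R]_6 -> R) v : skew s ->
  lef W (lam V (lam V s)) v = - 4 * lam V s v.
Proof.
move=> sS; have := congr1 (@^~ v) (lam_lef W_skew V_skew VW (skew_lam V sS)).
have -> : lef W (lam V s) = fun v => - 3 * s v.
  by apply/funext => u; exact: lef_lam_top.
by rewrite /= lamZ; lra.
Qed.

(** In degree 4 the relation is c = Lambda L c - L Lambda c. The first term [d] comes from a top
    form and equals -1/4 L Lambda d. *)
Lemma lef1_surj (c : 'M[R]_(4, 6) -> R) : skew c ->
  exists2 a, skew a & lef W a = c.
Proof.
move=> cS; pose d := lam V (lef W c); have sS := skew_lef W cS.
have E v : c v = d v - lef W (lam V c) v.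
  have := congr1 (@^~ v) (lam_lef W_skew V_skew VW cS); rewrite /= /d; lra.
have Ed v : lef W (lam V d) v = - 4 * d v by exact: lef_lam2_top.
exists (fun v => - 4^-1 * lam V d v + -1 * lam V c v).
  by apply: skew_lin; do ?apply: skew_lam.
by rewrite lef_lin; apply/funext => v; rewrite Ed E; field.
Qed.

(** L^3 Lambda^3 acts on top forms as (-3)(-4)(-3) = -36. *)
Lemma lef3_surj (s : 'M[R]_6 -> R) : skew s ->
  exists a : 'M[R]_(0, 6) -> R, lef W (lef W (lef W a)) = s.
Proof.
move=> sS; pose f := lam V (lam V s).
have E v : lef W (lam V f) v = - 3 * f v.
  have := congr1 (@^~ v) (lam_lef W_skew V_skew VW (skew_lam V (skew_lam V sS))).
  have -> : lef W (lam V (lam V s)) = fun v => - 4 * lam V s v.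
    by apply/funext => u; exact: lef_lam2_top.
  by rewrite /= lamZ -/f; lra.
exists (fun v => - 36^-1 * lam V f v).
rewrite (lefZ W (lam V f)) (lefZ W (lef W (lam V f))).
rewrite (lefZ W (lef W (lef W (lam V f)))).
have -> : lef W (lam V f) = fun v => - 3 * f v by exact/funext.
rewrite (lefZ W f) (lefZ W (lef W f)); have -> : lef W f = fun v => - 4 * lam V s v.
  by apply/funext => u; exact: lef_lam2_top.
by rewrite (lefZ W (lam V s)); apply/funext => v; rewrite lef_lam_top//; field.
Qed.

End HardLefschetz6.

(** * Weights of forms under a diagonal matrix *)

Section WeightSplitting.
Context {R : realType} {n : nat}.
Variable mu : 'rV[R]_n.

(* Multiplies the coefficient of dx_(i1) /\ ... /\ dx_(ik) by
   [g (x * mu_i1 * ... * mu_ik)]. *)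
Fixpoint weight_op (g : R -> R) k (x : R) : ('M[R]_(k, n) -> R) -> 'M[R]_(k, n) -> R :=
  match k with
  | 0 => fun a v => g x * a v
  | k'.+1 => fun a v => k'.+1%:R^-1 *
      \sum_q cowedge (crd q) (weight_op g (x * mu ord0 q) (contr (delta_mx 0 q) a)) v
  end.

Lemma weight_op_lin g k x (a b : 'M[R]_(k, n) -> R) r s :
  weight_op g x (fun v => r * a v + s * b v) =
  fun v => r * weight_op g x a v + s * weight_op g x b v.
Proof.
elim: k x a b => [|k IH] x a b; apply/funext => v /=; first by ring.
rewrite [r * _]mulrCA [s * _]mulrCA -mulrDr; congr (_ * _).
rewrite !mulr_sumr -big_split; apply: eq_bigr => q _ /=.
by rewrite -[contr _ (fun v => _)]/(fun v => r * contr _ a v + s * contr _ b v) IH cowedge_lin.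
Qed.

Lemma weight_opZ g k x (a : 'M[R]_(k, n) -> R) r :
  weight_op g x (fun v => r * a v) = fun v => r * weight_op g x a v.
Proof.
have -> : (fun v => r * a v) = fun v => r * a v + 0 * a v.
  by apply/funext => v; rewrite mul0r addr0.
by rewrite weight_op_lin; apply/funext => v; rewrite mul0r addr0.
Qed.

Lemma weight_op1 k x (a : 'M[R]_(k, n) -> R) :
  skew a -> weight_op (fun=> 1) x a = a.
Proof.
elim: k x a => [|k IH] x a aS; apply/funext => v /=; first exact: mul1r.
rewrite (eq_bigr (fun q => cowedge (crd q) (contr (delta_mx 0 q) a) v)); last first.
  by move=> q _; rewrite IH//; exact: skew_contr.
by rewrite euler// mulrA mulVf ?mul1r// pnatr_eq0.
Qed.

Lemma weight_opD g g' k x (a : 'M[R]_(k, n) -> R) v :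
  weight_op (fun y => g y + g' y) x a v = weight_op g x a v + weight_op g' x a v.
Proof.
elim: k x a v => [|k IH] x a v /=; first by ring.
rewrite -mulrDr; congr (_ * _); rewrite -big_split; apply: eq_bigr => q _ /=.
by rewrite (funext (IH _ _)) cowedgeD.
Qed.

Lemma cowedge_diag k q (a : 'M[R]_(k, n) -> R) v (nu : 'rV[R]_n) :
  cowedge (crd q) a (v *m diag_mx nu) =
  nu ord0 q * cowedge (crd q) (fun u => a (u *m diag_mx nu)) v.
Proof.
rewrite /cowedge mulr_sumr; apply: eq_bigr => i _.
have -> : crd q (row i (v *m diag_mx nu)) = nu ord0 q * crd q (row i v).
  by rewrite /crd mxE mul_mx_diag !mxE mulrC.
by rewrite row'Esub -mul_rowsub_mx -row'Esub; ring.
Qed.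

Lemma weight_op_diag g k x (a : 'M[R]_(k, n) -> R) v (nu : 'rV[R]_n) :
  multilinear a ->
  weight_op g x (fun u => a (u *m diag_mx nu)) v = weight_op g x a (v *m diag_mx nu).
Proof.
elim: k x a v => [|k IH] x a v aM //=; congr (_ * _); apply: eq_bigr => q _.
rewrite cowedge_diag.
have -> : contr (delta_mx 0 q) (fun u => a (u *m diag_mx nu)) =
    fun u => nu ord0 q * contr (delta_mx 0 q) a (u *m diag_mx nu).
  apply/funext => u; rewrite /contr (mul_col_mx (delta_mx 0 q : 'rV_n)).
  rewrite -rowE row_diag_mx.
  have := contr_linear (nu ord0 q) 0 (delta_mx 0 q) 0 (u *m diag_mx nu) aM.
  by rewrite scale0r addr0 mul0r addr0.
rewrite weight_opZ cowedgeZ; congr (_ * cowedge _ _ _); apply/funext => u.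
by rewrite IH//; exact: multilinear_contr.
Qed.

(** Pulling back by the diagonal matrix scales the coefficient of weight y by y; on the side of [g]
    this is multiplication by the argument. *)
Lemma weight_op_twist g k x (a : 'M[R]_(k, n) -> R) v :
  x * weight_op g x a (v *m diag_mx mu) = weight_op (fun y => y * g y) x a v.
Proof.
elim: k x a v => [|k IH] x a v /=.
  by rewrite (_ : v *m diag_mx mu = v) 1?mulrA//; apply/matrixP => - [].
rewrite mulrCA; congr (_ * _); rewrite mulr_sumr; apply: eq_bigr => q _.
by rewrite cowedge_diag mulrA -(funext (IH _ _)) cowedgeZ.
Qed.

Let D := diag_mx mu.
Let proj1 (y : R) : R := (y == 1)%:R.
Let resolvent (y : R) : R := if y == 1 then 0 else (y - 1)^-1.

(** The projection onto weight 1, where the twist by [D] is the identity. Its companion [weight_res]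
    inverts twist minus identity on the other weights and is set to 0 on weight 1. *)
Definition weight_inv k (a : 'M[R]_(k, n) -> R) := weight_op proj1 1 a.
Definition weight_res k (a : 'M[R]_(k, n) -> R) := weight_op resolvent 1 a.

Lemma weight_inv_twist k (a : 'M[R]_(k, n) -> R) v :
  weight_inv a (v *m D) = weight_inv a v.
Proof.
rewrite -[LHS]mul1r /weight_inv weight_op_twist.
suff -> : (fun y => y * proj1 y) = proj1 by [].
by apply/funext => y; rewrite /proj1; case: eqP => [->|]; rewrite ?mulr1 ?mulr0.
Qed.

(** Weight by weight this is y / (y - 1) - 1 / (y - 1) = 1 off y = 1, and 0 = 1 - 1 at y = 1. So
    every form is a fixed form plus a coboundary. *)
Lemma weight_res_twist k (a : 'M[R]_(k, n) -> R) v : skew a ->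
  weight_res a (v *m D) - weight_res a v = a v - weight_inv a v.
Proof.
move=> aS; rewrite -[weight_res a (v *m D)]mul1r /weight_res weight_op_twist.
suff : weight_op (fun y => y * resolvent y) 1 a v + weight_inv a v =
    weight_op resolvent 1 a v + a v by lra.
rewrite -[in a v](weight_op1 1 aS) /weight_inv -!weight_opD.
suff -> : (fun y => y * resolvent y + proj1 y) = fun y => resolvent y + 1 by [].
apply/funext => y; rewrite /resolvent /proj1.
have [->|y1] := eqVneq y 1; first by rewrite mulr0.
have : y - 1 != 0 by rewrite subr_eq0.
by move=> H; rewrite mulr0n; field.
Qed.

(* The twist by D is semisimple, so its fixed vectors meet the image of
   1 - twist only in 0. *)
Lemma weight_inv_coboundary k (a c : 'M[R]_(k, n) -> R) : skew a -> skew c ->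
  (forall v, c (v *m D) = c v) -> (forall v, c v = a v - a (v *m D)) -> c = fun=> 0.
Proof.
move=> aS cS cD ca.
have cE v : c v = weight_inv c v.
  have := weight_res_twist v cS.
  have -> : weight_res c (v *m D) = weight_res c v.
    rewrite /weight_res -weight_op_diag; last by case: cS.
    by suff -> : (fun u => c (u *m diag_mx mu)) = c by []; apply/funext.
  by rewrite subrr => /esym/eqP; rewrite subr_eq0 => /eqP.
apply/funext => v; rewrite cE.
have -> : c = fun v => 1 * a v + -1 * a (v *m D).
  by apply/funext => u; rewrite ca mul1r mulN1r.
rewrite /weight_inv weight_op_lin (weight_op_diag _ _ _ _ aS.1).
by rewrite -!/(weight_inv _) weight_inv_twist; ring.
Qed.

End WeightSplitting.

Lemma littleo_differentiable {R : realType} (V W : normedModType R) (f : V -> W)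
    (df : {linear V -> W}) p : continuous df ->
  (forall e, 0 < e -> \forall h \near (0 : V),
     `|f (p + h) - f p - df h| <= e * `|h|) ->
  differentiable f p /\ 'd f p = df :> (_ -> _).
Proof.
move=> dfc fdf; have E : f \o shift p = cst (f p) + df +o_ 0 id.
  apply/eqaddoP => e e0; near=> h.
  rewrite -[X in `|X|]/(f (h + p) - (f p + df h)) opprD addrA [h + p]addrC.
  by near: h; exact: fdf.
have dE := diff_unique dfc E.
by split=> //; apply/diff_locallyP; rewrite dE.
Unshelve. all: by end_near. Qed.

(** * Smooth functions and averages along lines *)

Section Smooth.
Context {R : realType} {n : nat}.
Implicit Types (f g : 'rV[R]_n -> R) (p v : 'rV[R]_n).

Lemma smooth_differentiable f p : smooth f -> differentiable f p.
Proof. by move=> /(_ [::] p). Qed.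

Lemma smooth_derivable f p v : smooth f -> derivable f p v.
Proof. by move=> fS; apply/diff_derivable/smooth_differentiable. Qed.

Lemma smooth_derive f v : smooth f -> smooth ('D_v f).
Proof. by move=> fS vs p; have := fS (rcons vs v) p; rewrite foldr_rcons. Qed.

(** Smoothness is a greatest fixed point: it suffices to name a class of differentiable functions
    stable under directional derivatives. Most closure properties below differ only in the class
    they name. *)
Lemma smooth_coind (C : set ('rV[R]_n -> R)) :
  (forall f, C f -> (forall p, differentiable f p) /\ (forall v, C ('D_v f))) ->
  forall f, C f -> smooth f.
Proof.
move=> CP f Cf vs; suff Cvs : C (foldr (fun v g => 'D_v g) f vs).
  by have [] := CP _ Cvs.
by elim: vs => //= v vs /CP[].
Qed.

Lemma smooth_cst (c : R) : smooth (fun _ : 'rV[R]_n => c).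
Proof.
apply: (@smooth_coind [set f | exists c, f = fun=> c]); last by exists c.
move=> _ [d ->]; split; first by move=> p; exact: differentiable_cst.
by move=> v; exists 0; apply/funext => p; rewrite derive_cst.
Qed.

Lemma smooth_lin f g r s : smooth f -> smooth g -> smooth (fun p => r * f p + s * g p).
Proof.
move=> fS gS; apply: (@smooth_coind [set h | exists f g, [/\ smooth f, smooth g &
  h = r *: f + s *: g]]); last by exists f, g.
move=> _ [f' [g' [f'S g'S ->]]]; split.
  move=> p; apply: differentiableD; apply: differentiableZ; exact: smooth_differentiable.
move=> v; exists ('D_v f'), ('D_v g'); split; [exact: smooth_derive|exact: smooth_derive|].
apply/funext => p; rewrite deriveD; [|apply: derivableZ; exact: smooth_derivable..].
by rewrite !deriveZ; [|exact: smooth_derivable..].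
Qed.

Lemma smoothD f g : smooth f -> smooth g -> smooth (fun p => f p + g p).
Proof.
move=> fS gS; have := smooth_lin 1 1 fS gS.
by under eq_fun do rewrite !mul1r.
Qed.

Lemma smoothB f g : smooth f -> smooth g -> smooth (fun p => f p - g p).
Proof.
move=> fS gS; have := smooth_lin 1 (-1) fS gS.
by under eq_fun do rewrite mul1r mulN1r.
Qed.

Lemma smoothZ r f : smooth f -> smooth (fun p => r * f p).
Proof.
move=> fS; have := smooth_lin r 0 fS fS.
by under eq_fun do rewrite mul0r addr0.
Qed.

Lemma smooth_sum I (s : seq I) (P : pred I) (f : I -> 'rV[R]_n -> R) :
  (forall i, smooth (f i)) -> smooth (fun p => \sum_(i <- s | P i) f i p).
Proof.
move=> fS; elim: s => [|i s IH].
  by under eq_fun do rewrite big_nil; exact: smooth_cst.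
under eq_fun do rewrite big_cons.
by case: (P i) => //; exact: smoothD.
Qed.

(** Products alone are not stable under derivation; finite sums of products of smooth functions are,
    by the Leibniz rule. *)
Inductive prod_closure : ('rV[R]_n -> R) -> Prop :=
| Prod_mul f g of smooth f & smooth g : prod_closure (f * g)
| Prod_add f g of prod_closure f & prod_closure g : prod_closure (f + g).

Lemma smoothM f g : smooth f -> smooth g -> smooth (fun p => f p * g p).
Proof.
move=> fS gS; apply: (@smooth_coind prod_closure); last exact: (Prod_mul fS gS).
move=> h hP; suff [h1 h2] : (forall p, differentiable h p) /\ (forall v, prod_closure ('D_v h)) by [].
elim: hP => [f' g' f'S g'S|f' g' _ [df Pf] _ [dg Pg]]; split.
- by move=> p; apply: differentiableM; exact: smooth_differentiable.
- move=> v; have -> : 'D_v (f' * g') = f' * 'D_v g' + g' * 'D_v f'.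
    by apply/funext => p; rewrite deriveM//; exact: smooth_derivable.
  by apply: Prod_add; apply: Prod_mul => //; exact: smooth_derive.
- by move=> p; exact: differentiableD.
- move=> v; have -> : 'D_v (f' + g') = 'D_v f' + 'D_v g'.
    by apply/funext => p; rewrite deriveD//; exact: diff_derivable.
  exact: Prod_add.
Qed.

(** Stable under derivation because (h / f)' = (h' - f' (h / f)) / f stays within the listed
    operations. *)
Inductive inv_closure f : ('rV[R]_n -> R) -> Prop :=
| Inv_smooth g of smooth g : inv_closure f g
| Inv_add g h of inv_closure f g & inv_closure f h : inv_closure f (g + h)
| Inv_mul g h of smooth g & inv_closure f h : inv_closure f (g * h)
| Inv_div h of inv_closure f h : inv_closure f ((fun p => (f p)^-1) * h).

Lemma smoothV f : smooth f -> (forall p, f p != 0) -> smooth (fun p => (f p)^-1).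
Proof.
move=> fS f0; apply: (@smooth_coind (inv_closure f)); last first.
  have -> : (fun p => (f p)^-1) = (fun p => (f p)^-1) * (fun=> 1).
    by apply/funext => p; rewrite [RHS]mulr1.
  apply/Inv_div/Inv_smooth; exact: smooth_cst.
move=> h hP; suff [h1 h2] : (forall p, differentiable h p) /\ (forall v, inv_closure f ('D_v h)) by [].
have dV p : differentiable (fun q => (f q)^-1) p.
  by apply: differentiableV => //; exact: smooth_differentiable.
elim: hP => [g gS|g k gP [dg Pg] kP [dk Pk]|g k gS kP [dk Pk]|k kP [dk Pk]]; split.
- by move=> p; exact: smooth_differentiable.
- by move=> v; apply/Inv_smooth/smooth_derive.
- by move=> p; exact: differentiableD.
- move=> v; have -> : 'D_v (g + k) = 'D_v g + 'D_v k.
    by apply/funext => p; rewrite deriveD//; exact: diff_derivable.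
  exact: Inv_add.
- by move=> p; apply: differentiableM => //; exact: smooth_differentiable.
- move=> v; have -> : 'D_v (g * k) = g * 'D_v k + 'D_v g * k.
    apply/funext => p; rewrite deriveM; [|exact: smooth_derivable|exact: diff_derivable].
    by rewrite -[RHS]/(g p * 'D_v k p + 'D_v g p * k p) [_ * k p]mulrC.
  by apply: Inv_add; apply: Inv_mul => //; exact: smooth_derive.
- by move=> p; exact: differentiableM.
- move=> v; have -> : 'D_v ((fun p => (f p)^-1) * k) =
     (fun p => (f p)^-1) * ('D_v k + (fun p => - 'D_v f p) * ((fun p => (f p)^-1) * k)).
    apply/funext => p; rewrite deriveM; [|exact: diff_derivable..].
    rewrite deriveV//; last exact: smooth_derivable.
    rewrite -[RHS]/((f p)^-1 * ('D_v k p + (- 'D_v f p) * ((f p)^-1 * k p))).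
    rewrite /GRing.scale /= -exprVn expr2; ring.
  apply/Inv_div/Inv_add => //; apply: Inv_mul; last exact: Inv_div.
  have := smoothZ (-1) (smooth_derive v fS).
  by under eq_fun do rewrite mulN1r.
Qed.

Lemma near_differentiable f g p : (\forall q \near p, f q = g q) ->
  differentiable g p -> differentiable f p.
Proof.
move=> fg dg; have fgp := nbhs_singleton fg.
apply: (proj1 (littleo_differentiable (df := 'd g p) _ _)).
  exact: diff_continuous.
move=> e e0; have [_ /eqaddoP /(_ _ e0)] := (diff_locallyP _ _).1 dg.
have fg0 : \forall h \near (0 : 'rV[R]_n), f (h + p) = g (h + p).
  by move: fg; rewrite (near_shift 0) subr0.
move=> H; near=> h; rewrite fgp [p + h]addrC (near fg0 h)//.
have : `|g (h + p) - (g p + 'd g p h)| <= e * `|h| by near: h; exact: H.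
by rewrite opprD addrA.
Unshelve. all: by end_near. Qed.

Lemma smooth_local f :
  (forall p, exists2 g, smooth g & \forall q \near p, f q = g q) -> smooth f.
Proof.
move: f; apply: smooth_coind => f fP; split=> [p|v p].
- have [g gS fg] := fP p.
  exact: near_differentiable fg (smooth_differentiable p gS).
- have [g gS fg] := fP p; exists ('D_v g); first exact: smooth_derive.
  (* Agreement near p is agreement near every q close to p, which is what the derivative at q
     needs. *)
  move: fg => /nbhs_interior; rewrite -[X in X -> _]/(\near p, _).
  by apply: filterS => q fq; apply: near_eq_derive.
Qed.

Lemma derive_linear f p r s u v : differentiable f p ->
  'D_(r *: u + s *: v) f p = r * 'D_u f p + s * 'D_v f p.
Proof. by move=> df; rewrite !deriveE// linearP linearZ. Qed.

Lemma derive_delta f p v : differentiable f p ->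
  'D_v f p = \sum_(j < n) v ord0 j * 'D_(delta_mx 0 j) f p.
Proof.
move=> df; rewrite deriveE// {1}[v]row_sum_delta linear_sum.
by apply: eq_bigr => j _; rewrite linearZ deriveE.
Qed.

End Smooth.

Lemma crd_is_linear {R : realType} {n : nat} (j : 'I_n) : linear (@crd R n j).
Proof. by move=> a u v; rewrite /crd !mxE. Qed.
HB.instance Definition _ {R : realType} {n : nat} (j : 'I_n) :=
  GRing.isLinear.Build R 'rV[R]_n R _ (@crd R n j) (crd_is_linear j).

Section Lines.
Context {R : realType} {n : nat}.
Implicit Types (f g : 'rV[R]_n -> R) (p q v h : 'rV[R]_n).

Lemma is_derive_line f q h (s : R) : derivable f (q + s *: h) h ->
  is_derive s 1 (fun t : R => f (q + t *: h)) ('D_h f (q + s *: h)).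
Proof.
have E : (fun t : R => t^-1 *: (f (q + (t *: (1 : R) + s) *: h) - f (q + s *: h))) =
    (fun t : R => t^-1 *: (f (t *: h + (q + s *: h)) - f (q + s *: h))).
  apply/funext => t; congr (_ *: (f _ - _)).
  have -> : t *: (1 : R) = t by exact: mulr1.
  by rewrite scalerDl addrCA.
move=> fd; split.
- by move: fd; rewrite /derivable -E.
- by rewrite /derive -E.
Qed.

Lemma smooth_line f q h (s : R) : smooth f ->
  is_derive s 1 (fun t : R => f (q + t *: h)) ('D_h f (q + s *: h)).
Proof. by move=> fS; apply/is_derive_line/smooth_derivable. Qed.

Lemma is_derive_continuous (phi dphi : R -> R) :
  (forall s : R, is_derive s 1 phi (dphi s)) -> continuous phi.
Proof. by move=> H s; apply/differentiable_continuous/derivable1_diffP; case: (H s). Qed.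

Lemma mean_value (phi dphi : R -> R) (s : R) :
  (forall t : R, is_derive t 1 phi (dphi t)) -> 0 <= s ->
  exists2 t, 0 <= t <= s & phi s - phi 0 = dphi t * s.
Proof.
move=> H s0; have [|t ts] := MVT_segment s0 (fun t _ => H t).
  by apply: continuous_subspaceT; exact: is_derive_continuous H.
by rewrite subr0 => E; exists t => //; move: ts; rewrite in_itv.
Qed.

Lemma smooth_cst0 f : smooth f -> (forall v p, 'D_v f p = 0) ->
  forall p q, f p = f q.
Proof.
move=> fS f0 p q.
have [t _] := mean_value (fun t => smooth_line q (p - q) t fS) ler01.
rewrite scale1r scale0r addr0 [q + _]addrC subrK f0 mul0r => /eqP.
by rewrite subr_eq0 => /eqP.
Qed.

Lemma differentiable_affine (T : 'M[R]_n) c p : differentiable (fun p => p *m T + c) p.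
Proof.
apply: differentiableD; last exact: differentiable_cst.
have -> : (fun q : 'rV[R]_n => q *m T) = \sum_j (fun q => crd j q *: row j T).
  by apply/funext => q; rewrite fct_sumE mulmx_sum_row.
apply: differentiable_sum => j; apply: differentiableZl.
exact: differentiable_coord.
Qed.

Lemma diff_affine (T : 'M[R]_n) c p v : 'd (fun p => p *m T + c) p v = v *m T.
Proof.
rewrite -deriveE; last exact: differentiable_affine.
apply: cvg_lim => //; apply: cvg_near_cst; near=> h.
have -> : (shift p (h *: v) *m T + c) - (p *m T + c) = h *: (v *m T).
  by rewrite /= mulmxDl -scalemxAl -[X in X - _]addrA addrK.
rewrite scalerA mulVf ?scale1r//.
by near: h; exact: nbhs_dnbhs_neq.
Unshelve. all: by end_near. Qed.

Lemma smooth_comp_affine f (T : 'M[R]_n) c : smooth f ->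
  smooth (fun p => f (p *m T + c)) /\
  (forall v p, 'D_v (fun p => f (p *m T + c)) p = 'D_(v *m T) f (p *m T + c)).
Proof.
have D g v p : smooth g -> is_derive p v (fun p => g (p *m T + c)) ('D_(v *m T) g (p *m T + c)).
  move=> gS.
  have E : (fun t : R => t^-1 *: (g ((t *: v + p) *m T + c) - g (p *m T + c))) =
      (fun t : R => t^-1 *: (g (t *: (v *m T) + (p *m T + c)) - g (p *m T + c))).
    by apply/funext => t; rewrite mulmxDl -scalemxAl addrA.
  have gd : derivable g (p *m T + c) (v *m T) by exact: smooth_derivable.
  by split; [move: gd; rewrite /derivable -E|rewrite /derive -E].
move=> fS; split; last by move=> v p; case: (D f v p fS).
apply: (@smooth_coind _ _ [set g | exists2 f, smooth f & g = fun p => f (p *m T + c)]); last by exists f.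
move=> _ [g gS ->]; split.
  move=> p; apply: (differentiable_comp (f := fun p => p *m T + c)).
    exact: differentiable_affine.
  exact: smooth_differentiable.
move=> v; exists ('D_(v *m T) g); first exact: smooth_derive.
by apply/funext => p; case: (D g v p gS).
Qed.

Lemma derive_crd j v p : 'D_v (@crd R n j) p = v ord0 j.
Proof.
rewrite deriveE; last exact: differentiable_coord.
by rewrite (diff_lin (f := @crd R n j)) //; exact: coord_continuous.
Qed.

Lemma smooth_crd j : smooth (@crd R n j).
Proof.
apply: (@smooth_coind _ _ [set f | f = @crd R n j \/ exists c, f = fun=> c]); last by left.
move=> _ [->|[c ->]]; split.
- by move=> p; exact: differentiable_coord.
- by move=> v; right; exists (v ord0 j); apply/funext => p; exact: derive_crd.
- by move=> p; exact: differentiable_cst.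
- by move=> v; right; exists 0; apply/funext => p; rewrite derive_cst.
Qed.

Lemma local_bound f (r : R) : continuous f ->
  exists2 C, 0 <= C & forall q, `|q| <= r -> `|f q| <= C.
Proof.
move=> fC.
have cK : compact [set q : 'rV[R]_n | `|q| <= r].
  apply: bounded_closed_compact.
    exists r; split; first exact: num_real.
    by move=> x rx q /= /le_trans; apply; exact: ltW.
  rewrite (_ : [set _ | _] = closed_ball_ (fun x => `|x|) (0 : 'rV[R]_n) r).
    exact: closed_closed_ball_.
  by apply/seteqP; split=> q; rewrite /closed_ball_ /= sub0r normrN.
have /compact_bounded[M [_ MP]] : compact (f @` [set q | `|q| <= r]).
  by apply: continuous_compact cK; exact: continuous_subspaceT.
exists (Num.max 0 (M + 1)); first by rewrite le_max lexx.
move=> q qr; rewrite le_max; apply/orP; right; apply: MP; last by exists q.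
by rewrite ltrDl.
Qed.

End Lines.

(** * Integration over the unit interval and along segments *)

Section UnitIntegral.
Context {R : realType}.
Local Notation mu := (@lebesgue_measure R).

Definition int01 (phi : R -> R) : R := \int[mu]_(u in `[0, 1]) phi u.

Lemma int01_integrable (phi : R -> R) : continuous phi ->
  mu.-integrable `[0, 1] (EFin \o phi).
Proof.
move=> phiC; apply: continuous_compact_integrable; first exact: segment_compact.
exact: continuous_subspaceT.
Qed.

Lemma int01_lin (phi chi : R -> R) r s : continuous phi -> continuous chi ->
  int01 (fun u => r * phi u + s * chi u) = r * int01 phi + s * int01 chi.
Proof.
move=> phiC chiC; rewrite /int01 RintegralD//; last 2 first.
- by apply: int01_integrable => u; apply: cvgM; [exact: cvg_cst|exact: phiC].
- by apply: int01_integrable => u; apply: cvgM; [exact: cvg_cst|exact: chiC].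
by rewrite !RintegralZl//; exact: int01_integrable.
Qed.

Lemma int01_cst (c : R) : int01 (fun=> c) = c.
Proof.
rewrite /int01 Rintegral_cst// -[RHS]mulr1; congr (c * _).
transitivity (fine (1%:E : \bar R)) => //; congr fine.
apply: (eq_trans (lebesgue_measure_itv `[0 : R, 1])).
by rewrite /= lte_fin ltr01 -EFinD subr0.
Qed.

Lemma int01_bound (phi : R -> R) M : continuous phi ->
  (forall u, 0 <= u <= 1 -> `|phi u| <= M) -> `|int01 phi| <= M.
Proof.
move=> phiC phiM; apply: (le_trans (le_normr_Rintegral _ _)) => //.
  exact: int01_integrable.
rewrite -[leRHS]int01_cst; apply: le_Rintegral => //.
- by apply: (@int01_integrable (fun u => `|phi u|)) => u; apply: cvg_norm; exact: phiC.
- by apply: (@int01_integrable (fun=> M)) => u; exact: cvg_cst.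
Qed.

Lemma int01_derive (phi dphi : R -> R) : continuous dphi ->
  (forall s : R, is_derive s 1 phi (dphi s)) -> int01 dphi = phi 1 - phi 0.
Proof.
move=> dphiC H; rewrite /int01 /Rintegral (@continuous_FTC2 _ _ phi)//.
- exact: continuous_subspaceT.
- have phiC := is_derive_continuous H; split.
  + by move=> x _; case: (H x).
  + by apply: cvg_at_right_filter; exact: phiC.
  + by apply: cvg_at_left_filter; exact: phiC.
- by move=> x _; rewrite derive1E; case: (H x).
Qed.

End UnitIntegral.

Section LineAverage.
Context {R : realType} {n : nat}.
Implicit Types (f g : 'rV[R]_n -> R) (p q v h e : 'rV[R]_n) (psi : R -> R).

(** The common form of [avg] and [prim], so that differentiation under the integral sign is proved
    once, for a continuous weight bounded by 1. *)
Definition line_int psi e f p : R := int01 (fun u => psi u * f (p + u *: e)).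

Lemma smooth_continuous f : smooth f -> continuous f.
Proof. by move=> fS p; apply/differentiable_continuous/smooth_differentiable. Qed.

Lemma continuous_line psi e f p : continuous psi -> smooth f ->
  continuous (fun u => psi u * f (p + u *: e)).
Proof.
move=> psiC fS u; apply: cvgM; first exact: psiC.
exact: (is_derive_continuous (fun s => smooth_line p e s fS)).
Qed.

Lemma line_int_lin psi e f g r s p : continuous psi -> smooth f -> smooth g ->
  line_int psi e (fun q => r * f q + s * g q) p =
  r * line_int psi e f p + s * line_int psi e g p.
Proof.
move=> psiC fS gS; rewrite /line_int -int01_lin; [|exact: continuous_line..].
by congr int01; apply/funext => u; ring.
Qed.

Lemma taylor2 f q h : smooth f ->
  exists t, `|f (q + h) - f q - 'D_h f q| <= `|'D_h ('D_h f) (q + t *: h)| /\ 0 <= t <= 1.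
Proof.
move=> fS.
have [t /andP[t0 t1]] := mean_value (fun t => smooth_line q h t fS) ler01.
rewrite scale1r scale0r addr0 mulr1 => ->.
have [s /andP[s0 st]] := mean_value (fun t => smooth_line q h t (smooth_derive h fS)) t0.
rewrite scale0r addr0 => ->; exists s; split; last by rewrite s0 (le_trans st).
by rewrite normrM ler_piMr// ger0_norm.
Qed.

(** The second derivative along h is quadratic in h, with the second partial derivatives as
    coefficients, and these are bounded on a ball. *)
Lemma derive2_bound f (r : R) : smooth f ->
  exists2 C, 0 <= C & forall q h, `|q| <= r -> `|'D_h ('D_h f) q| <= C * `|h| ^+ 2.
Proof.
move=> fS.
have /(_ _)/cid2-/all_sig2 := fun ij : 'I_n * 'I_n => local_bound r (smooth_continuous
  (smooth_derive (delta_mx 0 ij.1) (smooth_derive (delta_mx 0 ij.2) fS))).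
move=> [C C0 CP]; exists (\sum_i \sum_j C (i, j)).
  by apply: sumr_ge0 => i _; apply: sumr_ge0 => j _.
have crd_le h (j : 'I_n) : `|h ord0 j| <= `|h|.
  by rewrite [leRHS]mx_normrE; apply: (le_bigmax _ (fun ij => `|h ij.1 ij.2|) (ord0, j)).
move=> q h qr.
have -> : 'D_h ('D_h f) q = \sum_i \sum_j h ord0 i * h ord0 j *
    'D_(delta_mx 0 i) ('D_(delta_mx 0 j) f) q.
  rewrite derive_delta; last exact/smooth_differentiable/smooth_derive.
  apply: eq_bigr => i _.
  have -> : 'D_h f = \sum_j (fun p => h ord0 j *: 'D_(delta_mx 0 j) f p).
    apply/funext => p; rewrite derive_delta; last exact: smooth_differentiable.
    by rewrite fct_sumE.
  rewrite derive_sum; last first.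
    by move=> j; apply: derivableZ; apply: smooth_derivable; exact: smooth_derive.
  rewrite mulr_sumr; apply: eq_bigr => j _.
  rewrite deriveZ; last by apply: smooth_derivable; exact: smooth_derive.
  by rewrite /GRing.scale /= mulrA.
apply: (le_trans (ler_norm_sum _ _ _)); rewrite mulr_suml; apply: ler_sum => i _.
apply: (le_trans (ler_norm_sum _ _ _)); rewrite mulr_suml; apply: ler_sum => j _.
rewrite !normrM [leRHS]mulrC expr2.
by apply: ler_pM; rewrite ?mulr_ge0 ?ler_pM ?crd_le//; exact: (CP (i, j)).
Qed.

Lemma line_int_bound psi e f p M N : continuous psi -> smooth f ->
  (forall u, 0 <= u <= 1 -> `|psi u| <= N) ->
  (forall u, 0 <= u <= 1 -> `|f (p + u *: e)| <= M) ->
  `|line_int psi e f p| <= N * M.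
Proof.
move=> psiC fS psiN fM; apply: int01_bound; first exact: continuous_line.
by move=> u u01; rewrite normrM; apply: ler_pM => //; [exact: psiN|exact: fM].
Qed.

End LineAverage.

Section LineIntegral.
Context {R : realType} {n : nat}.
Implicit Types (f g : 'rV[R]_n -> R) (p q v h e : 'rV[R]_n).
Variable psi : R -> R.
Hypotheses (psiC : continuous psi) (psi1 : forall u, 0 <= u <= 1 -> `|psi u| <= 1).

Lemma smooth_shift f c : smooth f -> smooth (fun p => f (p + c)).
Proof.
move=> fS; have [+ _] := smooth_comp_affine 1%:M c fS.
by under eq_fun do rewrite mulmx1.
Qed.

Lemma derive_shift_rV f c v p : smooth f ->
  'D_v (fun p => f (p + c)) p = 'D_v f (p + c).
Proof.
move=> fS; have [_ /(_ v p)] := smooth_comp_affine 1%:M c fS.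
by under eq_fun do rewrite mulmx1; rewrite !mulmx1.
Qed.

Lemma line_int_sum e I (s : seq I) (c : I -> R) (g : I -> 'rV[R]_n -> R) p :
  (forall i, smooth (g i)) ->
  line_int psi e (fun q => \sum_(i <- s) c i * g i q) p =
  \sum_(i <- s) c i * line_int psi e (g i) p.
Proof.
move=> gS; elim: s => [|i s IH].
  rewrite big_nil; under eq_fun do rewrite big_nil.
  by rewrite /line_int; under eq_fun do rewrite mulr0; rewrite int01_cst.
rewrite big_cons -IH -[X in _ + X]mul1r -line_int_lin//.
  by congr (line_int _ _ _ _); apply/funext => q; rewrite big_cons mul1r.
by apply: smooth_sum => j; exact: smoothZ.
Qed.

Lemma line_int_derive_delta e f p v : smooth f ->
  line_int psi e ('D_v f) p =
  \sum_j v ord0 j * line_int psi e ('D_(delta_mx 0 j) f) p.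
Proof.
move=> fS; rewrite -line_int_sum; last by move=> j; exact: smooth_derive.
congr (line_int _ _ _ _); apply/funext => q.
by rewrite derive_delta//; exact: smooth_differentiable.
Qed.

(** Differentiation under the integral sign: the second-order Taylor remainder is bounded uniformly
    along the segment, so it integrates to O(|h|^2), which is o(h). *)
Lemma line_int_differentiable e f p : smooth f ->
  differentiable (line_int psi e f) p /\
  (forall v, 'D_v (line_int psi e f) p = line_int psi e ('D_v f) p).
Proof.
move=> fS.
pose C : 'M[R]_(n, 1) := \col_j line_int psi e ('D_(delta_mx 0 j) f) p.
pose df : {linear 'rV[R]_n -> R} := (@crd R 1 ord0 \o mulmxr C)%FUN.
have dfE h : df h = line_int psi e ('D_h f) p.
  rewrite line_int_derive_delta// /df /= /crd mxE; apply: eq_bigr => j _.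
  by rewrite !mxE.
have dfC : continuous df.
  apply: smooth_continuous.
  have -> : (df : 'rV_n -> R) = fun h => \sum_j C j ord0 * crd j h.
    by apply/funext => h; rewrite /df /= /crd mxE; apply: eq_bigr => j _; rewrite mulrC.
  by apply: smooth_sum => j; apply: smoothZ; exact: smooth_crd.
have [|dF dE] := littleo_differentiable (f := line_int psi e f) (p := p) dfC; last first.
  by split=> // v; rewrite deriveE// dE dfE.
move=> eps eps0.
(* This ball contains every point p + u e + s h with u and s in [0, 1] and |h| <= 1. *)
have [M M0 MP] := derive2_bound (`|p| + `|e| + 1) fS.
(* [M + 1] in place of [M] keeps the denominator positive. *)
have eM : 0 < eps / (M + 1) by rewrite divr_gt0// ltr_wpDl.
have near1 := nbhs0_le (V := 'rV[R]_n) (ltr01 : 0 < 1 :> R).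
have near2 := nbhs0_le (V := 'rV[R]_n) eM.
near=> h.
have h1 : `|h| <= 1 by exact: (near near1 h).
have hM : M * `|h| <= eps.
  have : `|h| <= eps / (M + 1).
    exact: (near near2 h).
  move=> hh; apply: (le_trans (y := (M + 1) * `|h|)); last first.
    by rewrite mulrC -ler_pdivlMr// ltr_wpDl.
  by rewrite ler_wpM2r// lerDl.
have -> : line_int psi e f (p + h) - line_int psi e f p - df h =
    line_int psi e (fun q => (1 * f (q + h) + -1 * f q) - 'D_h f q) p.
  rewrite dfE.
  have -> : line_int psi e f (p + h) = line_int psi e (fun q => f (q + h)) p.
    by congr int01; apply/funext => u; rewrite addrAC.
  have -> : (fun q => 1 * f (q + h) + -1 * f q - 'D_h f q) =
      fun q => 1 * (1 * f (q + h) + -1 * f q) + -1 * 'D_h f q.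
    by apply/funext => q; ring.
  rewrite line_int_lin//; last 2 first.
  - by apply: smooth_lin => //; exact: smooth_shift.
  - exact: smooth_derive.
  rewrite line_int_lin//; last exact: smooth_shift.
  by rewrite -[fun q => 'D_h f q]/('D_h f); ring.
have hb : `|line_int psi e (fun q => (1 * f (q + h) + -1 * f q) - 'D_h f q) p| <=
    1 * (M * `|h| ^+ 2).
  apply: line_int_bound => //.
    apply: smoothB; last exact: smooth_derive.
    by apply: smooth_lin => //; exact: smooth_shift.
  move=> u /andP[u0 u1]; rewrite mul1r mulN1r.
  have [t [+ /andP[t0 t1]]] := taylor2 (p + u *: e) h fS.
  move=> /le_trans; apply; apply: MP.
  apply: (le_trans (ler_normD _ _)); apply: lerD; last first.
    by rewrite normrZ ger0_norm// (le_trans _ h1)// ler_piMl.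
  apply: (le_trans (ler_normD _ _)); rewrite lerD2l.
  by rewrite normrZ ger0_norm// ler_piMl.
by rewrite (le_trans hb)// mul1r expr2 mulrA ler_wpM2r.
Unshelve. all: by end_near. Qed.

Lemma smooth_line_int e f : smooth f -> smooth (line_int psi e f).
Proof.
move=> fS; apply: (@smooth_coind _ _ [set F | exists2 f, smooth f & F = line_int psi e f]); last by exists f.
move=> _ [g gS ->]; split=> [p|v].
  by have [] := line_int_differentiable e p gS.
exists ('D_v g); first exact: smooth_derive.
by apply/funext => p; have [_] := line_int_differentiable e p gS.
Qed.

Lemma derive_line_int e f v : smooth f ->
  'D_v (line_int psi e f) = line_int psi e ('D_v f).
Proof.
by move=> fS; apply/funext => p; have [_] := line_int_differentiable e p fS.
Qed.

End LineIntegral.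

Section Averages.
Context {R : realType} {n : nat}.
Implicit Types (f g : 'rV[R]_n -> R) (p q v h e : 'rV[R]_n).

(* The weight 1 - u makes the derivative of [prim e f] along e equal to
   [avg e f - f]. *)
Definition avg e f : 'rV[R]_n -> R := line_int (fun=> 1) e f.
Definition prim e f : 'rV[R]_n -> R := line_int (fun u => 1 - u) e f.

Lemma avg_psiC : continuous (fun _ : R => 1 : R).
Proof. by move=> u; exact: cvg_cst. Qed.

Lemma avg_psi1 (u : R) : 0 <= u <= 1 -> `|1 : R| <= 1.
Proof. by rewrite normr1. Qed.

Lemma prim_psiC : continuous (fun u : R => 1 - u).
Proof. by move=> u; apply: cvgB; [exact: cvg_cst|exact: cvg_id]. Qed.

Lemma prim_psi1 (u : R) : 0 <= u <= 1 -> `|1 - u| <= 1.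
Proof. by move=> /andP[u0 u1]; rewrite ger0_norm ?subr_ge0// gerBl. Qed.

Lemma smooth_avg e f : smooth f -> smooth (avg e f).
Proof. exact: smooth_line_int avg_psiC avg_psi1 _ _. Qed.

Lemma smooth_prim e f : smooth f -> smooth (prim e f).
Proof. exact: smooth_line_int prim_psiC prim_psi1 _ _. Qed.

Lemma derive_avg e f v : smooth f -> 'D_v (avg e f) = avg e ('D_v f).
Proof. exact: derive_line_int avg_psiC avg_psi1 _ _ _. Qed.

Lemma derive_prim e f v : smooth f -> 'D_v (prim e f) = prim e ('D_v f).
Proof. exact: derive_line_int prim_psiC prim_psi1 _ _ _. Qed.

Lemma avg_derive e f p : smooth f -> avg e ('D_e f) p = f (p + e) - f p.
Proof.
move=> fS; rewrite /avg /line_int; under eq_fun do rewrite mul1r.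
have -> : f (p + e) - f p = f (p + 1 *: e) - f (p + 0 *: e).
  by rewrite scale1r scale0r addr0.
apply: (int01_derive (phi := fun u => f (p + u *: e))).
  exact: (is_derive_continuous (fun s => smooth_line p e s (smooth_derive e fS))).
by move=> s; exact: smooth_line.
Qed.

Lemma prim_derive e f p : smooth f -> prim e ('D_e f) p = avg e f p - f p.
Proof.
move=> fS.
(* The fundamental theorem is applied to (1 - u) f(p + u e), which is f(p) at u = 0 and 0 at u =
   1. *)
have D (s : R) : is_derive s 1 (fun u => (1 - u) * f (p + u *: e))
    ((1 - s) * 'D_e f (p + s *: e) + -1 * (1 * f (p + s *: e))).
  have D1 : is_derive s (1 : R) (fun u : R => 1 - u) (-1).
    have := is_deriveB (is_derive_cst (1 : R) s (1 : R)) (is_derive_id s (1 : R)).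
    by rewrite sub0r.
  have D2 := smooth_line p e s fS.
  have D3 := is_deriveM D1 D2.
  apply: (@is_derive_eq _ _ _ _ _ _ _ _ D3).
  by rewrite /GRing.scale /=; ring.
have C1 : continuous (fun s : R => (1 - s) * 'D_e f (p + s *: e)).
  exact: (@continuous_line _ _ (fun u => 1 - u) e ('D_e f) p prim_psiC (smooth_derive e fS)).
have C2 : continuous (fun s : R => 1 * f (p + s *: e)).
  exact: (@continuous_line _ _ (fun=> 1) e f p avg_psiC fS).
have := int01_derive _ D; rewrite subrr mul0r scale0r addr0 subr0 mul1r sub0r.
have -> : (fun s : R => (1 - s) * 'D_e f (p + s *: e) + -1 * (1 * f (p + s *: e))) =
  fun s : R => 1 * ((1 - s) * 'D_e f (p + s *: e)) + -1 * (1 * f (p + s *: e)).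
  by apply/funext => s; rewrite [X in _ = X + _]mul1r.
rewrite int01_lin//; set X := int01 _; set Y := int01 _ => E.
have {}E : 1 * X + -1 * Y = - f p.
  apply: E => u; apply: cvgD; apply: cvgM; try exact: cvg_cst; [exact: C1|exact: C2].
by rewrite /prim /avg /line_int -/X -/Y; lra.
Qed.

Lemma avg_lin e f g r s p : smooth f -> smooth g ->
  avg e (fun q => r * f q + s * g q) p = r * avg e f p + s * avg e g p.
Proof. exact: line_int_lin avg_psiC. Qed.

Lemma prim_lin e f g r s p : smooth f -> smooth g ->
  prim e (fun q => r * f q + s * g q) p = r * prim e f p + s * prim e g p.
Proof. exact: line_int_lin prim_psiC. Qed.

Lemma avg_id e f p : (forall u : R, f (p + u *: e) = f p) -> avg e f p = f p.
Proof.
by move=> fe; rewrite /avg /line_int; under eq_fun do rewrite mul1r fe; rewrite int01_cst.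
Qed.

End Averages.

(** * A smooth step function *)

Section SmoothStep.
Context {R : realType}.

(** The function x^-k exp(-1/x), extended by 0. All k are taken together because the derivative of
    [flat k] combines [flat k.+2] and [flat k.+1]. *)
Definition flat (k : nat) (x : R) : R :=
  if 0 < x then x^-1 ^+ k * expR (- x^-1) else 0.

Lemma flat_ge0 k x : 0 <= flat k x.
Proof.
by rewrite /flat; case: ifP => // x0; rewrite mulr_ge0 ?expR_ge0// exprn_ge0// invr_ge0 ltW.
Qed.

(** From y^(k+2) / (k+2)! <= exp y at y = 1/x. The quadratic bound is what makes the derivative at 0
    vanish. *)
Lemma flat_le k x : flat k x <= k.+2`!%:R * x ^+ 2.
Proof.
rewrite /flat; case: ifP => x0; last by rewrite mulr_ge0 ?sqr_ge0.
have x1 : 0 <= x^-1 by rewrite invr_ge0 ltW.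
rewrite expRN ler_pdivrMr ?expR_gt0//.
have := expR_ge1Dxn k.+1 x1 => H.
have {}H : x^-1 ^+ k.+2 / k.+2`!%:R <= expR x^-1.
  by apply: le_trans H; rewrite lerDr.
have f0 : 0 < (k.+2)`!%:R :> R by rewrite ltr0n fact_gt0.
rewrite ler_pdivrMr// in H.
rewrite mulrAC; apply: (le_trans (y := (expR x^-1 * k.+2`!%:R) * x ^+ 2)); last first.
  by rewrite [expR _ * _]mulrC.
apply: (le_trans (y := x^-1 ^+ k.+2 * x ^+ 2)); last by rewrite ler_wpM2r ?sqr_ge0.
by rewrite -addn2 exprD -mulrA -exprMn mulVf ?expr1n ?mulr1// gt_eqF.
Qed.

Lemma is_derive_flat k (x : R) :
  is_derive x 1 (flat k) (flat k.+2 x - k%:R * flat k.+1 x).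
Proof.
have [x0|x0|->] := ltgtP x 0.
- have -> : flat k.+2 x - k%:R * flat k.+1 x = 0.
    by rewrite /flat ltNge (ltW x0) /= mulr0 subrr.
  apply: (near_eq_is_derive (f := fun=> 0)).
  have near0 := lt_nbhsl x0.
  near=> y; rewrite /flat ltNge (ltW (near near0 y _))//.
- have E : flat k.+2 x - k%:R * flat k.+1 x =
      x^-1 ^+ k.+2 * expR (- x^-1) - k%:R * (x^-1 ^+ k.+1 * expR (- x^-1)).
    by rewrite /flat x0.
  rewrite E.
  have x0' : x != 0 by rewrite gt_eqF.
  have DV : is_derive x 1 (fun y : R => y^-1) (- x^-1 ^+ 2).
    have := @is_deriveV R id x 1 1 x0' (is_derive_id x (1 : R)).
    by rewrite /GRing.scale /= mulr1 exprVn.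
  have DX := is_deriveX k DV.
  have DN : is_derive x 1 (fun y : R => - y^-1) (- - x^-1 ^+ 2) by exact: is_deriveN DV.
  have DE := is_derive1_comp (g := fun y : R => - y^-1) (is_derive_expR (- x^-1)) DN.
  have near0 := lt_nbhsr x0.
  apply: (near_eq_is_derive
    (f := (fun y : R => y^-1) ^+ k * (expR \o (fun y : R => - y^-1)))).
    near=> y; rewrite /flat (near near0 y _)//.
    by rewrite -[LHS]/(((fun y : R => y^-1) ^+ k) y * expR (- y^-1)) exprfctE.
  apply: (is_derive_eq (is_deriveM DX DE)).
  rewrite /GRing.scale /= exprfctE opprK.
  by case: k {DX E} => [|k]; rewrite ?exprS /=; ring.
- have E : flat k.+2 0 - k%:R * flat k.+1 0 = 0 :> R.
    by rewrite /flat ltxx mulr0 subrr.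
  rewrite E.
  suff H : (fun h : R => h^-1 *: (flat k (h *: (1 : R) + 0) - flat k 0)) h @[h --> 0^'] --> (0 : R).
    by split; [apply/cvg_ex; exists 0|exact/cvg_lim].
  apply/cvgrPdist_le => eps eps0.
  have C0 : 0 < k.+2`!%:R :> R by rewrite ltr0n fact_gt0.
  have near1 := dnbhs0_le (V := R^o) (divr_gt0 eps0 C0).
  near=> h; rewrite sub0r normrN addr0 (_ : h *: (1 : R) = h); last exact: mulr1.
  rewrite {2}/flat ltxx subr0 normrM.
  have h0 : h != 0 by near: h; exact: nbhs_dnbhs_neq.
  rewrite normfV ler_pdivrMl ?normr_gt0// (ger0_norm (flat_ge0 _ _)).
  apply: (le_trans (flat_le k h)); rewrite -real_normK ?num_real// expr2 mulrA [leRHS]mulrC.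
  apply: ler_wpM2r => //; rewrite mulrC -ler_pdivlMr//.
  exact: (near near1 h).
Unshelve. all: by end_near. Qed.

(** Constant below 1/3 and above 2/3; these margins let neighbouring windows overlap in
    [glue_window]. *)
Definition step (x : R) : R :=
  flat 0 (x - 3^-1) / (flat 0 (x - 3^-1) + flat 0 (2 / 3 - x)).

Lemma flat_gt0 k x : 0 < x -> 0 < flat k x.
Proof. by move=> x0; rewrite /flat x0 mulr_gt0 ?expR_gt0// exprn_gt0// invr_gt0. Qed.

Lemma flat_eq0 k x : x <= 0 -> flat k x = 0.
Proof. by move=> x0; rewrite /flat ltNge x0. Qed.

Lemma step_denom x : flat 0 (x - 3^-1) + flat 0 (2 / 3 - x) != 0.
Proof.
have [x12|x12] := ltP (2^-1) x.
  by rewrite gt_eqF// ltr_pwDl ?flat_ge0// flat_gt0//; lra.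
by rewrite gt_eqF// ltr_wpDl ?flat_ge0// flat_gt0//; lra.
Qed.

Lemma step0 x : x <= 3^-1 -> step x = 0.
Proof. by move=> x3; rewrite /step flat_eq0 ?mul0r// subr_le0. Qed.

Lemma step1 x : 2 / 3 <= x -> step x = 1.
Proof.
move=> x3; rewrite /step; have := step_denom x.
by rewrite [flat 0 (2 / 3 - x)]flat_eq0 ?subr_le0// addr0 => /divff.
Qed.

Context {n : nat}.
Variable j : 'I_n.

Lemma is_derive_line1 (g : R -> R) (l : 'rV[R]_n -> R) p v dg a :
  (forall t, l (t *: v + p) = l p + t * a) -> is_derive (l p) 1 g dg ->
  is_derive p v (g \o l) (a * dg).
Proof.
move=> lE gD.
have G1 : is_derive (0 : R) 1 (fun t : R => l p + t * a) a.
  have G := is_deriveD (is_derive_cst (l p) (0 : R) (1 : R))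
    (is_deriveM (is_derive_id (0 : R) (1 : R)) (is_derive_cst a (0 : R) (1 : R))).
  apply: (is_derive_eq G).
  by rewrite /GRing.scale /=; ring.
have gD' : is_derive (l p + 0 * a) 1 g dg by rewrite mul0r addr0.
have [G2 G3] := is_derive1_comp (g := fun t => l p + t * a) gD' G1.
have E : (fun t : R => t^-1 *: ((g \o l) (t *: v + p) - (g \o l) p)) =
    (fun t : R => t^-1 *: ((g \o (fun t => l p + t * a)) (t *: (1 : R) + 0) -
       (g \o (fun t => l p + t * a)) 0)).
  apply/funext => t; rewrite /= lE mul0r !addr0.
  by have -> : t *: (1 : R) = t by exact: mulr1.
split; first by rewrite /derivable E.
by rewrite mulrC -G3 /derive E.
Qed.

Inductive flat_closure (l : 'rV[R]_n -> R) : ('rV[R]_n -> R) -> Prop :=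
| Flat_scale c k : flat_closure l (fun p => c * flat k (l p))
| Flat_add f g of flat_closure l f & flat_closure l g :
    flat_closure l (fun p => f p + g p).

Lemma smooth_flat k a c : smooth (fun p : 'rV[R]_n => flat k (a * crd j p + c)).
Proof.
pose l (p : 'rV[R]_n) := a * crd j p + c.
have lS : smooth l by apply: smoothD; [apply: smoothZ; exact: smooth_crd|exact: smooth_cst].
have lE p v t : l (t *: v + p) = l p + t * (a * crd j v).
  by rewrite /l /crd !mxE; ring.
have D m p v := is_derive_line1 (fun t => lE p v t) (is_derive_flat m (l p)).
apply: (@smooth_coind _ _ (flat_closure l)); last first.
  have := Flat_scale l 1 k.
  by under [X in flat_closure l X]eq_fun do rewrite mul1r.
move=> h; elim=> [d m|f g _ [df fC] _ [dg gC]]; split.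
- move=> p; apply: differentiableM; first exact: differentiable_cst.
  apply: (differentiable_comp (f := l) (g := flat m)).
    exact: smooth_differentiable.
  by apply/derivable1_diffP; case: (is_derive_flat m (l p)).
- move=> v.
  have -> : 'D_v (fun p => d * flat m (l p)) = fun p =>
     (d * (a * crd j v)) * flat m.+2 (l p) + (- (d * (a * crd j v) * m%:R)) * flat m.+1 (l p).
    apply/funext => p; have [D1 D2] := D m p v.
    have -> : (fun p => d * flat m (l p)) = d *: (flat m \o l) by [].
    by rewrite deriveZ// D2 /GRing.scale /=; ring.
  by apply: Flat_add; exact: Flat_scale.
- by move=> p; exact: differentiableD.
- move=> v; have -> : 'D_v (fun p => f p + g p) = fun p => 'D_v f p + 'D_v g p.
    by apply/funext => p; rewrite deriveD//; exact: diff_derivable.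
  exact: Flat_add.
Qed.

Lemma smooth_step a c : smooth (fun p : 'rV[R]_n => step (a * crd j p + c)).
Proof.
have S1 : smooth (fun p : 'rV[R]_n => flat 0 (a * crd j p + c - 3^-1)).
  have := smooth_flat 0 a (c - 3^-1).
  by under eq_fun do rewrite addrA.
have S2 : smooth (fun p : 'rV[R]_n => flat 0 (2 / 3 - (a * crd j p + c))).
  have := smooth_flat 0 (- a) (2 / 3 - c).
  rewrite (_ : (fun p : 'rV[R]_n => _) = fun p => flat 0 (2 / 3 - (a * crd j p + c)))//.
  by apply/funext => p; congr flat; ring.
apply: smoothM => //; apply: smoothV; first exact: smoothD.
by move=> p; exact: step_denom.
Qed.

End SmoothStep.

(** * Calculus of differential forms *)

Section FormCalculus.
Context {R : realType} {n : nat}.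
Implicit Types (p e u : 'rV[R]_n).

Lemma smooth_form_lin k (a b : diff_form R n k) r s :
  smooth_form a -> smooth_form b ->
  smooth_form (fun p v => r * a p v + s * b p v).
Proof.
move=> [aS aC] [bS bC]; split=> [p|v].
  exact: skew_lin (aS p) (bS p).
by apply: smooth_lin; [exact: aC|exact: bC].
Qed.

Lemma smooth_formD k (a b : diff_form R n k) :
  smooth_form a -> smooth_form b -> smooth_form (fun p v => a p v + b p v).
Proof.
move=> aS bS; have := smooth_form_lin 1 1 aS bS.
by under eq_fun do under eq_fun do rewrite !mul1r.
Qed.

Lemma smooth_formB k (a b : diff_form R n k) :
  smooth_form a -> smooth_form b -> smooth_form (fun p v => a p v - b p v).
Proof.
move=> aS bS; have := smooth_form_lin 1 (-1) aS bS.
by under eq_fun do under eq_fun do rewrite mul1r mulN1r.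
Qed.

Lemma smooth_form_mul k (f : 'rV[R]_n -> R) (a : diff_form R n k) :
  smooth f -> smooth_form a -> smooth_form (fun p v => f p * a p v).
Proof.
move=> fS [aS aC]; split=> [p|v]; first exact: skewZ (aS p).
by apply: smoothM => //; exact: aC.
Qed.

Lemma smooth_formZ k (r : R) (a : diff_form R n k) :
  smooth_form a -> smooth_form (fun p v => r * a p v).
Proof. exact: smooth_form_mul (smooth_cst r). Qed.

Lemma smooth_form0 k : smooth_form ((fun _ _ => 0) : diff_form R n k).
Proof. by split=> [p|v]; [exact: (skew0 k)|exact: smooth_cst]. Qed.

Lemma smooth_form_sum k I (s : seq I) (a : I -> diff_form R n k) :
  (forall i, smooth_form (a i)) ->
  smooth_form (fun p v => \sum_(i <- s) a i p v).
Proof.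
move=> aS; split=> [p|v].
  by apply: skew_sum => i; exact: (aS i).1.
by apply: smooth_sum => i; exact: (aS i).2.
Qed.

Lemma smooth_form_cst k (c : 'M[R]_(k, n) -> R) :
  skew c -> smooth_form (fun _ => c).
Proof. by move=> cS; split=> // v; exact: smooth_cst. Qed.

Lemma smooth_form_contr k e (a : diff_form R n k.+1) :
  smooth_form a -> smooth_form (fun p => contr e (a p)).
Proof. by move=> [aS aC]; split=> [p|v]; [exact: skew_contr (aS p)|exact: aC]. Qed.

Lemma smooth_form_cowedge k j (a : diff_form R n k) :
  smooth_form a -> smooth_form (fun p => cowedge (crd j) (a p)).
Proof.
move=> [aS aC]; split=> [p|v].
  by apply: skew_cowedge; [exact: covector_crd|exact: aS].
by apply: smooth_sum => i; do 2 apply: smoothZ; exact: aC.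
Qed.

(** The pattern shared by directional derivatives and by averages and primitives along segments.
    Applied to coefficients, such an operator acts on forms and commutes with exterior
    multiplication by a coordinate covector. *)
Definition smooth_op (T : ('rV[R]_n -> R) -> 'rV[R]_n -> R) :=
  (forall f, smooth f -> smooth (T f)) /\
  (forall f g r s, smooth f -> smooth g ->
    T (fun p => r * f p + s * g p) = fun p => r * T f p + s * T g p).

Definition form_op (T : ('rV[R]_n -> R) -> 'rV[R]_n -> R) k
  (a : diff_form R n k) : diff_form R n k := fun p v => T (a ^~ v) p.

Lemma smooth_op0 T : smooth_op T -> T (fun=> 0) = fun=> 0.
Proof.
move=> [_ TL]; have := TL (fun=> 0) (fun=> 0) 0 0 (smooth_cst 0) (smooth_cst 0).
by under eq_fun do rewrite !mul0r addr0; under [RHS]eq_fun do rewrite !mul0r addr0.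
Qed.

Lemma smooth_op_sum T I (s : seq I) (c : I -> R) (f : I -> 'rV[R]_n -> R) p :
  smooth_op T -> (forall i, smooth (f i)) ->
  T (fun q => \sum_(i <- s) c i * f i q) p = \sum_(i <- s) c i * T (f i) p.
Proof.
move=> TP fS; elim: s => [|i s IH].
  by under eq_fun do rewrite big_nil; rewrite smooth_op0// big_nil.
under eq_fun do rewrite big_cons -[X in _ + X]mul1r.
rewrite TP.2//; first by rewrite big_cons IH mul1r.
by apply: smooth_sum => j; exact: smoothZ.
Qed.

Lemma smooth_form_op T k (a : diff_form R n k) :
  smooth_op T -> smooth_form a -> smooth_form (form_op T a).
Proof.
move=> TP [aS aC]; split=> [p|v]; last exact: TP.1.
split=> [u v w i b c uvw vu wu|v i j ij vij]; rewrite /form_op.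
- have -> : a ^~ u = fun q => b * a q v + c * a q w.
    by apply/funext => q; rewrite ((aS q).1 _ _ _ _ _ _ uvw vu wu).
  by rewrite TP.2.
- have -> : a ^~ v = fun=> 0.
    by apply/funext => q; rewrite ((aS q).2 _ _ _ ij vij).
  by rewrite smooth_op0.
Qed.

Lemma form_op_cowedge T k j (a : diff_form R n k) : smooth_op T ->
  smooth_form a ->
  form_op T (fun p => cowedge (crd j) (a p)) =
  fun p => cowedge (crd j) (form_op T a p).
Proof.
move=> TP aS; apply/funext => p; apply/funext => v; rewrite /form_op /cowedge.
have -> : (fun q => \sum_(i < k.+1) (-1) ^+ i * (crd j (row i v) * a q (row' i v))) =
    fun q => \sum_(i < k.+1) ((-1) ^+ i * crd j (row i v)) * a q (row' i v).
  by apply/funext => q; apply: eq_bigr => i _; rewrite mulrA.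
rewrite smooth_op_sum//; first by apply: eq_bigr => i _; rewrite mulrA.
by move=> i; case: aS.
Qed.

Definition ddir u (f : 'rV[R]_n -> R) : 'rV[R]_n -> R := 'D_u f.

Lemma smooth_op_derive u : smooth_op (ddir u).
Proof.
split=> [f fS|f g r s fS gS]; first exact: smooth_derive.
apply/funext => p; rewrite /ddir.
have -> : (fun p => r * f p + s * g p) = r *: f + s *: g by [].
have fD := smooth_differentiable p fS; have gD := smooth_differentiable p gS.
rewrite deriveD; [|by apply: derivableZ; exact: diff_derivable..].
by rewrite !deriveZ//; exact: diff_derivable.
Qed.

Lemma smooth_op_avg e : smooth_op (avg e).
Proof.
split=> [f|f g r s fS gS]; first exact: smooth_avg.
by apply/funext => p; exact: avg_lin.
Qed.

Lemma smooth_op_prim e : smooth_op (prim e).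
Proof.
split=> [f|f g r s fS gS]; first exact: smooth_prim.
by apply/funext => p; exact: prim_lin.
Qed.

Lemma extdE k (a : diff_form R n k) p : smooth_form a ->
  extd a p = fun v => \sum_l cowedge (crd l) (form_op (ddir (delta_mx 0 l)) a p) v.
Proof.
move=> aS; apply/funext => v; rewrite /extd /cowedge exchange_big /=.
apply: eq_bigr => i _; rewrite derive_delta; last first.
  by apply: smooth_differentiable; exact: aS.2.
by rewrite mulr_sumr; apply: eq_bigr => l _; rewrite /form_op /crd.
Qed.

Lemma smooth_form_extd k (a : diff_form R n k) : smooth_form a -> smooth_form (extd a).
Proof.
move=> aS; have -> : extd a = fun p v => \sum_l cowedge (crd l) (form_op (ddir (delta_mx 0 l)) a p) v.
  by apply/funext => p; exact: extdE.
apply: smooth_form_sum => l.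
apply: (@smooth_form_cowedge _ _ (form_op (ddir (delta_mx 0 l)) a)).
by apply: smooth_form_op => //; exact: smooth_op_derive.
Qed.

Lemma extd_lin k (a b : diff_form R n k) r s : smooth_form a -> smooth_form b ->
  extd (fun p v => r * a p v + s * b p v) =
  fun p v => r * extd a p v + s * extd b p v.
Proof.
move=> aS bS; apply/funext => p; apply/funext => v; rewrite /extd.
rewrite !mulr_sumr -big_split; apply: eq_bigr => i _ /=.
have := (smooth_op_derive (row i v)).2 _ _ r s (aS.2 (row' i v)) (bS.2 (row' i v)).
move=> /(congr1 (@^~ p)) E.
have {E} -> : 'D_(row i v) (fun p => r * a p (row' i v) + s * b p (row' i v)) p =
  r * 'D_(row i v) (a ^~ (row' i v)) p + s * 'D_(row i v) (b ^~ (row' i v)) p by [].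
by ring.
Qed.

Lemma extdD k (a b : diff_form R n k) : smooth_form a -> smooth_form b ->
  extd (fun p v => a p v + b p v) = fun p v => extd a p v + extd b p v.
Proof.
move=> aS bS; transitivity (extd (fun p v => 1 * a p v + 1 * b p v)).
  by congr extd; apply/funext => p; apply/funext => v; rewrite !mul1r.
by rewrite extd_lin//; apply/funext => p; apply/funext => v; rewrite !mul1r.
Qed.

Lemma extdB k (a b : diff_form R n k) : smooth_form a -> smooth_form b ->
  extd (fun p v => a p v - b p v) = fun p v => extd a p v - extd b p v.
Proof.
move=> aS bS; transitivity (extd (fun p v => 1 * a p v + -1 * b p v)).
  by congr extd; apply/funext => p; apply/funext => v; rewrite mul1r mulN1r.
by rewrite extd_lin//; apply/funext => p; apply/funext => v; rewrite mul1r mulN1r.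
Qed.

Lemma extdZ k (a : diff_form R n k) r : smooth_form a ->
  extd (fun p v => r * a p v) = fun p v => r * extd a p v.
Proof.
move=> aS; transitivity (extd (fun p v => r * a p v + 0 * a p v)).
  by congr extd; apply/funext => p; apply/funext => v; rewrite mul0r addr0.
by rewrite extd_lin//; apply/funext => p; apply/funext => v; rewrite mul0r addr0.
Qed.

Lemma extd_op T k (a : diff_form R n k) : smooth_op T ->
  (forall f u, smooth f -> 'D_u (T f) = T ('D_u f)) -> smooth_form a ->
  extd (form_op T a) = form_op T (extd a).
Proof.
move=> TP TD aS; apply/funext => p; apply/funext => v; rewrite /extd /form_op.
rewrite smooth_op_sum//; last by move=> i; apply: smooth_derive; exact: aS.2.
by apply: eq_bigr => i _; rewrite -TD//; exact: aS.2.
Qed.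

(** Cartan's formula for a constant vector field, whose Lie derivative just differentiates the
    coefficients. *)
Lemma cartan k (a : diff_form R n k.+1) e p v :
  contr e (extd a p) v =
  'D_e (a ^~ v) p - extd (fun q => contr e (a q)) p v.
Proof.
rewrite /contr /extd big_ord_recl mul1r row0_col_mx row'0_col_mx -sumrN.
congr (_ + _); apply: eq_bigr => i _.
by rewrite rowS_col_mx row'S_col_mx lift0 exprS mulN1r mulNr.
Qed.

Lemma cartan0 (a : diff_form R n 0) e p v :
  contr e (extd a p) v = 'D_e (a ^~ v) p.
Proof.
by rewrite /contr /extd big_ord_recl big_ord0 addr0 mul1r row0_col_mx row'0_col_mx.
Qed.

Lemma extd_mul k (f : 'rV[R]_n -> R) (a : diff_form R n k) p : smooth f ->
  smooth_form a ->
  extd (fun p v => f p * a p v) p =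
  fun v => f p * extd a p v + cowedge (fun u => 'D_u f p) (a p) v.
Proof.
move=> fS aS; apply/funext => v; rewrite /extd /cowedge mulr_sumr -big_split.
apply: eq_bigr => i _ /=.
rewrite (deriveM (f := f) (g := a ^~ (row' i v))).
- by rewrite /GRing.scale /=; ring.
- exact: smooth_derivable.
- by apply: smooth_derivable; exact: aS.2.
Qed.

(** For closed [a], Cartan's formula gives D_e a = d (iota_e a). Applying [prim e] turns the left
    side into the average minus [a], and [prim e] commutes with d. *)
Lemma avg_closed k (a : diff_form R n k.+1) e : smooth_form a ->
  extd a = (fun _ _ => 0) ->
  form_op (avg e) a =
  fun p v => a p v + extd (form_op (prim e) (fun q => contr e (a q))) p v.
Proof.
move=> aS da0; apply/funext => p; apply/funext => v.
rewrite extd_op; [|exact: smooth_op_prim|by move=> f u fS; exact: derive_prim|exact: smooth_form_contr].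
have H : (extd (fun q => contr e (a q)))^~ v = 'D_e (a ^~ v).
  apply/funext => q; have := cartan a e q v; rewrite da0 /contr.
  by move/esym/eqP; rewrite subr_eq0 => /eqP <-.
rewrite /form_op H prim_derive; last exact: aS.2.
by rewrite addrC subrK.
Qed.

Definition avgs I (e : I -> 'rV[R]_n) (s : seq I) (f : 'rV[R]_n -> R) :=
  foldr (fun i => avg (e i)) f s.

Lemma smooth_op_avgs I (e : I -> 'rV[R]_n) s : smooth_op (avgs e s).
Proof.
elim: s => [|i s [IH1 IH2]]; first by split.
split=> [f fS|f g r r' fS gS] /=; first by apply: smooth_avg; exact: IH1.
rewrite IH2//; apply/funext => p; apply: avg_lin; exact: IH1.
Qed.

Lemma derive_avgs I (e : I -> 'rV[R]_n) s f u : smooth f ->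
  'D_u (avgs e s f) = avgs e s ('D_u f).
Proof.
move=> fS; elim: s => //= i s IH; rewrite derive_avg ?IH//.
exact: (smooth_op_avgs e s).1.
Qed.

(** One homotopy per direction, added up. The last two clauses are what gluing needs: the primitive
    keeps the periods of [a], and it keeps divisibility by a covector dx_j vanishing on all
    directions, because contraction with such a direction anticommutes with dx_j. *)
Lemma avgs_closed k I (e : I -> 'rV[R]_n) s (a : diff_form R n k.+1) :
  smooth_form a -> extd a = (fun _ _ => 0) ->
  exists eta : diff_form R n k,
    [/\ smooth_form eta,
        form_op (avgs e s) a = (fun p v => a p v + extd eta p v),
        (forall c, (forall p v, a (p + c) v = a p v) ->
           forall p v, eta (p + c) v = eta p v) &
        (forall j, (forall i, crd j (e i) = 0) ->
           (forall p, cowedge (crd j) (a p) = fun=> 0) ->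
           forall p, cowedge (crd j) (eta p) = fun=> 0)].
Proof.
move=> aS da0; elim: s => [|i s [eta [etaS etaE etaP etaJ]]].
  exists (fun _ _ => 0); split=> //; first exact: smooth_form0.
  - apply/funext => p; apply/funext => v; rewrite /extd big1 ?addr0// => i _.
    by rewrite derive_cst mulr0.
  - by move=> j _ _ p; rewrite cowedge0.
set b := form_op (avgs e s) a.
have bS : smooth_form b by apply: smooth_form_op => //; exact: smooth_op_avgs.
have db0 : extd b = fun _ _ => 0.
  rewrite extd_op//; [|exact: smooth_op_avgs|by move=> *; exact: derive_avgs].
  by rewrite da0; apply/funext => p; apply/funext => v; rewrite /form_op smooth_op0//; exact: smooth_op_avgs.
set xi := form_op (prim (e i)) (fun q => contr (e i) (b q)).
have xiS : smooth_form xi.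
  by apply: smooth_form_op; [exact: smooth_op_prim|exact: smooth_form_contr].
exists (fun p v => eta p v + xi p v); split.
- exact: smooth_formD.
- rewrite extdD// -[LHS]/(form_op (avg (e i)) b) avg_closed//.
  by apply/funext => p; apply/funext => v; rewrite -/xi {1}/b etaE addrA.
- move=> c ac p v; congr (_ + _); first exact: etaP.
  rewrite /xi /form_op /prim /line_int; congr int01; apply/funext => t; congr (_ * _).
  have bc q w : b (q + c) w = b q w.
    rewrite /b /form_op; elim: (s) q => [|l s' IH] q /=; first exact: ac.
    rewrite /avg /line_int; congr int01; apply/funext => t'; congr (_ * _).
    by rewrite addrAC IH.
  by rewrite /contr addrAC bc.
- move=> j ej aj p; rewrite cowedgeD etaJ//; apply/funext => v; rewrite add0r.
  have -> : cowedge (crd j) (xi p) v = form_op (prim (e i)) (fun q => cowedge (crd j) (contr (e i) (b q))) p v.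
    rewrite (form_op_cowedge j (a := fun q => contr (e i) (b q)))//.
      exact: smooth_op_prim.
    exact: smooth_form_contr.
  have bj q : cowedge (crd j) (b q) = fun=> 0.
    rewrite -[LHS]/((fun q => cowedge (crd j) (b q)) q) -form_op_cowedge//; last exact: smooth_op_avgs.
    apply/funext => w; rewrite /form_op; under eq_fun do rewrite aj.
    by rewrite smooth_op0//; exact: smooth_op_avgs.
  have cbj q w : cowedge (crd j) (contr (e i) (b q)) w = 0.
    have := congr1 (@^~ w) (contr_cowedge (e i) (crd j) (b q)).
    by rewrite bj ej mul0r sub0r /contr => /eqP; rewrite eq_sym oppr_eq0 => /eqP.
  rewrite /form_op; under eq_fun do rewrite cbj.
  by rewrite smooth_op0//; exact: smooth_op_prim.
Qed.

(** The average along [e i] of the derivative along [e i] is f(p + e_i) - f(p), and averages in the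
    other directions preserve this periodicity. *)
Lemma avgs_derive_periodic (I : eqType) (e : I -> 'rV[R]_n) s f i : smooth f ->
  i \in s -> (forall p, f (p + e i) = f p) -> avgs e s ('D_(e i) f) = fun=> 0.
Proof.
move=> fS + fP; elim: s => //= l s IH; rewrite inE.
case: (eqVneq i l) => [<- _|_ /= /IH ->]; last first.
  by rewrite smooth_op0//; exact: smooth_op_avg.
have gS := (smooth_op_avgs e s).1 _ fS.
apply/funext => p; rewrite -derive_avgs// avg_derive//.
suff -> : avgs e s f (p + e i) = avgs e s f p by rewrite subrr.
elim: (s) p => [|m s' IH'] p /=; first exact: fP.
rewrite /avg /line_int; congr int01; apply/funext => t; congr (_ * _).
by rewrite addrAC IH'.
Qed.

Lemma derive_const_line (f : 'rV[R]_n -> R) u p : (forall t : R, f (p + t *: u) = f p) -> 'D_u f p = 0.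
Proof.
move=> fu; rewrite /derive.
have -> : (fun h : R => h^-1 *: ((f \o shift p) (h *: u) - f p)) = fun=> 0.
  by apply/funext => h; rewrite /= [h *: u + p]addrC fu subrr scaler0.
exact: lim_cst.
Qed.

Lemma const_line_derive (f : 'rV[R]_n -> R) u : smooth f -> (forall p, 'D_u f p = 0) ->
  forall p, f (p + u) = f p.
Proof.
move=> fS fu p; have [t _] := mean_value (fun t => smooth_line p u t fS) ler01.
by rewrite scale1r scale0r addr0 fu mul0r => /eqP; rewrite subr_eq0 => /eqP.
Qed.

Lemma extd_cowedge_crd k j (a : diff_form R n k) : smooth_form a ->
  extd (fun p => cowedge (crd j) (a p)) =
  fun p v => - cowedge (crd j) (extd a p) v.
Proof.
move=> aS; apply/funext => p; apply/funext => v.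
rewrite extdE; last exact: smooth_form_cowedge.
rewrite extdE// cowedge_sum -sumrN; apply: eq_bigr => l _.
rewrite form_op_cowedge//; last exact: smooth_op_derive.
exact: (congr1 (@^~ v) (cowedge_anticomm _ _ _)).
Qed.

End FormCalculus.

(** * Torus bundles over the circle *)

Section Bundle.
Context {R : realType} {d : nat}.
Variables (t : R) (e : 'I_d -> 'rV[R]_d.+1) (T : int -> 'M[R]_d.+1).
Hypothesis t_neq0 : t != 0.
Hypothesis e_fibre : forall j, crd ord0 (e j) = 0.
Hypothesis e_span : forall v : 'rV[R]_d.+1, crd ord0 v = 0 ->
  exists c : 'I_d -> R, v = \sum_j c j *: e j.
Hypotheses (T0 : T 0 = 1%:M) (TD : forall m m', T (m + m') = T m *m T m').
Hypothesis T_crd : forall m (v : 'rV[R]_d.+1), crd ord0 (v *m T m) = crd ord0 v.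
Hypothesis T_e0 : forall m, delta_mx 0 ord0 *m T m = delta_mx 0 ord0 :> 'rV[R]_d.+1.
Hypothesis T_lattice : forall m j, exists z : 'I_d -> int,
  e j *m T m = \sum_i (z i)%:~R *: e i.

Local Notation V := 'rV[R]_d.+1.
Local Notation e0 := (delta_mx 0 ord0 : V).
Local Notation x0 := (@crd R d.+1 ord0).
Implicit Types (p q u : V) (m : int).

(** The lift of the m-fold turn around the base: the base coordinate advances by m t and the
    holonomy moves the fibre. *)
Definition monodromy m p : V := p *m T m + (m%:~R * t) *: e0.

Definition pb m k (a : diff_form R d.+1 k) : diff_form R d.+1 k :=
  fun p v => a (monodromy m p) (v *m T m).

Definition periodic X (f : V -> X) := forall j p, f (p + e j) = f p.

Definition fibre_const X (f : V -> X) := forall p u, x0 u = 0 -> f (p + u) = f p.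

(* The forms on the quotient of R x R^d by the lattice spanned by the e j and by
   the lift (t0, x) |-> (t0 + t, T x) of the generator of the base. *)
Definition bundle_form k (a : diff_form R d.+1 k) :=
  [/\ smooth_form a, periodic a & forall m, pb m a = a].

Lemma x0Z (h : R) u : x0 (h *: u) = h * x0 u.
Proof. by rewrite /crd mxE. Qed.

Lemma monodromyD m m' p : monodromy m (monodromy m' p) = monodromy (m' + m) p.
Proof.
rewrite /monodromy mulmxDl -mulmxA -TD -scalemxAl T_e0 -addrA -scalerDl.
by rewrite intrD mulrDl.
Qed.

Lemma monodromy_add m p u : monodromy m (p + u) = monodromy m p + u *m T m.
Proof. by rewrite /monodromy mulmxDl addrAC. Qed.

Lemma x0_monodromy m p : x0 (monodromy m p) = x0 p + m%:~R * t.
Proof. by rewrite /monodromy linearD /= T_crd /crd !mxE eqxx mulr1. Qed.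

Lemma pbD k m m' (a : diff_form R d.+1 k) : pb m (pb m' a) = pb (m + m') a.
Proof.
by apply/funext => p; apply/funext => v; rewrite /pb monodromyD -mulmxA -TD.
Qed.

Lemma smooth_form_pb k m (a : diff_form R d.+1 k) : smooth_form a -> smooth_form (pb m a).
Proof.
move=> [aS aC]; split=> [p|v]; first exact: skew_comp (aS _).
exact: (smooth_comp_affine (T m) ((m%:~R * t) *: e0) (aC (v *m T m))).1.
Qed.

Lemma extd_pb k m (a : diff_form R d.+1 k) : smooth_form a ->
  extd (pb m a) = pb m (extd a).
Proof.
move=> [aS aC]; apply/funext => p; apply/funext => v; rewrite /extd {2}/pb.
apply: eq_bigr => i _; congr (_ * _).
have -> : row i (v *m T m) = row i v *m T m by rewrite row_mul.
have -> : row' i (v *m T m) = row' i v *m T m by rewrite !row'Esub mul_rowsub_mx.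
exact: (smooth_comp_affine (T m) ((m%:~R * t) *: e0) (aC _)).2.
Qed.

Lemma contr_pb k m (a : diff_form R d.+1 k.+1) :
  (fun p => contr e0 (pb m a p)) = pb m (fun p => contr e0 (a p)).
Proof.
apply/funext => p; apply/funext => v; rewrite /contr /pb; congr (a _ _).
by rewrite (mul_col_mx e0 v) T_e0.
Qed.

Lemma cowedge_pb k m (a : diff_form R d.+1 k) :
  (fun p => cowedge x0 (pb m a p)) = pb m (fun p => cowedge x0 (a p)).
Proof.
apply/funext => p; apply/funext => v; rewrite /cowedge /pb; apply: eq_bigr => i _.
by rewrite row_mul T_crd !row'Esub mul_rowsub_mx.
Qed.

Lemma periodic_int X (f : V -> X) j (z : int) p : periodic f ->
  f (p + z%:~R *: e j) = f p.
Proof.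
move=> fP.
have natP (l : nat) q : f (q + l%:R *: e j) = f q.
  elim: l => [|l IH]; first by rewrite scale0r addr0.
  by rewrite -natr1 scalerDl scale1r addrA fP.
case: z => l; first exact: natP.
by rewrite NegzE mulrNz scaleNr -[LHS](natP l.+1) subrK.
Qed.

Lemma periodic_lattice X (f : V -> X) (z : 'I_d -> int) p : periodic f ->
  f (p + \sum_i (z i)%:~R *: e i) = f p.
Proof.
move=> fP; elim: (index_enum _) p => [|i s IH] p; first by rewrite big_nil addr0.
by rewrite big_cons addrA IH periodic_int.
Qed.

Lemma periodic_monodromy X (f : V -> X) m : periodic f -> periodic (f \o monodromy m).
Proof.
move=> fP j p; rewrite /= monodromy_add; have [z ->] := T_lattice m j.
exact: periodic_lattice.
Qed.

Lemma periodic_pb k m (a : diff_form R d.+1 k) : periodic a -> periodic (pb m a).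
Proof.
move=> aP j p; apply/funext => v.
exact: (congr1 (@^~ (v *m T m)) (periodic_monodromy m aP j p)).
Qed.

Definition tau p : R := x0 p / t.

Definition cutoff m p : R := step (tau p - m%:~R).

Definition window m k (a : diff_form R d.+1 k) : diff_form R d.+1 k :=
  fun p v => (1 - cutoff m p) * pb (- m) a p v + cutoff m p * pb (- (m + 1)) a p v.

(* In the window m <= tau < m + 1, interpolates between the two translates of a
   by the neighbouring deck transformations. *)
Definition glue k (a : diff_form R d.+1 k) : diff_form R d.+1 k :=
  fun p => window (Num.floor (tau p)) a p.

Lemma smooth_cutoff m : smooth (cutoff m).
Proof.
have := smooth_step ord0 t^-1 (- m%:~R) (n := d.+1).
rewrite (_ : (fun p : V => _) = cutoff m)//.
by apply/funext => p; rewrite /cutoff /tau mulrC.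
Qed.

Lemma cutoff_fibre m : fibre_const (cutoff m).
Proof. by move=> p u u0; rewrite /cutoff /tau linearD /= u0 addr0. Qed.

Lemma fibre_derive (f : V -> R) p u : smooth f -> fibre_const f ->
  'D_u f p = x0 u * 'D_e0 f p.
Proof.
move=> fS fF.
have uE : u = x0 u *: e0 + 1 *: (u - x0 u *: e0) by rewrite scale1r addrC subrK.
rewrite {1}uE derive_linear; last exact: smooth_differentiable.
rewrite [X in _ + 1 * X]derive_const_line ?mulr0 ?addr0// => h; apply: fF.
by rewrite /crd !mxE !eqxx mulr1 subrr mulr0.
Qed.

Lemma fibre_const_derive (f : V -> R) u : smooth f -> fibre_const f ->
  fibre_const ('D_u f).
Proof.
move=> fS fF p w w0.
have := derive_shift_rV w u p fS.
by have -> : (fun q => f (q + w)) = f by apply/funext => q; exact: fF.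
Qed.

Lemma smooth_form_window m k (a : diff_form R d.+1 k) : smooth_form a ->
  smooth_form (window m a).
Proof.
move=> aS; have sS := smooth_cutoff m.
apply: smooth_formD; apply: smooth_form_mul => //.
- by apply: smoothB => //; exact: smooth_cst.
- exact: smooth_form_pb.
- exact: smooth_form_pb.
Qed.

Lemma glue_window k (a : diff_form R d.+1 k) m p :
  m%:~R - 3^-1 <= tau p <= m%:~R + 1 + 3^-1 -> glue a p = window m a p.
Proof.
move=> /andP[lo hi]; have [fl fh] : (Num.floor (tau p))%:~R <= tau p /\
    tau p < (Num.floor (tau p))%:~R + 1.
  by have /andP[] := floor_itv (tau p); rewrite intrD.
rewrite /glue; set l := Num.floor _ in fl fh *.
have lm : m - 1 <= l.
  rewrite -ltzD1 -(ltr_int R) !intrD; lra.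
have ml : l <= m + 1.
  rewrite -ltzD1 -(ltr_int R) !intrD; lra.
have [->//|[lm1|lm1]] : l = m \/ l = m - 1 \/ l = m + 1 by lia.
- have s1 : step (tau p - l%:~R) = 1.
    by apply: step1; rewrite lm1 intrD in fl fh *; lra.
  have s0 : step (tau p - m%:~R) = 0.
    by apply: step0; rewrite lm1 intrD in fl fh *; lra.
  rewrite /window /cutoff s0 s1; apply/funext => v.
  by rewrite lm1 subrK; ring.
- have s0 : step (tau p - l%:~R) = 0.
    by apply: step0; rewrite lm1 intrD in fl fh *; lra.
  have s1 : step (tau p - m%:~R) = 1.
    by apply: step1; rewrite lm1 intrD in fl fh *; lra.
  rewrite /window /cutoff s0 s1; apply/funext => v.
  by rewrite lm1; ring.
Qed.

(** The floor jumps at integers, but by the overlap a single window formula holds on a whole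
    neighbourhood. Smoothness and the differential of [glue a] are read off from it. *)
Lemma glue_near k (a : diff_form R d.+1 k) p :
  exists m, \forall q \near p, glue a q = window m a q.
Proof.
exists (Num.floor (tau p)).
have tC : {for p, continuous tau}.
  have tS : smooth (fun q : V => t^-1 * crd ord0 q) by apply: smoothZ; exact: smooth_crd.
  have := smooth_continuous tS (x := p).
  by rewrite (_ : (fun q : V => t^-1 * _) = tau)//; apply/funext => q; exact: mulrC.
have /andP[fl fh] := floor_itv (tau p); rewrite intrD in fh.
have e3 : 0 < 3^-1 :> R by rewrite invr_gt0.
have /cvgrPdist_le/(_ _ e3) near3 := tC.
near=> q; apply: glue_window.
have : `|tau p - tau q| <= 3^-1 by exact: (near near3 q).
rewrite ler_norml => /andP[lo hi].
by apply/andP; split; lra.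
Unshelve. all: by end_near. Qed.

Lemma smooth_form_glue k (a : diff_form R d.+1 k) : smooth_form a -> smooth_form (glue a).
Proof.
move=> aS; split=> [p|v]; first exact: (smooth_form_window _ aS).1.
apply: smooth_local => p; have [m am] := glue_near a p.
exists ((window m a)^~ v); first exact: (smooth_form_window m aS).2.
by apply: filterS am => q ->.
Qed.

Lemma extd_near k (a b : diff_form R d.+1 k) p :
  (\forall q \near p, a q = b q) -> extd a p = extd b p.
Proof.
move=> ab; apply/funext => v; rewrite /extd; apply: eq_bigr => i _; congr (_ * _).
by apply: near_eq_derive; apply: filterS ab => q ->.
Qed.

Lemma extd_fibre_mul k (f : V -> R) (a : diff_form R d.+1 k) p :
  smooth f -> fibre_const f -> smooth_form a ->
  extd (fun p v => f p * a p v) p =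
  fun v => f p * extd a p v + 'D_e0 f p * cowedge x0 (a p) v.
Proof.
move=> fS fF aS; rewrite extd_mul//; apply/funext => v; congr (_ + _).
rewrite /cowedge mulr_sumr; apply: eq_bigr => i _.
by rewrite fibre_derive//; ring.
Qed.

(** The two cutoffs sum to 1, so their derivatives are opposite, and being functions of t they
    contribute dt times the difference of the two translates. *)
Lemma extd_window m k (a : diff_form R d.+1 k) p : smooth_form a ->
  extd (window m a) p = fun v => window m (extd a) p v +
    'D_e0 (cutoff m) p * cowedge x0 (fun w => pb (- (m + 1)) a p w - pb (- m) a p w) v.
Proof.
move=> aS; have sS := smooth_cutoff m; have sF := cutoff_fibre m.
have s1S : smooth (fun p => 1 - cutoff m p) by apply: smoothB => //; exact: smooth_cst.
have s1F : fibre_const (fun p => 1 - cutoff m p) by move=> q u u0; rewrite sF.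
have aS1 := smooth_form_pb (- m) aS; have aS2 := smooth_form_pb (- (m + 1)) aS.
rewrite extdD; [|exact: smooth_form_mul..].
apply/funext => v; rewrite !extd_fibre_mul// !extd_pb// cowedgeB /window.
have -> : 'D_e0 (fun p => 1 - cutoff m p) p = - 'D_e0 (cutoff m) p.
  have -> : (fun p => 1 - cutoff m p) = cst 1 - cutoff m by [].
  rewrite deriveB; [|exact: derivable_cst|exact: smooth_derivable].
  by rewrite derive_cst sub0r.
by ring.
Qed.

Lemma periodic_glue k (a : diff_form R d.+1 k) : periodic a -> periodic (glue a).
Proof.
move=> aP j p; apply/funext => v.
have tE : tau (p + e j) = tau p by rewrite /tau linearD /= e_fibre addr0.
by rewrite /glue /window /cutoff !tE !periodic_pb.
Qed.

(** Advancing by m periods shifts [tau] and its floor by m; the shifted window index is absorbed by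
    the translates. *)
Lemma pb_glue k (a : diff_form R d.+1 k) m : pb m (glue a) = glue a.
Proof.
apply/funext => p; apply/funext => v.
have tE : tau (monodromy m p) = tau p + m%:~R.
  by rewrite /tau x0_monodromy mulrDl mulfK.
have fE : Num.floor (tau (monodromy m p)) = Num.floor (tau p) + m.
  by rewrite tE floorDrz ?intr_int// intrKfloor.
have pbE l : pb (- (l + m)) a (monodromy m p) (v *m T m) = pb (- l) a p v.
  rewrite -[LHS]/(pb m (pb (- (l + m)) a) p v) pbD; congr (pb _ a p v); lia.
rewrite {1}/pb /glue fE /window /cutoff tE pbE.
have -> : Num.floor (tau p) + m + 1 = Num.floor (tau p) + 1 + m by lia.
rewrite pbE; have -> // : tau p + m%:~R - (Num.floor (tau p) + m)%:~R =
  tau p - (Num.floor (tau p))%:~R.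
by rewrite intrD; ring.
Qed.

Definition fibre_avg (f : V -> R) := avgs e (index_enum 'I_d) f.

Lemma smooth_op_fibre_avg : smooth_op fibre_avg.
Proof. exact: smooth_op_avgs. Qed.

Lemma fibre_avg_derive0 f u : smooth f -> periodic f -> x0 u = 0 ->
  fibre_avg ('D_u f) = fun=> 0.
Proof.
move=> fS fP u0; have [c ->] := e_span u0.
have -> : 'D_(\sum_j c j *: e j) f = fun p => \sum_(j <- index_enum 'I_d) c j * 'D_(e j) f p.
  apply/funext => p; rewrite deriveE; last exact: smooth_differentiable.
  rewrite linear_sum; apply: eq_bigr => j _; rewrite linearZ -deriveE//.
  exact: smooth_differentiable.
apply/funext => p; rewrite /fibre_avg smooth_op_sum; [|exact: smooth_op_avgs|].
  rewrite big1// => j _; rewrite avgs_derive_periodic ?mulr0//.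
  by rewrite mem_index_enum.
by move=> j; exact: smooth_derive.
Qed.

Lemma fibre_avg_const f : smooth f -> periodic f -> fibre_const (fibre_avg f).
Proof.
move=> fS fP p u u0; apply: const_line_derive; first exact: smooth_op_fibre_avg.1.
move=> q; apply: (eq_trans (congr1 (@^~ q) (derive_avgs e (index_enum 'I_d) u fS))).
exact: (congr1 (@^~ q) (fibre_avg_derive0 fS fP u0)).
Qed.

Lemma fibre_avg_id f : fibre_const f -> fibre_avg f = f.
Proof.
move=> fF; rewrite /fibre_avg; elim: (index_enum _) => //= j s ->.
apply/funext => p; apply: avg_id => h; apply: fF.
by rewrite x0Z e_fibre mulr0.
Qed.

Lemma fibre_const_periodic X (f : V -> X) : fibre_const f -> periodic f.
Proof. by move=> fF j p; exact: fF. Qed.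

Lemma periodic_avgs f s : periodic f -> periodic (avgs e s f).
Proof.
move=> fP; elim: s => //= l s IH j p; rewrite /avg /line_int.
by congr int01; apply/funext => h; rewrite addrAC IH.
Qed.

Lemma smooth_monodromy f m : smooth f -> smooth (f \o monodromy m).
Proof. by move=> fS; exact: (smooth_comp_affine (T m) ((m%:~R * t) *: e0) fS).1. Qed.

(** The holonomy takes the cell spanned by the [e j] to another cell of the lattice. Instead of a
    change of variables, the averages are inserted one direction at a time inside the composition:
    each changes the function by a fibre derivative of a periodic function, which [fibre_avg]
    kills. *)
Lemma fibre_avg_monodromy f m : smooth f -> periodic f ->
  fibre_avg (f \o monodromy m) = fibre_avg f \o monodromy m.
Proof.
move=> fS fP.
have avF : fibre_const (fibre_avg f \o monodromy m).
  move=> p u u0; rewrite /= monodromy_add fibre_avg_const//.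
  by rewrite T_crd.
suff H s : fibre_avg (avgs e s f \o monodromy m) = fibre_avg (f \o monodromy m).
  by rewrite -(H (index_enum 'I_d)) fibre_avg_id.
elim: s => //= j s <-.
set g := avgs e s f; have gS : smooth g by exact: (smooth_op_avgs e s).1.
have gP : periodic g by exact: periodic_avgs.
pose h := prim (e j) g; have hS : smooth h by exact: smooth_prim.
have hP : periodic h.
  move=> l p; rewrite /h /prim /line_int; congr int01; apply/funext => r.
  by rewrite addrAC gP.
(* The average differs from [g] by the derivative of [h] along [e j]; seen through the monodromy,
   this is the derivative along [e j *m T (- m)], still a fibre direction. *)
have -> : avg (e j) g \o monodromy m =
    fun p => 1 * (g \o monodromy m) p + 1 * 'D_(e j *m T (- m)) (h \o monodromy m) p.
  apply/funext => p; rewrite !mul1r.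
  rewrite (smooth_comp_affine (T m) ((m%:~R * t) *: e0) hS).2.
  rewrite -mulmxA -TD addNr T0 mulmx1 -/(monodromy m p).
  have -> : 'D_(e j) h (monodromy m p) = prim (e j) ('D_(e j) g) (monodromy m p).
    exact: (congr1 (@^~ _) (derive_prim (e j) (e j) gS)).
  by rewrite prim_derive//= addrC subrK.
rewrite (smooth_op_fibre_avg).2; last 2 first.
- exact: smooth_monodromy.
- by apply: smooth_derive; exact: smooth_monodromy.
rewrite -/(fibre_avg _) fibre_avg_derive0.
- by apply/funext => p; rewrite mul1r mulr0 addr0.
- exact: smooth_monodromy.
- exact: periodic_monodromy.
- by rewrite T_crd e_fibre.
Qed.

Definition form_avg k (a : diff_form R d.+1 k) := form_op fibre_avg a.

Lemma smooth_form_avg k (a : diff_form R d.+1 k) :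
  smooth_form a -> smooth_form (form_avg a).
Proof. exact/smooth_form_op/smooth_op_fibre_avg. Qed.

Lemma extd_avg k (a : diff_form R d.+1 k) : smooth_form a ->
  extd (form_avg a) = form_avg (extd a).
Proof.
by move=> aS; rewrite extd_op//; [exact: smooth_op_fibre_avg|move=> *; exact: derive_avgs].
Qed.

Lemma form_avg0 k : form_avg ((fun _ _ => 0) : diff_form R d.+1 k) = fun _ _ => 0.
Proof.
by apply/funext => p; apply/funext => v; rewrite /form_avg /form_op smooth_op0//; exact: smooth_op_fibre_avg.
Qed.

Lemma fibre_const_form_avg k (a : diff_form R d.+1 k) :
  smooth_form a -> periodic a -> fibre_const (form_avg a).
Proof.
move=> aS aP p u u0; apply/funext => v; apply: fibre_avg_const => //; first exact: aS.2.
by move=> j q; rewrite aP.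
Qed.

Lemma pb_form_avg k (a : diff_form R d.+1 k) m :
  smooth_form a -> periodic a -> pb m a = a -> pb m (form_avg a) = form_avg a.
Proof.
move=> aS aP aE; apply/funext => p; apply/funext => v; rewrite -{2}aE.
rewrite /form_avg /form_op /pb.
rewrite -[LHS]/((fibre_avg (a ^~ (v *m T m)) \o monodromy m) p) -fibre_avg_monodromy//.
  exact: aS.2.
by move=> j q; rewrite aP.
Qed.

Lemma periodic_extd k (a : diff_form R d.+1 k) :
  smooth_form a -> periodic a -> periodic (extd a).
Proof.
move=> aS aP j p; apply/funext => v; rewrite /extd; apply: eq_bigr => i _.
congr (_ * _); rewrite -(derive_shift_rV (e j)); last exact: aS.2.
by have -> : (fun q => a (q + e j) (row' i v)) = a ^~ (row' i v)
  by apply/funext => q; rewrite aP.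
Qed.

Lemma bundle_form_lin k (a b : diff_form R d.+1 k) r s :
  bundle_form a -> bundle_form b -> bundle_form (fun p v => r * a p v + s * b p v).
Proof.
move=> [aS aP aE] [bS bP bE]; split; first exact: smooth_form_lin.
- by move=> j p; rewrite aP bP.
- by move=> m; rewrite -{2}(aE m) -{2}(bE m).
Qed.

Lemma bundle_formD k (a b : diff_form R d.+1 k) :
  bundle_form a -> bundle_form b -> bundle_form (fun p v => a p v + b p v).
Proof.
move=> aB bB; rewrite (_ : (fun _ _ => _) = fun p v => 1 * a p v + 1 * b p v).
  exact: bundle_form_lin.
by apply/funext => p; apply/funext => v; rewrite !mul1r.
Qed.

Lemma bundle_formB k (a b : diff_form R d.+1 k) :
  bundle_form a -> bundle_form b -> bundle_form (fun p v => a p v - b p v).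
Proof.
move=> aB bB; rewrite (_ : (fun _ _ => _) = fun p v => 1 * a p v + -1 * b p v).
  exact: bundle_form_lin.
by apply/funext => p; apply/funext => v; rewrite mul1r mulN1r.
Qed.

Lemma bundle_form_avg k (a : diff_form R d.+1 k) :
  bundle_form a -> bundle_form (form_avg a).
Proof.
move=> [aS aP aE]; split; first exact: smooth_form_avg.
- exact/fibre_const_periodic/fibre_const_form_avg.
- by move=> m; exact: pb_form_avg.
Qed.

Lemma bundle_form_extd k (a : diff_form R d.+1 k) :
  bundle_form a -> bundle_form (extd a).
Proof.
move=> [aS aP aE]; split; first exact: smooth_form_extd.
- exact: periodic_extd.
- by move=> m; rewrite -extd_pb// aE.
Qed.

Lemma bundle_form_glue k (a : diff_form R d.+1 k) :
  smooth_form a -> periodic a -> bundle_form (glue a).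
Proof.
by move=> aS aP; split; [exact: smooth_form_glue|exact: periodic_glue|move=> m; exact: pb_glue].
Qed.

(* The partition of unity depends on t only, so gluing the primitives of an
   invariant form costs only a multiple of dt. *)
Lemma glue_error k (a : diff_form R d.+1 k) (b : diff_form R d.+1 k.+1) p :
  smooth_form a -> extd a = b -> (forall m, pb m b = b) ->
  exists m, \forall q \near p, (fun v => b q v - extd (glue a) q v) =
    fun v => - 'D_e0 (cutoff m) q *
      cowedge x0 (fun w => pb (- (m + 1)) a q w - pb (- m) a q w) v.
Proof.
move=> aS ab bE; have [m am] := glue_near a p; exists m.
move: am => /nbhs_interior; apply: filterS => q aq.
rewrite (extd_near aq) extd_window// ab; apply/funext => v.
by rewrite /window !bE; ring.
Qed.

(** Near each point the error is a function of t times dt /\ (difference of two translates of [a]).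
    Both translates have differential [b], so the difference is closed, and differentiating the
    function only brings in a second dt. *)
Lemma glue_error_closed k (a : diff_form R d.+1 k) (b : diff_form R d.+1 k.+1) :
  smooth_form a -> extd a = b -> (forall m, pb m b = b) ->
  let r := fun p v => b p v - extd (glue a) p v in
  extd r = (fun _ _ => 0) /\ forall p, cowedge x0 (r p) = fun=> 0.
Proof.
move=> aS ab bE r; split=> [|p].
- apply/funext => p; have [m rm] := glue_error p aS ab bE.
  pose dl : diff_form R d.+1 k := fun q w => pb (- (m + 1)) a q w - pb (- m) a q w.
  have dlS : smooth_form dl by apply: smooth_formB; exact: smooth_form_pb.
  have cS := smooth_derive e0 (smooth_cutoff m).
  have cS' : smooth (fun q => - 'D_e0 (cutoff m) q).
    have := smoothZ (-1) cS.
    by under eq_fun do rewrite mulN1r.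
  have cF : fibre_const (fun q => - 'D_e0 (cutoff m) q).
    have dF : fibre_const ('D_e0 (cutoff m)).
      by apply: fibre_const_derive; [exact: smooth_cutoff|exact: cutoff_fibre].
    by move=> q u u0; exact: (congr1 -%R (dF q u u0)).
  rewrite (extd_near (b := fun q v => - 'D_e0 (cutoff m) q * cowedge x0 (dl q) v)) //.
  rewrite (extd_fibre_mul (a := fun q => cowedge x0 (dl q)))//; last exact: smooth_form_cowedge.
  rewrite extd_cowedge_crd// cowedge_cowedge_same.
  have -> : extd dl = fun _ _ => 0.
    rewrite extdB; [|exact: smooth_form_pb..].
    by rewrite !extd_pb// ab !bE; apply/funext => q; apply/funext => v; rewrite subrr.
  by apply/funext => v; rewrite cowedge0 oppr0 !mulr0 addr0.
- have [m /nbhs_singleton rm] := glue_error p aS ab bE.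
  by rewrite /r rm cowedgeZ cowedge_cowedge_same; apply/funext => v; rewrite mulr0.
Qed.

Lemma closed_fibre_const k (a : diff_form R d.+1 k.+1) :
  bundle_form a -> extd a = (fun _ _ => 0) ->
  exists theta eta, [/\ bundle_form theta, fibre_const theta,
    extd theta = (fun _ _ => 0), bundle_form eta &
    a = fun p v => theta p v + extd eta p v].
Proof.
move=> aB da0; have [aS aP aE] := aB.
have [eta0 [eta0S eta0E eta0P _]] := avgs_closed e (index_enum 'I_d) aS da0.
have avB := bundle_form_avg aB; have [avS avP avE] := avB.
have dav : extd (form_avg a) = fun _ _ => 0 by rewrite extd_avg// da0 form_avg0.
pose b := fun p v => a p v - form_avg a p v.
have bB : bundle_form b by exact: bundle_formB.
have [bS bP bE] := bB.
(* The sign: [avgs_closed] writes the average as [a] plus a differential, whereas [b] is [a] minus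
   the average. *)
pose e1 := fun p v => -1 * eta0 p v.
have e1S : smooth_form e1 by exact: smooth_formZ.
have e1P : periodic e1.
  move=> j p; apply/funext => v; congr (_ * _); apply: eta0P => q w.
  by rewrite aP.
have de1 : extd e1 = b.
  rewrite extdZ//; apply/funext => p; apply/funext => v.
  by rewrite /b /form_avg /fibre_avg eta0E; ring.
pose r := fun p v => b p v - extd (glue e1) p v.
have [dr0 rx0] := glue_error_closed e1S de1 bE.
have g1B := bundle_form_glue e1S e1P; have [g1S g1P g1E] := g1B.
have rB : bundle_form r by apply: bundle_formB => //; exact: bundle_form_extd.
have [rS rP rE] := rB.
have [eta1 [eta1S eta1E eta1P eta1x]] := avgs_closed e (index_enum 'I_d) rS dr0.
have ravB := bundle_form_avg rB; have [ravS ravP ravE] := ravB.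
pose b2 := fun p v => r p v - form_avg r p v.
have [b2S b2P b2E] : bundle_form b2 by exact: bundle_formB.
pose e2 := fun p v => -1 * eta1 p v.
have e2S : smooth_form e2 by exact: smooth_formZ.
have e2P : periodic e2.
  move=> j p; apply/funext => v; congr (_ * _); apply: eta1P => q w.
  by rewrite rP.
have e2x p : cowedge x0 (e2 p) = fun=> 0.
  by rewrite cowedgeZ eta1x//; apply/funext => v; rewrite mulr0.
have de2 : extd e2 = b2.
  rewrite extdZ//; apply/funext => p; apply/funext => v.
  by rewrite /b2 /form_avg /fibre_avg eta1E; ring.
have g2B := bundle_form_glue e2S e2P; have [g2S g2P g2E] := g2B.
(* All translates of [e2] are killed by dt, so this time the gluing error is zero. *)
have rE2 p v : b2 p v = extd (glue e2) p v.
  have [m /nbhs_singleton/(congr1 (@^~ v)) /=] := glue_error p e2S de2 b2E.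
  have pbx l : cowedge x0 (pb l e2 p) = fun=> 0.
    apply: (eq_trans (congr1 (@^~ p) (cowedge_pb l e2))).
    by apply/funext => w; rewrite /pb e2x.
  by rewrite cowedgeB !pbx subrr mulr0 => /eqP; rewrite subr_eq0 => /eqP.
exists (fun p v => form_avg a p v + form_avg r p v), (fun p v => glue e1 p v + glue e2 p v).
split.
- exact: bundle_formD.
- by move=> p u u0; rewrite !fibre_const_form_avg.
- rewrite extdD// dav extd_avg// dr0 form_avg0.
  by apply/funext => p; apply/funext => v; rewrite addr0.
- exact: bundle_formD.
- rewrite extdD//; apply/funext => p; apply/funext => v.
  have H1 : r p v = b p v - extd (glue e1) p v by [].
  have H2 : b2 p v = r p v - form_avg r p v by [].
  have H3 : b p v = a p v - form_avg a p v by [].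
  by rewrite -rE2 H2 H1 H3; ring.
Qed.

(** Averaging the primitive over the fibres commutes with d and fixes [a]; on forms depending on t
    only, d is dt /\ d/dt. *)
Lemma exact_fibre_const k (a : diff_form R d.+1 k.+1) (b : diff_form R d.+1 k) :
  fibre_const a -> bundle_form b -> a = extd b ->
  exists c, [/\ bundle_form c, fibre_const c &
    forall p, a p = cowedge x0 (form_op (ddir e0) c p)].
Proof.
move=> aF bB ab; have [bS bP bE] := bB; exists (form_avg b).
have cF := fibre_const_form_avg bS bP; split=> //; first exact: bundle_form_avg.
have -> : a = extd (form_avg b).
  rewrite extd_avg// -ab; apply/funext => p; apply/funext => v.
  by rewrite /form_avg /form_op fibre_avg_id// => q u u0; rewrite aF.
move=> p; rewrite extdE; last exact: smooth_form_avg.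
apply/funext => v; rewrite (bigD1 ord0)//= big1 ?addr0// => l l0.
suff -> : form_op (ddir (delta_mx 0 l)) (form_avg b) p = fun=> 0 by rewrite cowedge0.
apply/funext => w; apply: derive_const_line => h.
by rewrite cF// x0Z /crd mxE eqxx /= eq_sym (negbTE l0) mulr0.
Qed.

Local Notation te := (t *: e0).

Lemma monodromy1_fibre X (f : V -> X) p : fibre_const f -> f (monodromy 1 p) = f (p + te).
Proof.
move=> fF; rewrite /monodromy mul1r.
have -> : p *m T 1 + te = (p + te) + (p *m T 1 - p) by rewrite [RHS]addrC addrA subrK.
by apply: fF; rewrite linearB /= T_crd subrr.
Qed.

Lemma smooth_form_twist k m (a : diff_form R d.+1 k) :
  smooth_form a -> smooth_form (fun p v => a p (v *m T m)).
Proof.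
by move=> [aS aC]; split=> [p|v]; [exact: skew_comp (aS p)|exact: aC].
Qed.

Lemma bundle_form_twist k (a : diff_form R d.+1 k) : bundle_form a ->
  bundle_form (fun p v => a p (v *m T 1)).
Proof.
move=> [aS aP aE]; split; first exact: smooth_form_twist.
- by move=> j p; rewrite aP.
- move=> m; apply/funext => p; apply/funext => v.
  by rewrite -{2}(aE m) /pb -!mulmxA -!TD addrC.
Qed.

Lemma bundle_form_line_int psi k (a : diff_form R d.+1 k) :
  smooth_op (line_int psi te) -> bundle_form a -> fibre_const a ->
  bundle_form (form_op (line_int psi te) a) /\
  fibre_const (form_op (line_int psi te) a).
Proof.
move=> opS [aS aP aE] aF.
have bF : fibre_const (form_op (line_int psi te) a).
  move=> p u u0; apply/funext => v; rewrite /form_op /line_int; congr int01.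
  by apply/funext => h; rewrite addrAC (aF _ _ u0).
split=> //; split; first exact: smooth_form_op.
- exact: fibre_const_periodic.
- move=> m; apply/funext => p; apply/funext => v.
  rewrite /pb /form_op /line_int; congr int01; apply/funext => h; congr (_ * _).
  rewrite -[RHS](congr1 (fun b => b (p + h *: te) v) (aE m)) /pb monodromy_add.
  by rewrite -!scalemxAl T_e0.
Qed.

Lemma extd_fibre_const k (a : diff_form R d.+1 k) p : smooth_form a ->
  fibre_const a -> extd a p = cowedge x0 (form_op (ddir e0) a p).
Proof.
move=> aS aF; rewrite extdE//.
apply/funext => v; rewrite (bigD1 ord0)//= big1 ?addr0// => l l0.
suff -> : form_op (ddir (delta_mx 0 l)) a p = fun=> 0 by rewrite cowedge0.
apply/funext => w; apply: derive_const_line => h.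
by rewrite aF// x0Z /crd mxE eqxx /= eq_sym (negbTE l0) mulr0.
Qed.

Lemma derive_te (f : V -> R) p : smooth f -> 'D_te f p = t * 'D_e0 f p.
Proof.
move=> fS; rewrite deriveE; last exact: smooth_differentiable.
by rewrite linearZ -deriveE//; exact: smooth_differentiable.
Qed.

(** [h] solves dh/dt = g - M, where g is the contraction of [theta] with d/dt and M the mean of [H]
    over a period. The [prim] of [H] accounts for H - M; the mean of the twisted [C] accounts for
    the coboundary, because advancing by a period undoes the twist. By closedness of [theta],
    subtracting dh then leaves constant coefficients. *)
Lemma closed_constant k (theta : diff_form R d.+1 k.+1) (H C : diff_form R d.+1 k) :
  bundle_form theta -> fibre_const theta -> extd theta = (fun _ _ => 0) ->
  bundle_form H -> fibre_const H -> bundle_form C -> fibre_const C ->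
  (forall p v, H p (v *m T 1) = H p v) ->
  (forall p v, contr e0 (theta p) v = H p v + (C p (v *m T 1) - C p v)) ->
  exists c h, [/\ skew c, (forall m v, c (v *m T m) = c v), bundle_form h &
    theta = fun p v => c v + extd h p v].
Proof.
move=> thB thF dth HB HF CB CF HT gE.
pose tC := fun p v => C p (v *m T 1).
have tCB : bundle_form tC by exact: bundle_form_twist.
have tCF : fibre_const tC by move=> p u u0; apply/funext => v; rewrite /tC CF//.
have [JB JF] := bundle_form_line_int (smooth_op_prim te) HB HF.
have [AB AF] := bundle_form_line_int (smooth_op_avg te) tCB tCF.
have [MB MF] := bundle_form_line_int (smooth_op_avg te) HB HF.
rewrite -!/(prim _) -!/(avg _) in JB JF AB AF MB MF.
set J := form_op (prim te) H in JB JF; set A := form_op (avg te) tC in AB AF.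
set M := form_op (avg te) H in MB MF.
pose h := fun p v => (- t) * J p v + (- t) * A p v.
have hB : bundle_form h by exact: bundle_form_lin.
have hF : fibre_const h by move=> p u u0; rewrite /h JF// AF//.
have [[thS _ thE] [HS _ HE] [CS _ CE]] := And3 thB HB CB.
have [[tCS _ _] [JS _ _] [AS _ _]] := And3 tCB JB AB.
have [[MS _ _] [hS _ _]] := conj MB hB.
pose g := fun p => contr e0 (theta p).
have gS : smooth_form g by exact: smooth_form_contr.
have gF : fibre_const g by move=> p u u0; rewrite /g thF//.
have Hte p v : H (p + te) v = H p v.
  rewrite -(monodromy1_fibre _ HF) -HT; exact: (congr1 (fun a => a p v) (HE 1)).
have tCte p v : tC (p + te) v = C p v.
  by rewrite -(monodromy1_fibre _ tCF); exact: (congr1 (fun a => a p v) (CE 1)).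
have DM p v : 'D_e0 (M ^~ v) p = 0.
  apply: (mulfI t_neq0); rewrite mulr0 -derive_te; last exact: MS.2.
  rewrite (congr1 (@^~ p) (derive_avg te te (HS.2 v))) avg_derive; last exact: HS.2.
  by rewrite Hte subrr.
have Dh p v : 'D_e0 (h ^~ v) p = g p v - M p v.
  have -> : 'D_e0 (h ^~ v) p = - t * 'D_e0 (J ^~ v) p + - t * 'D_e0 (A ^~ v) p.
    exact: (congr1 (@^~ p) ((smooth_op_derive e0).2 _ _ _ _ (JS.2 v) (AS.2 v))).
  rewrite !mulNr -!derive_te; [|exact: AS.2|exact: JS.2].
  rewrite (congr1 (@^~ p) (derive_avg te te (tCS.2 v))) avg_derive; last exact: tCS.2.
  rewrite (congr1 (@^~ p) (derive_prim te te (HS.2 v))) prim_derive; last exact: HS.2.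
  by rewrite tCte /g gE /tC /M /form_op; ring.
pose th' := fun p v => theta p v - extd h p v.
have th'B : bundle_form th' := bundle_formB thB (bundle_form_extd hB).
have [th'S _ th'E] := th'B.
have dhE p : extd h p = cowedge x0 (fun v => g p v - M p v).
  rewrite extd_fibre_const//; congr cowedge; apply/funext => v; exact: Dh.
have th'F : fibre_const th'.
  by move=> p u u0; rewrite /th' !dhE thF// gF// MF//.
have gMS : smooth_form (fun p v => g p v - M p v) by exact: smooth_formB.
have D0 p v : 'D_e0 (th' ^~ v) p = 0.
  have E1 : 'D_e0 (theta ^~ v) p = cowedge x0 (form_op (ddir e0) g p) v.
    have := cartan theta e0 p v; rewrite dth => /esym/eqP.
    by rewrite subr_eq0 => /eqP ->; rewrite extd_fibre_const.
  have E2 : 'D_e0 ((extd h) ^~ v) p = cowedge x0 (form_op (ddir e0) g p) v.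
    have -> : (extd h) ^~ v = fun q => cowedge x0 (fun v => g q v - M q v) v.
      by apply/funext => q; rewrite dhE.
    apply: (eq_trans (congr1 (fun a : diff_form R d.+1 k.+1 => a p v)
      (form_op_cowedge ord0 (smooth_op_derive e0) gMS))).
    congr (cowedge _ _ v).
    apply/funext => w; rewrite /form_op /ddir.
    have -> : (fun q => g q w - M q w) = g ^~ w - M ^~ w by [].
    rewrite deriveB; [|apply: smooth_derivable; exact: gS.2|apply: smooth_derivable; exact: MS.2].
    by rewrite DM subr0.
  have -> : th' ^~ v = theta ^~ v - (extd h) ^~ v by [].
  rewrite deriveB ?E1 ?E2 ?subrr//; apply: smooth_derivable; first exact: thS.2.
  exact: (smooth_form_extd hS).2.
have cE p v : th' p v = th' 0 v.
  apply: (smooth_cst0 (th'S.2 v)) => u q.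
  rewrite fibre_derive; [by rewrite D0 mulr0|exact: th'S.2|].
  by move=> q' w w0; rewrite th'F//.
exists (th' 0), h; split; [exact: th'S.1| |exact: hB|].
- move=> m v; exact: (eq_trans (esym (cE (monodromy m 0) (v *m T m)))
    (congr1 (fun a : diff_form R d.+1 k.+1 => a 0 v) (th'E m))).
- apply/funext => p; apply/funext => v; rewrite -(cE p v).
  by rewrite -[th' p v]/(theta p v - extd h p v) subrK.
Qed.

(** The form is dt /\ dc/dt for an invariant c, so its mean over the period t is dt /\ (c(t) - c(0))
    / t; invariance makes c(0) the twist of c(t) by the holonomy. *)
Lemma exact_average k (a : diff_form R d.+1 k.+1) (b : diff_form R d.+1 k) :
  fibre_const a -> bundle_form b -> a = extd b ->
  (forall p, cowedge x0 (a p) = fun=> 0) /\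
  exists B, skew B /\ forall v, avg te (a ^~ v) 0 =
    cowedge x0 B v - cowedge x0 B (v *m T 1).
Proof.
move=> aF bB ab; have [c [[cS _ cE] cF aE]] := exact_fibre_const aF bB ab.
split; first by move=> p; rewrite aE cowedge_cowedge_same.
exists (fun v => t^-1 * c te v); split; first exact: skewZ (cS.1 _).
move=> v.
have -> : avg te (a ^~ v) 0 = form_op (avg te) (fun p => cowedge x0 (form_op (ddir e0) c p)) 0 v.
  by rewrite /form_op; congr (avg _ _ _); apply/funext => q; rewrite aE.
have DS : smooth_form (form_op (ddir e0) c) by apply: smooth_form_op => //; exact: smooth_op_derive.
rewrite (form_op_cowedge _ (smooth_op_avg te) DS).
have -> : form_op (avg te) (form_op (ddir e0) c) 0 =
    fun v => t^-1 * c te v - t^-1 * c te (v *m T 1).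
  apply/funext => w; rewrite /form_op /ddir.
  have -> : 'D_e0 (c ^~ w) = fun p => t^-1 * 'D_te (c ^~ w) p + 0 * 'D_te (c ^~ w) p.
    apply/funext => p; rewrite derive_te; last exact: cS.2.
    by rewrite mul0r addr0 mulKf.
  rewrite (smooth_op_avg te).2; [|apply: smooth_derive; exact: cS.2..].
  rewrite mul0r addr0 avg_derive; last exact: cS.2.
  rewrite add0r mulrBr; congr (_ - _ * _).
  rewrite -(congr1 (fun a => a 0 w) (cE 1)) /pb.
  by rewrite (monodromy1_fibre _ cF) add0r.
rewrite cowedgeB; congr (_ - _).
rewrite /cowedge; apply: eq_bigr => i _.
by rewrite row_mul T_crd !row'Esub mul_rowsub_mx.
Qed.

End Bundle.

(** * Lefschetz maps in cohomology *)

Section WedgeForms.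
Context {R : realType} {n : nat}.
Implicit Types (w : diff_form R n 2) (p : 'rV[R]_n).

Definition lef_form w k (a : diff_form R n k) : diff_form R n k.+2 :=
  fun p => lef (gram (w p)) (a p).

Lemma lef_form_wedge w k (a : diff_form R n k) : smooth_form w ->
  smooth_form a -> lef_form w a = wedge w a.
Proof. by move=> wS aS; apply/funext => p; rewrite wedge2//; [exact: wS.1|exact: aS.1]. Qed.

Lemma skew_wpow w m p : (forall p, skew (w p)) -> skew (wpow w m p).
Proof.
move=> wS; elim: m p => [|m IH] p; first exact: skew_deg0.
by rewrite /= wedge2//; exact: skew_lef.
Qed.

Lemma wedge_wpowS w m k (a : diff_form R n k) : (forall p, skew (w p)) ->
  wedge (wpow w m.+1) a = lef_form w (wedge (wpow w m) a).
Proof.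
move=> wS; apply/funext => p.
rewrite (wedge_ext (a' := fun q => lef (gram (w p)) (wpow w m q)) (b' := a))//.
  by rewrite wedge_lef.
by rewrite /= wedge2//; exact: skew_wpow.
Qed.

Lemma wedge_wpow0 w k (a : diff_form R n k) : (forall p, skew (a p)) ->
  wedge (wpow w 0) a = a.
Proof. by move=> aS; apply/funext => p; rewrite [wpow w 0]/= wedge_one. Qed.

Lemma smooth_form_lef w k (a : diff_form R n k) : smooth_form w ->
  smooth_form a -> smooth_form (lef_form w a).
Proof.
move=> wS aS; split=> [p|v]; first exact/skew_lef/(aS.1 p).
apply: smoothZ; apply: smooth_sum => i; apply: smooth_sum => j.
apply: smoothM.
  rewrite (_ : (fun p => _) = w ^~ (col_mx (delta_mx 0 i : 'rV_n) (delta_mx 0 j : 'rV_n))).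
    exact: wS.2.
  by apply/funext => p; rewrite mxE.
by have := smooth_form_cowedge i (smooth_form_cowedge j aS); case=> _; apply.
Qed.

Lemma lef_formB w k (a b : diff_form R n k) :
  lef_form w (fun p v => a p v - b p v) =
  fun p v => lef_form w a p v - lef_form w b p v.
Proof. by apply/funext => p; rewrite /lef_form lefB. Qed.

Lemma lef_form_linl (w w' : diff_form R n 2) k (a : diff_form R n k) r s :
  lef_form (fun p v => r * w p v + s * w' p v) a =
  fun p v => r * lef_form w a p v + s * lef_form w' a p v.
Proof.
apply/funext => p; apply/funext => v; rewrite /lef_form /lef.
rewrite [r * _]mulrCA [s * _]mulrCA -mulrDr; congr (_ * _).
rewrite !mulr_sumr -big_split; apply: eq_bigr => i _ /=.
rewrite !mulr_sumr -big_split; apply: eq_bigr => j _ /=.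
by rewrite !mxE; ring.
Qed.

Lemma extd_one : extd ((fun _ _ => 1) : diff_form R n 0) = fun _ _ => 0.
Proof.
apply/funext => p; apply/funext => v; rewrite /extd big1// => i _.
by rewrite derive_cst mulr0.
Qed.

Let one : diff_form R n 0 := fun _ _ => 1.

Lemma smooth_form_one : smooth_form one.
Proof. by split=> [p|v]; [exact: skew_deg0|exact: smooth_cst]. Qed.

Let dW w p i j (u : 'rV[R]_n) := 'D_u (fun q => gram (w q) i j) p.

(** The part of d (L a) in which the coefficients of [w] are differentiated: dw /\ a in disguise. *)
Let dlef w k (a : diff_form R n k) : diff_form R n k.+3 := fun p v =>
  2^-1 * \sum_i \sum_j cowedge (dW w p i j) (cowedge (crd i) (cowedge (crd j) (a p))) v.

Lemma smooth_gram w i j : smooth_form w -> smooth (fun p => gram (w p) i j).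
Proof.
move=> wS.
rewrite (_ : (fun p => _) = w ^~ (col_mx (delta_mx 0 i : 'rV_n) (delta_mx 0 j : 'rV_n))).
  exact: wS.2.
by apply/funext => p; rewrite mxE.
Qed.

Lemma extd_sum k I (s : seq I) (a : I -> diff_form R n k) p v :
  (forall i, smooth_form (a i)) ->
  extd (fun p v => \sum_(i <- s) a i p v) p v = \sum_(i <- s) extd (a i) p v.
Proof.
move=> aS; elim: s => [|i s IH].
  rewrite big_nil (_ : (fun _ _ => _) = fun _ _ => 0).
    by rewrite /extd big1// => i _; rewrite derive_cst mulr0.
  by apply/funext => q; apply/funext => u; rewrite big_nil.
rewrite big_cons -IH (_ : (fun _ _ => _) = fun p v => a i p v + \sum_(i <- s) a i p v).
  by rewrite extdD//; exact: smooth_form_sum.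
by apply/funext => q; apply/funext => u; rewrite big_cons.
Qed.

Lemma extd_lef_aux w k (a : diff_form R n k) : smooth_form w -> smooth_form a ->
  extd (lef_form w a) = fun p v => lef_form w (extd a) p v + dlef w a p v.
Proof.
move=> wS aS; apply/funext => p; apply/funext => v.
pose b i j : diff_form R n k.+2 := fun q => cowedge (crd i) (cowedge (crd j) (a q)).
have bS i j : smooth_form (b i j) by do 2 apply: smooth_form_cowedge.
have wbS i j : smooth_form (fun q u => gram (w q) i j * b i j q u).
  by apply: smooth_form_mul => //; exact: smooth_gram.
have -> : extd (lef_form w a) p v =
    2^-1 * \sum_i \sum_j extd (fun q u => gram (w q) i j * b i j q u) p v.
  rewrite [in LHS]/lef_form [in LHS]/lef.
  rewrite (extdZ _ (a := fun q u => \sum_i \sum_j gram (w q) i j * b i j q u)); last first.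
    by apply: smooth_form_sum => i; apply: smooth_form_sum.
  congr (_ * _); rewrite (extd_sum _ (a := fun i q u => \sum_j gram (w q) i j * b i j q u)).
    by apply: eq_bigr => i _; rewrite (extd_sum _ (a := fun j q u => gram (w q) i j * b i j q u)).
  by move=> i; exact: smooth_form_sum.
rewrite /lef_form /lef /dlef -mulrDr; congr (_ * _).
rewrite -big_split; apply: eq_bigr => i _; rewrite -big_split; apply: eq_bigr => j _ /=.
rewrite extd_mul//; last exact: smooth_gram.
congr (_ * _ + _).
rewrite (extd_cowedge_crd i (a := fun q => cowedge (crd j) (a q))); last exact: smooth_form_cowedge.
rewrite extd_cowedge_crd//.
rewrite (_ : (fun v0 => - cowedge (crd j) (extd a p) v0) = fun v0 => -1 * cowedge (crd j) (extd a p) v0).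
  by rewrite cowedgeZ; ring.
by apply/funext => u; rewrite mulN1r.
Qed.

(** For a = 1 the extra term is dw itself, hence 0; for general [a] it is that term wedged with [a].
    This avoids a Leibniz rule for arbitrary wedge products. *)
Lemma extd_lef w k (a : diff_form R n k) : smooth_form w -> smooth_form a ->
  extd w = (fun _ _ => 0) -> extd (lef_form w a) = lef_form w (extd a).
Proof.
move=> wS aS dw0; rewrite extd_lef_aux//; apply/funext => p; apply/funext => v.
have w1 : lef_form w one = w by apply/funext => q; rewrite /lef_form lef_gram1//; exact: wS.1.
have d1 : dlef w one = fun _ _ => 0.
  have := extd_lef_aux wS smooth_form_one; rewrite w1 dw0 extd_one => E.
  apply/funext => q; apply/funext => u; have := congr1 (fun b => b q u) E.
  by rewrite /= /lef_form lef0 add0r.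
suff -> : dlef w a p = wedge (dlef w one) a p.
  by rewrite d1 /wedge big1 ?mulr0 ?addr0// => s _; rewrite mul0r mulr0.
apply/funext => u; rewrite /dlef wedgeZl; congr (_ * _).
pose A i j : diff_form R n 3 := fun q => cowedge (dW w q i j) (cowedge (crd i) (cowedge (crd j) (one q))).
rewrite (wedge_suml _ (fun i q v => \sum_j A i j q v)); apply: eq_bigr => i _.
rewrite (wedge_suml _ (A i)); apply: eq_bigr => j _.
rewrite /A (wedge_cowedge (fun q => dW w q i j) (fun q => cowedge (crd i) (cowedge (crd j) (one q)))).
rewrite (wedge_cowedge (fun=> crd i) (fun q => cowedge (crd j) (one q))).
by rewrite (wedge_cowedge (fun=> crd j)) wedge_one//; exact: aS.1.
Qed.

Definition wedge1 (eta : diff_form R n 1) k (a : diff_form R n k) : diff_form R n k.+1 :=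
  fun p => cowedge (eta p) (a p).

Lemma covector_form (eta : 'M[R]_(1, n) -> R) : skew eta -> covector eta.
Proof.
move=> [eM _] b c u v; apply: (eM _ u v ord0); rewrite ?row_id//.
- by apply/matrixP => - [].
- by apply/matrixP => - [].
Qed.

Lemma wedge1E (eta : diff_form R n 1) k (a : diff_form R n k) p v : skew (eta p) ->
  wedge1 eta a p v = \sum_r eta p (delta_mx 0 r) * cowedge (crd r) (a p) v.
Proof.
move=> eS; transitivity (cowedge (fun u => \sum_r eta p (delta_mx 0 r) * crd r u) (a p) v).
  congr (cowedge _ _ v); apply/funext => u; have eL := covector_form eS.
  have H : linear (eta p : 'rV_n -> R).
    by move=> r x y; rewrite -[y]scale1r eL mul1r scale1r.
  pose f : {linear 'rV[R]_n -> R} := HB.pack (eta p : 'rV_n -> R)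
  (GRing.isLinear.Build R 'rV[R]_n R _ (eta p : 'rV_n -> R) H).
  rewrite -[LHS]/(f u) {1}[u]row_sum_delta linear_sum; apply: eq_bigr => j _.
  by rewrite linearZ /= mulrC.
by rewrite cowedge_suml.
Qed.

Lemma smooth_form_wedge1 (eta : diff_form R n 1) k (a : diff_form R n k) :
  smooth_form eta -> smooth_form a -> smooth_form (wedge1 eta a).
Proof.
move=> eS aS; have -> : wedge1 eta a = fun p v => \sum_r eta p (delta_mx 0 r) * cowedge (crd r) (a p) v.
  by apply/funext => p; apply/funext => v; apply: wedge1E; exact: eS.1.
apply: smooth_form_sum => r; apply: smooth_form_mul; first exact: eS.2.
exact: smooth_form_cowedge.
Qed.

Lemma extd_wedge1_aux (eta : diff_form R n 1) k (a : diff_form R n k) p v :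
  smooth_form eta -> smooth_form a -> extd a = (fun _ _ => 0) ->
  extd (wedge1 eta a) p v =
  \sum_r cowedge (fun u => 'D_u (eta ^~ (delta_mx 0 r)) p) (cowedge (crd r) (a p)) v.
Proof.
move=> eS aS da0.
have -> : wedge1 eta a = fun p v => \sum_r eta p (delta_mx 0 r) * cowedge (crd r) (a p) v.
  by apply/funext => q; apply/funext => u; apply: wedge1E; exact: eS.1.
have cS r : smooth_form (fun q => cowedge (crd r) (a q)) by exact: smooth_form_cowedge.
rewrite (extd_sum _ (a := fun r p v => eta p (delta_mx 0 r) * cowedge (crd r) (a p) v)).
  apply: eq_bigr => r _; rewrite (extd_mul (f := eta ^~ (delta_mx 0 r)))//; last exact: eS.2.
  by rewrite extd_cowedge_crd// da0 cowedge0 oppr0 mulr0 add0r.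
by move=> r; apply: smooth_form_mul => //; exact: eS.2.
Qed.

(** The same device: the case a = 1 identifies the sum as d eta, and the general case is its product
    with [a]. *)
Lemma extd_wedge1 (eta : diff_form R n 1) k (a : diff_form R n k) :
  smooth_form eta -> smooth_form a -> extd a = (fun _ _ => 0) ->
  extd (wedge1 eta a) = lef_form (extd eta) a.
Proof.
move=> eS aS da0; rewrite lef_form_wedge//; last exact: smooth_form_extd.
have e1 : wedge1 eta one = eta.
  apply/funext => p; apply/funext => v; rewrite /wedge1 /cowedge big_ord_recl big_ord0.
  by rewrite addr0 mul1r mulr1; congr (eta p _); exact: row_id.
apply/funext => p; apply/funext => v; rewrite extd_wedge1_aux//.
pose B r : diff_form R n 2 := fun q =>
  cowedge (fun u => 'D_u (eta ^~ (delta_mx 0 r)) q) (cowedge (crd r) (one q)).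
have -> : extd eta = fun q u => \sum_r B r q u.
  apply/funext => q; apply/funext => u; rewrite -{1}e1 extd_wedge1_aux//.
    exact: smooth_form_one.
  exact: extd_one.
rewrite (wedge_suml _ B); apply: eq_bigr => r _; rewrite /B.
rewrite (wedge_cowedge (fun q u => 'D_u (eta ^~ (delta_mx 0 r)) q) (fun q => cowedge (crd r) (one q))).
by rewrite (wedge_cowedge (fun=> crd r)) wedge_one//; exact: aS.1.
Qed.

End WedgeForms.

(** * Cohomology classes and criteria for bijectivity *)

Section CohomologyMaps.
Context {R : realType} {n : nat}.
Variable D : set ('rV[R]_n -> 'rV[R]_n).

Lemma pullback_lin f k (a b : diff_form R n k) r s :
  pullback f (fun p v => r * a p v + s * b p v) =
  fun p v => r * pullback f a p v + s * pullback f b p v.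
Proof. by []. Qed.

Lemma invariant_form_lin k (a b : diff_form R n k) r s :
  invariant_form D k a -> invariant_form D k b ->
  invariant_form D k (fun p v => r * a p v + s * b p v).
Proof.
move=> [aS aD] [bS bD]; split; first exact: smooth_form_lin.
by move=> f Df; rewrite pullback_lin aD// bD.
Qed.

Lemma invariant_form0 k : invariant_form D k ((fun _ _ => 0) : diff_form R n k).
Proof. by split; [exact: smooth_form0|]. Qed.

Lemma exact_form0 k : exact_form D k ((fun _ _ => 0) : diff_form R n k).
Proof.
case: k => [|k] //=; exists (fun _ _ => 0); first exact: invariant_form0.
apply/funext => p; apply/funext => v; rewrite /extd big1// => i _.
by rewrite derive_cst mulr0.
Qed.

Lemma exact_form_lin k (a b : diff_form R n k) r s :
  exact_form D k a -> exact_form D k b ->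
  exact_form D k (fun p v => r * a p v + s * b p v).
Proof.
case: k a b => [|k] a b /=.
  by move=> -> ->; apply/funext => p; apply/funext => v; rewrite !mulr0 addr0.
move=> [a' aI <-] [b' bI <-]; exists (fun p v => r * a' p v + s * b' p v).
  exact: invariant_form_lin.
by rewrite extd_lin//; [exact: aI.1|exact: bI.1].
Qed.

Lemma closed_form0 k : closed_form D k ((fun _ _ => 0) : diff_form R n k).
Proof.
split; first exact: invariant_form0.
apply/funext => p; apply/funext => v; rewrite /extd big1// => i _.
by rewrite derive_cst mulr0.
Qed.

Definition cohomologous k (a b : diff_form R n k) :=
  exact_form D k (fun p v => a p v - b p v).

Lemma cohomologous_refl k (a : diff_form R n k) : cohomologous a a.
Proof.
rewrite /cohomologous (_ : (fun _ _ => _) = fun _ _ => 0); first exact: exact_form0.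
by apply/funext => p; apply/funext => v; rewrite subrr.
Qed.

Lemma cohomologous_sym k (a b : diff_form R n k) : cohomologous a b -> cohomologous b a.
Proof.
move=> ab; have := exact_form_lin (-1) 0 ab ab.
rewrite /cohomologous; congr (exact_form D k _); apply/funext => p; apply/funext => v.
by ring.
Qed.

Lemma cohomologous_trans k (a b c : diff_form R n k) :
  cohomologous a b -> cohomologous b c -> cohomologous a c.
Proof.
move=> ab bc; have := exact_form_lin 1 1 ab bc.
rewrite /cohomologous; congr (exact_form D k _); apply/funext => p; apply/funext => v.
by ring.
Qed.

Lemma dR_class_eq k (a b : diff_form R n k) : cohomologous a b ->
  dR_class D a = dR_class D b.
Proof.
move=> ab; apply/seteqP; split=> c [cC ca]; split=> //.
- exact: cohomologous_trans ca ab.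
- exact: cohomologous_trans ca (cohomologous_sym ab).
Qed.

Lemma dR_class_self k (a : diff_form R n k) : closed_form D k a -> dR_class D a a.
Proof. by move=> aC; split=> //; exact: cohomologous_refl. Qed.

Lemma dR_class_inj k (a b : diff_form R n k) : closed_form D k a ->
  dR_class D a = dR_class D b -> cohomologous a b.
Proof. by move=> aC ab; have [] : dR_class D b a by rewrite -ab; exact: dR_class_self. Qed.

Variables (w : diff_form R n 2) (m k : nat).
Let Om (a : diff_form R n k) : diff_form R n (m.*2 + k) := wedge (wpow w m) a.
Hypothesis Om_coh : forall a b, closed_form D k a -> closed_form D k b ->
  cohomologous a b -> cohomologous (Om a) (Om b).

(** The union over representatives in [lefschetz_map] collapses, since cohomologous representatives
    have cohomologous images. *)
Lemma lefschetz_map_class a : closed_form D k a ->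
  lefschetz_map D w m (dR_class D a) = dR_class D (Om a).
Proof.
move=> aC; apply/seteqP; split=> [c [b [bC ba] cb]|c ca].
  by rewrite -(dR_class_eq (Om_coh bC aC ba)).
by exists a => //; exact: dR_class_self.
Qed.

Lemma lefschetz_map_bij :
  (forall a, closed_form D k a -> closed_form D (m.*2 + k) (Om a)) ->
  (forall a b, closed_form D k a -> closed_form D k b ->
    cohomologous (Om a) (Om b) -> cohomologous a b) ->
  (forall c, closed_form D (m.*2 + k) c ->
    exists2 a, closed_form D k a & cohomologous (Om a) c) ->
  set_bij (dR_cohomology D k) (dR_cohomology D (m.*2 + k)) (lefschetz_map D w m (k := k)).
Proof.
move=> OmC Om_inj Om_surj; split.
- move=> _ [a aC <-]; rewrite lefschetz_map_class//.
  by exists (Om a) => //; exact: OmC.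
- move=> _ _ /set_mem[a aC <-] /set_mem[b bC <-].
  rewrite !lefschetz_map_class// => ab; apply: dR_class_eq; apply: Om_inj => //.
  by apply: dR_class_inj ab; exact: OmC.
- move=> _ [c cC <-]; have [a aC ac] := Om_surj _ cC.
  exists (dR_class D a); first by exists a.
  by rewrite lefschetz_map_class//; exact: dR_class_eq.
Qed.

(** A nonzero class with exact image shares its image with the zero class. *)
Lemma lefschetz_map_not_bij a : closed_form D k a ->
  ~ exact_form D k a -> exact_form D (m.*2 + k) (Om a) ->
  ~ set_bij (dR_cohomology D k) (dR_cohomology D (m.*2 + k)) (lefschetz_map D w m (k := k)).
Proof.
move=> aC aN aE [_ inj _].
have zC := closed_form0 k.
have Om0 : Om (fun _ _ => 0) = fun _ _ => 0.
  apply/funext => p; apply/funext => v; rewrite /Om /wedge big1 ?mulr0// => s _.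
  by rewrite !mulr0.
have E : dR_class D a = dR_class D (fun _ _ => 0).
  apply: inj.
  - by apply/mem_set; exists a.
  - by apply/mem_set; exists (fun _ _ => 0).
  rewrite !lefschetz_map_class//; apply: dR_class_eq.
  rewrite Om0 /cohomologous (_ : (fun _ _ => _) = Om a)//.
  by apply/funext => p; apply/funext => v; rewrite subr0.
apply: aN; have := dR_class_inj aC E.
rewrite /cohomologous (_ : (fun _ _ => _) = a)//.
by apply/funext => p; apply/funext => v; rewrite subr0.
Qed.

End CohomologyMaps.

Section LefschetzIteration.
Context {R : realType} {n : nat}.
Implicit Types (w : diff_form R n 2) (p : 'rV[R]_n).

Lemma wedge_mul k l (a : diff_form R n k) (b : diff_form R n l) (S : 'M[R]_n) p v :
  wedge a b p (v *m S) = wedge (fun q u => a q (u *m S)) (fun q u => b q (u *m S)) p v.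
Proof.
rewrite /wedge; congr (_ * _); apply: eq_bigr => s _.
have E : row_perm s (v *m S) = row_perm s v *m S.
  by rewrite !row_permE mulmxA.
by rewrite E -mul_usub_mx -mul_dsub_mx.
Qed.

Lemma lef_mul (w : 'M[R]_(2, n) -> R) k (a : 'M[R]_(k, n) -> R) (S : 'M[R]_n) v :
  skew w -> skew a ->
  lef (gram w) a (v *m S) = lef (gram (fun u => w (u *m S))) (fun u => a (u *m S)) v.
Proof.
move=> wS aS.
rewrite -[LHS]/(lef (gram ((fun _ : 'rV[R]_n => w) 0)) ((fun _ : 'rV[R]_n => a) 0) _).
rewrite -wedge2// wedge_mul wedge2//; exact: skew_comp.
Qed.

(** Iterating one factor of [w] at a time keeps the degree in the shape [m.*2 + k] without any
    cast. *)
Fixpoint lef_iter w m k (a : diff_form R n k) : diff_form R n (m.*2 + k) :=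
  if m is m'.+1 return diff_form R n (m.*2 + k) then lef_form w (@lef_iter w m' k a)
  else a.
Arguments lef_iter w m {k} a.

Lemma wedge_wpow w m k (a : diff_form R n k) : (forall p, skew (w p)) ->
  (forall p, skew (a p)) -> wedge (wpow w m) a = lef_iter w m a.
Proof.
move=> wS aS; elim: m => [|m IH]; first exact: wedge_wpow0.
by rewrite wedge_wpowS// IH.
Qed.

Variable D : set ('rV[R]_n -> 'rV[R]_n).
Hypothesis invariant_lef : forall w k (a : diff_form R n k),
  invariant_form D 2 w -> invariant_form D k a -> invariant_form D k.+2 (lef_form w a).

Lemma closed_lef w k (a : diff_form R n k) : closed_form D 2 w ->
  closed_form D k a -> closed_form D k.+2 (lef_form w a).
Proof.
move=> [wI dw] [aI da]; split; first exact: invariant_lef.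
rewrite extd_lef//; [|exact: wI.1|exact: aI.1].
rewrite da; apply/funext => p; apply/funext => v.
by rewrite /lef_form (lef0 (gram (w p))).
Qed.

Lemma cohomologous_lef w k (a b : diff_form R n k) : closed_form D 2 w ->
  cohomologous D a b -> cohomologous D (lef_form w a) (lef_form w b).
Proof.
move=> [wI dw] ab.
have E : (fun p v => lef_form w a p v - lef_form w b p v) =
    lef_form w (fun p v => a p v - b p v) by rewrite lef_formB.
rewrite /cohomologous E.
case: k a b ab {E} => [|k] a b.
  move=> /= ab; rewrite /cohomologous /= in ab; rewrite ab.
  exists (fun _ _ => 0); first exact: invariant_form0.
  apply/funext => p; apply/funext => v; rewrite /lef_form (lef0 (gram (w p))) /extd big1// => i _.
  by rewrite derive_cst mulr0.
rewrite /cohomologous => -[c cI <-]; exists (lef_form w c); first exact: invariant_lef.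
by rewrite extd_lef//; [exact: wI.1|exact: cI.1].
Qed.

Lemma closed_lef_iter w m k (a : diff_form R n k) : closed_form D 2 w ->
  closed_form D k a -> closed_form D (m.*2 + k) (lef_iter w m a).
Proof. by move=> wC aC; elim: m => //= m IH; exact: closed_lef. Qed.

Lemma cohomologous_lef_iter w m k (a b : diff_form R n k) : closed_form D 2 w ->
  cohomologous D a b -> cohomologous D (lef_iter w m a) (lef_iter w m b).
Proof. by move=> wC aC; elim: m => //= m IH; exact: cohomologous_lef. Qed.

Lemma lefschetz_map_iso w m k : closed_form D 2 w ->
  (forall a b, closed_form D k a -> closed_form D k b ->
    cohomologous D (lef_iter w m a) (lef_iter w m b) -> cohomologous D a b) ->
  (forall c, closed_form D (m.*2 + k) c ->
    exists2 a, closed_form D k a & cohomologous D (lef_iter w m a) c) ->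
  set_bij (dR_cohomology D k) (dR_cohomology D (m.*2 + k)) (lefschetz_map D w m (k := k)).
Proof.
move=> wC Linj Lsurj.
have LE a : closed_form D k a -> wedge (wpow w m) a = lef_iter w m a.
  by move=> [[aS _] _]; rewrite wedge_wpow//; [exact: wC.1.1.1|exact: aS.1].
apply: lefschetz_map_bij.
- by move=> a b aC bC ab; rewrite !LE//; exact: cohomologous_lef_iter.
- by move=> a aC; rewrite LE//; exact: closed_lef_iter.
- by move=> a b aC bC; rewrite !LE//; exact: Linj.
- by move=> c cC; have [a aC ac] := Lsurj _ cC; exists a => //; rewrite LE.
Qed.

Lemma lefschetz_map_not_iso w m k (a : diff_form R n k) : closed_form D 2 w ->
  closed_form D k a -> ~ exact_form D k a -> exact_form D (m.*2 + k) (lef_iter w m a) ->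
  ~ set_bij (dR_cohomology D k) (dR_cohomology D (m.*2 + k)) (lefschetz_map D w m (k := k)).
Proof.
move=> wC aC aN LaE.
have LE b : closed_form D k b -> wedge (wpow w m) b = lef_iter w m b.
  by move=> [[bS _] _]; rewrite wedge_wpow//; [exact: wC.1.1.1|exact: bS.1].
apply: (lefschetz_map_not_bij _ aC aN); last by rewrite LE.
by move=> b c bC cC bc; rewrite !LE//; exact: cohomologous_lef_iter.
Qed.

End LefschetzIteration.
Arguments lef_iter {R n} w m {k} a.

Lemma nondegenerate_unit {R : realType} n (w : diff_form R n 2) p :
  skew (w p) -> Defs.nondegenerate w -> gram (w p) \in unitmx.
Proof.
move=> wS wN; rewrite -row_free_unit -kermx_eq0; apply/negPn/negP => /rowV0Pn[u].
move=> /sub_kermxP uW /eqP u0; apply: u0; apply: (wN p u) => v.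
rewrite -[LHS]/(contr u (w p) v) -[w p](lef_gram1 wS) (contr_lef0 (skew_gram wS)).
rewrite /cowedge big_ord_recl big_ord0 addr0 /mx_covector uW mul0mx mxE mul0r.
exact: mulr0.
Qed.

Lemma invmx_skew {R : realType} n (W : 'M[R]_n) : W \in unitmx -> W^T = - W ->
  (invmx W)^T = - invmx W.
Proof.
move=> WU WS; rewrite trmx_inv WS -scaleN1r invmxZ ?unitrN1 ?unitmxZ ?unitrN1//.
by rewrite invrN1 scaleN1r.
Qed.

Lemma cowedge_lef {R : realType} n W x k (a : 'M[R]_(k, n) -> R) :
  cowedge x (lef W a) = lef W (cowedge x a).
Proof.
apply/funext => v; rewrite /lef (cowedgeZ x _ 2^-1); congr (_ * _).
rewrite cowedge_sum; apply: eq_bigr => i _; rewrite cowedge_sum; apply: eq_bigr => j _.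
rewrite (cowedgeZ x _ (W i j)); congr (_ * _).
have -> : cowedge (crd i) (cowedge (crd j) (cowedge x a)) =
    cowedge (crd i) (fun u => -1 * cowedge x (cowedge (crd j) a) u).
  by congr cowedge; apply/funext => u; rewrite cowedge_anticomm mulN1r.
by rewrite cowedgeZ mulN1r cowedge_anticomm.
Qed.

(** * Degree zero and unipotent holonomy *)

Section Bundle6.
Context {R : realType}.
Variables (t : R) (e : 'I_5 -> 'rV[R]_6) (T : int -> 'M[R]_6).
Hypothesis t_neq0 : t != 0.
Hypothesis e_fibre : forall j, crd ord0 (e j) = 0.
Hypothesis e_span : forall v : 'rV[R]_6, crd ord0 v = 0 ->
  exists c : 'I_5 -> R, v = \sum_j c j *: e j.
Hypotheses (T0 : T 0 = 1%:M) (TD : forall m m', T (m + m') = T m *m T m').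
Hypothesis T_crd : forall m (v : 'rV[R]_6), crd ord0 (v *m T m) = crd ord0 v.
Hypothesis T_e0 : forall m, delta_mx 0 ord0 *m T m = delta_mx 0 ord0 :> 'rV[R]_6.
Hypothesis T_lattice : forall m j, exists z : 'I_5 -> int,
  e j *m T m = \sum_i (z i)%:~R *: e i.
Hypothesis T_det : forall m, \det (T m) = 1.
Variable D : set ('rV[R]_6 -> 'rV[R]_6).
Hypothesis DI : forall k (a : diff_form R 6 k), invariant_form D k a <-> bundle_form t e T a.

Local Notation V := 'rV[R]_6.
Local Notation e0 := (delta_mx 0 ord0 : V).
Local Notation x0 := (@crd R 6 ord0).
Local Notation te := (t *: e0).
Local Notation bundle_form := (bundle_form t e T).

Lemma bundle_form_lef (w : diff_form R 6 2) k (a : diff_form R 6 k) :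
  bundle_form w -> bundle_form a -> bundle_form (lef_form w a).
Proof.
move=> [wS wP wE] [aS aP aE]; split; first exact: smooth_form_lef.
- by move=> j p; rewrite /lef_form wP aP.
- move=> m; apply/funext => p; apply/funext => v; rewrite /pb /lef_form lef_mul//.
  + rewrite -[X in lef (gram X)]/(pb t T m w p) -[X in lef _ X]/(pb t T m a p).
    by rewrite wE aE.
  + exact: wS.1.
  + exact: aS.1.
Qed.

Lemma invariant_form_lef (w : diff_form R 6 2) k (a : diff_form R 6 k) :
  invariant_form D 2 w -> invariant_form D k a -> invariant_form D k.+2 (lef_form w a).
Proof. by move=> /DI wB /DI aB; apply/DI; exact: bundle_form_lef. Qed.

Lemma bundle_form_cst k (c : 'M[R]_(k, 6) -> R) : skew c ->
  (forall m v, c (v *m T m) = c v) -> bundle_form (fun _ => c).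
Proof.
move=> cS cT; split=> //; first exact: smooth_form_cst.
by move=> m; apply/funext => p; apply/funext => v; rewrite /pb cT.
Qed.

Lemma extd_cst k (c : 'M[R]_(k, 6) -> R) : extd (fun _ => c) = fun _ _ => 0.
Proof.
apply/funext => p; apply/funext => v; rewrite /extd big1// => i _.
by rewrite derive_cst mulr0.
Qed.

Lemma skew_top_T (c : 'M[R]_6 -> R) m v : skew c -> c (v *m T m) = c v.
Proof. by move=> cS; rewrite skew_top_mul// T_det mul1r. Qed.

Lemma bundle_form_contr k (a : diff_form R 6 k.+1) : bundle_form a ->
  bundle_form (fun p => contr e0 (a p)).
Proof.
move=> [aS aP aE]; split; first exact: smooth_form_contr.
- by move=> j p; rewrite aP.
- by move=> m; rewrite -(contr_pb _ T_e0) aE.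
Qed.

Lemma bundle_form0 k : bundle_form ((fun _ _ => 0) : diff_form R 6 k).
Proof. by apply: bundle_form_cst => //; exact: (skew0 k). Qed.

Lemma closed_cst k (c : 'M[R]_(k, 6) -> R) : skew c ->
  (forall m v, c (v *m T m) = c v) -> closed_form D k (fun _ => c).
Proof. by move=> cS cT; split; [apply/DI; exact: bundle_form_cst|exact: extd_cst]. Qed.

(** Since det T = 1, the contraction of a top form with the invariant vector [e0] is
    holonomy-invariant, so the coboundary in [closed_constant] can be 0. *)
Lemma closed_top (a : diff_form R 6 6) : bundle_form a -> extd a = (fun _ _ => 0) ->
  exists c h, [/\ skew c, bundle_form h & a = fun p v => c v + extd h p v].
Proof.
move=> aB da.
have [th [eta [thB thF dth etaB aE]]] :=
  closed_fibre_const t_neq0 e_fibre e_span T0 TD T_crd T_e0 T_lattice aB da.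
have gB := bundle_form_contr thB.
have gF : fibre_const (fun p => contr e0 (th p)) by move=> p u u0; rewrite thF.
have [||c [h [cS _ hB thE]]] := closed_constant t_neq0 e_fibre TD T_crd T_e0 thB thF dth
  gB gF (bundle_form0 5) (fun p u _ => erefl).
- move=> p v; rewrite -[LHS]/(th p (col_mx e0 (v *m T 1))) -[in LHS](T_e0 1).
  rewrite -(mul_col_mx e0 v) skew_top_T//; have [[thS _] _ _] := thB; exact: thS.
- by move=> p v; rewrite subrr addr0.
- exists c, (fun p v => 1 * h p v + 1 * eta p v); split=> //.
    exact: bundle_form_lin.
  rewrite extd_lin; [|by case: hB|by case: etaB].
  by apply/funext => p; apply/funext => v; rewrite aE thE; ring.
Qed.

(** A constant is its own mean, and dt /\ B has top degree, so the holonomy fixes it and the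
    difference vanishes. *)
Lemma exact_top (c : 'M[R]_6 -> R) h : skew c -> bundle_form h ->
  (fun _ => c) = extd h -> c = fun=> 0.
Proof.
move=> cS hB ch.
have cF : fibre_const (fun _ : V => c) by [].
have [_ [B [BS cB]]] :=
  exact_average t_neq0 e_fibre e_span T0 TD T_crd T_lattice cF hB ch.
apply/funext => v; have := cB v; rewrite avg_id// => ->.
by rewrite skew_top_T ?subrr//; apply: skew_cowedge => //; exact: covector_crd.
Qed.

Section DegreeZero.
Variable w : diff_form R 6 2.
Hypotheses (wC : closed_form D 2 w) (wN : Defs.nondegenerate w).
Hypothesis wS : forall p, exists S : 'M[R]_6, \det S = 1 /\ forall v, w p (v *m S) = w 0 v.

Definition cube : 'M[R]_6 -> R := lef (gram (w 0)) (lef (gram (w 0)) (w 0)).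

Lemma skew_w p : skew (w p). Proof. exact: wC.1.1.1. Qed.

Lemma skew_cube : skew cube.
Proof. by do 2 apply: skew_lef; exact: skew_w. Qed.

(** [S] carries w at p to w at 0 and preserves volume forms, so the cubes agree. *)
Lemma cubeE p : lef (gram (w p)) (lef (gram (w p)) (w p)) = cube.
Proof.
apply/funext => v; have [S [S1 SE]] := wS p.
have SW : (fun u => w p (u *m S)) = w 0 by apply/funext.
rewrite -[LHS]mul1r -S1 -skew_top_mul; last by do 2 apply: skew_lef; exact: skew_w.
rewrite lef_mul; [|exact: skew_w|by apply: skew_lef; exact: skew_w].
rewrite SW; congr (lef _ _ v); apply/funext => u.
by rewrite lef_mul ?SW//; exact: skew_w.
Qed.

Lemma cube_neq0 : cube <> fun=> 0.
Proof.
rewrite /cube -[in X in lef _ (lef _ X)](lef_gram1 (skew_w 0)).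
have WS := skew_gram (skew_w 0).
have WU := nondegenerate_unit (skew_w 0) wN.
have VS := invmx_skew WU WS.
move=> /(lef3_inj WS VS (mulVmx WU))/(congr1 (@^~ 0))/eqP.
by rewrite oner_eq0.
Qed.

Lemma cube1 : cube 1%:M != 0.
Proof.
apply/eqP => c1; apply: cube_neq0; apply/funext => v.
by rewrite (skew_top _ skew_cube) c1 mul0r.
Qed.

Lemma closed_degree0 (a : diff_form R 6 0) : closed_form D 0 a ->
  exists r, a = fun _ _ => r.
Proof.
move=> [[aS _] da]; exists (a 0 0); apply/funext => p; apply/funext => v.
rewrite (_ : v = 0); last by apply/matrixP => - [].
apply: (smooth_cst0 (f := a ^~ 0)); first exact: aS.2.
by move=> u q; rewrite -cartan0 da.
Qed.

Lemma lef_iter_cst r : lef_iter w 3 ((fun _ _ => r) : diff_form R 6 0) =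
  fun p v => r * cube v.
Proof.
apply/funext => p; rewrite -(cubeE p) /= /lef_form.
have -> : lef (gram (w p)) (fun _ : 'M[R]_(0, 6) => r) = fun v => r * w p v.
  rewrite -[in RHS](lef_gram1 (skew_w p)) -lefZ; congr (lef _ _).
  by apply/funext => v; rewrite mulr1.
have := lefZ (gram (w p)) (lef (gram (w p)) (w p)) r; rewrite -lefZ.
exact: id.
Qed.

Lemma lefschetz_iso0 : lefschetz_iso D w 0.
Proof.
apply: (lefschetz_map_iso invariant_form_lef (m := 3) (k := 0)) => //.
- move=> a b aC bC; have [r ->] := closed_degree0 aC; have [s ->] := closed_degree0 bC.
  rewrite !lef_iter_cst => -[h /DI hB hE].
  have rs : (fun v => (r - s) * cube v) = fun=> 0.
    apply: exact_top hB _; first exact: skewZ skew_cube.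
    by rewrite hE; apply/funext => p; apply/funext => v; rewrite mulrBl.
  have /eqP := congr1 (@^~ 1%:M) rs; rewrite mulf_eq0 (negbTE cube1) orbF subr_eq0.
  by move=> /eqP ->; exact: cohomologous_refl.
- move=> c [/DI cB dc]; have [c0 [h [c0S hB cE]]] := closed_top cB dc.
  exists (fun _ _ => c0 1%:M / cube 1%:M).
    by apply: closed_cst => //; exact: skew_deg0.
  rewrite lef_iter_cst; exists (fun p v => -1 * h p v + 0 * h p v).
    by apply/DI; exact: bundle_form_lin.
  rewrite extd_lin; try by case: hB.
  apply/funext => p; apply/funext => v; rewrite cE (skew_top v c0S) (skew_top v skew_cube).
  by rewrite mulrA divfK ?cube1//; ring.
Qed.

End DegreeZero.
Section DegreeOne.
Variables (w : diff_form R 6 2) (eps y : V).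
Hypotheses (wC : closed_form D 2 w) (wN : Defs.nondegenerate w) (wF : fibre_const w).
Hypothesis wS : forall p, exists S : 'M[R]_6, [/\ \det S = 1,
  forall v, w p (v *m S) = w 0 v, eps *m S = eps & forall v : V, x0 (v *m S) = x0 v].
Hypotheses (eps0 : x0 eps = 0) (eps_neq0 : eps != 0).
Hypothesis eps_T : forall m, eps *m T m = eps.
Hypothesis y_T : forall m, y *m T m = y + (m%:~R * t) *: eps.

Let alpha : diff_form R 6 1 := fun p => contr eps (w p).
Let wS' p : exists S : 'M[R]_6, \det S = 1 /\ forall v, w p (v *m S) = w 0 v.
Proof. by have [S [SE wSE _ _]] := wS p; exists S. Qed.

(** Cartan's formula: [w] is closed, and constant along the vertical vector [eps]. Deck invariance
    holds because the holonomy fixes [eps]. *)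
Lemma closed_alpha : closed_form D 1 alpha.
Proof.
have [/DI[wS1 wP wE] dw] := wC; split.
  apply/DI; split; first exact: smooth_form_contr.
  - by move=> j p; rewrite /alpha wP.
  - move=> m; apply/funext => p; apply/funext => v.
    rewrite /alpha -[w in RHS](wE m) /pb /contr; congr (w _ _).
    by rewrite (mul_col_mx eps v) eps_T.
apply/funext => p; apply/funext => v; have := cartan w eps p v.
rewrite dw [LHS]/(0 : R) fibre_derive; [|exact: wS1.2|by move=> q u u0; rewrite wF].
by rewrite eps0 mul0r sub0r => /eqP; rewrite eq_sym oppr_eq0 => /eqP.
Qed.

(** An exact 1-form depending on t only is a multiple of dt. Homogeneity makes its coefficient
    constant, and its mean vanishes, since the B of [exact_average] is a 0-form here and feels no
    holonomy. So [alpha] would vanish at 0, against nondegeneracy. *)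
Lemma alpha_not_exact : ~ exact_form D 1 alpha.
Proof.
move=> [b /DI bB /esym ab].
have aF : fibre_const alpha by move=> p u u0; rewrite /alpha wF.
have [ax [B [BS aB]]] :=
  exact_average t_neq0 e_fibre e_span T0 TD T_crd T_lattice aF bB ab.
have aL p : linear (alpha p : V -> R).
  have := covector_form (closed_alpha.1.1.1 p) => aC.
  by move=> r u v; rewrite -[v in LHS]scale1r aC mul1r.
have a0 p u : x0 u = 0 -> alpha p u = 0.
  move=> u0; have := congr1 (@^~ (col_mx e0 u)) (ax p).
  rewrite /cowedge !big_ord_recl big_ord0 !row0_col_mx row'0_col_mx.
  rewrite (_ : row (lift ord0 ord0) _ = u); last first.
    by rewrite rowS_col_mx row_id.
  by rewrite u0 /crd !mxE eqxx; rewrite mul0r mulr0 !addr0 !mul1r.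
have aE p v : alpha p v = x0 v * alpha p e0.
  rewrite -[in LHS](subrK (x0 v *: e0) v) addrC aL [alpha p (v - _)]a0 ?addr0//.
  by rewrite /crd !mxE eqxx mulr1 subrr.
have a_cst p : alpha p e0 = alpha 0 e0.
  have [S [_ SE Seps Sx]] := wS p.
  transitivity (alpha p (e0 *m S)); first by rewrite aE [RHS]aE Sx.
  by rewrite /alpha /contr -SE (mul_col_mx eps e0) Seps.
move/eqP: eps_neq0; apply; apply: (wN (p := 0)) => v.
rewrite -[LHS]/(alpha 0 v) aE.
suff -> : alpha 0 e0 = 0 by rewrite mulr0.
have := aB e0; rewrite avg_id => [->|u]; last by rewrite a_cst.
rewrite /cowedge !big_ord_recl !big_ord0 row_mul T_crd.
by rewrite (_ : row' ord0 (e0 *m T 1) = row' ord0 e0) ?subrr//; apply/matrixP => - [].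
Qed.

(** Contraction is a derivation on even forms, and each of the three factors contributes the same
    term once the covector has been moved past L. *)
Lemma contr_cube p : contr eps (cube w) = fun v => 3 * lef_iter w 2 alpha p v.
Proof.
have WS := skew_gram (skew_w wC p).
rewrite -(cubeE wC wS' p) -[in X in lef _ (lef _ X)](lef_gram1 (skew_w wC p)).
rewrite (contr_lef WS) (contr_lef WS) (contr_lef0 WS) !cowedge_lef.
have aE : cowedge (mx_covector (gram (w p)) eps) (fun _ : 'M[R]_(0, 6) => 1) = alpha p.
  by rewrite -(contr_lef0 WS) (lef_gram1 (skew_w wC p)).
rewrite aE.
have dbl (b : 'M[R]_(3, 6) -> R) : (fun v => b v + b v) = fun v => 2 * b v.
  by apply/funext => v; ring.
by rewrite dbl lefZ; apply/funext => v; rewrite /= /lef_form; ring.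
Qed.

Let c1 : 'M[R]_(4, 6) -> R := contr y (contr e0 (cube w)).
Let c2 : 'M[R]_(4, 6) -> R := contr eps (contr e0 (cube w)).
Let beta : diff_form R 6 4 := fun p v => c1 v + x0 p * c2 v.

Lemma skew_c1 : skew c1.
Proof. by do 2 apply: skew_contr; exact: skew_cube wC. Qed.

Lemma skew_c2 : skew c2.
Proof. by do 2 apply: skew_contr; exact: skew_cube wC. Qed.

Lemma betaE p v : beta p v = contr (y + x0 p *: eps) (contr e0 (cube w)) v.
Proof.
have := contr_linear 1 (x0 p) y eps v (skew_contr e0 (skew_cube wC)).1.
by rewrite scale1r mul1r => ->.
Qed.

(** The holonomy adds m t eps to [y], and the shift of [x0] by m t produces the same summand, so y +
    x0 eps is equivariant. The volume form is invariant because det T = 1. *)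
Lemma bundle_beta : bundle_form beta.
Proof.
split.
- have := smooth_form_lin 1 1 (smooth_form_cst skew_c1)
    (smooth_form_mul (smooth_crd ord0) (smooth_form_cst skew_c2)).
  by congr smooth_form; apply/funext => p; apply/funext => v; rewrite !mul1r.
- move=> j p; apply/funext => v; rewrite /beta; congr (_ + _ * _).
  by rewrite /crd mxE -[e j _ _]/(x0 (e j)) e_fibre addr0.
- move=> m; apply/funext => p; apply/funext => v; rewrite /pb !betaE.
  rewrite (x0_monodromy t T_crd).
  have -> : y + (x0 p + m%:~R * t) *: eps = (y + x0 p *: eps) *m T m.
    by rewrite mulmxDl y_T -scalemxAl eps_T scalerDl addrA addrAC.
  rewrite /contr -[in LHS](T_e0 m) -(mul_col_mx (y + x0 p *: eps) v) -(mul_col_mx e0).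
  by rewrite skew_top_T//; exact: skew_cube wC.
Qed.

(** d beta = dt /\ c2, and c2 is minus the contraction of iota_eps w^3 with d/dt. Since dt /\
    iota_eps w^3 = 0, by degree and dt(eps) = 0, multiplying back by dt restores iota_eps w^3. *)
Lemma extd_beta p : extd beta p = fun v => - contr eps (cube w) v.
Proof.
have -> : extd beta p = cowedge x0 c2.
  have c2S := smooth_form_cst skew_c2; have xS := smooth_form_mul (smooth_crd ord0) c2S.
  have -> : beta = fun p v => 1 * c1 v + 1 * (x0 p * c2 v).
    by apply/funext => q; apply/funext => v; rewrite !mul1r.
  rewrite (extd_lin 1 1 (smooth_form_cst skew_c1) xS) (extd_mul _ (smooth_crd ord0) c2S) !extd_cst.
  have -> : (fun u => 'D_u x0 p) = x0 by apply/funext => u; rewrite derive_crd.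
  by apply/funext => v; rewrite !mulr0 !add0r mul1r.
have -> : c2 = fun v => -1 * contr e0 (contr eps (cube w)) v.
  apply/funext => v; rewrite mulN1r; apply: contr_anticomm.
    by case: (skew_cube wC).
  by move=> u; apply: contr_contr_same; case: (skew_cube wC).
rewrite cowedgeZ.
have xK : cowedge x0 (contr eps (cube w)) = fun=> 0.
  apply/funext => v; have := congr1 (@^~ v) (contr_cowedge eps x0 (cube w)).
  have -> : cowedge x0 (cube w) = fun=> 0.
    by apply: skew_overdim => //; apply: skew_cowedge; [exact: covector_crd|exact: skew_cube wC].
  by rewrite eps0 mul0r sub0r => /eqP; rewrite eq_sym oppr_eq0 => /eqP.
apply/funext => v; have := congr1 (@^~ v) (contr_cowedge e0 x0 (contr eps (cube w))).
have x1 : x0 e0 = 1 by rewrite /crd mxE eqxx.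
rewrite xK => E; suff -> : cowedge x0 (contr e0 (contr eps (cube w))) v = contr eps (cube w) v.
  by rewrite mulN1r.
apply/esym/eqP; rewrite -subr_eq0; apply/eqP.
transitivity (x0 e0 * contr eps (cube w) v - cowedge x0 (contr e0 (contr eps (cube w))) v).
  by rewrite x1 mul1r.
exact: esym E.
Qed.

Lemma lefschetz_not_iso1 : ~ lefschetz_iso D w 1.
Proof.
apply: (lefschetz_map_not_iso invariant_form_lef (m := 2) (k := 1) wC closed_alpha
  alpha_not_exact).
(* d beta = - iota_eps w^3 = -3 w^2 /\ alpha, hence the factor -1/3. *)
exists (fun p v => (- 3^-1) * beta p v + 0 * beta p v).
  by apply/DI; apply: bundle_form_lin; exact: bundle_beta.
rewrite extd_lin; try by case: bundle_beta.
apply/funext => p; apply/funext => v; rewrite extd_beta (contr_cube p).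
by field.
Qed.

End DegreeOne.
End Bundle6.

(** * Diagonal holonomy *)

Section LefschetzPowers.
Context {R : realType} {n : nat}.
Implicit Types (W : 'M[R]_n) (w : diff_form R n 2).

Fixpoint lefn W m k (a : 'M[R]_(k, n) -> R) : 'M[R]_(m.*2 + k, n) -> R :=
  if m is m'.+1 return 'M[R]_(m.*2 + k, n) -> R then lef W (@lefn W m' k a)
  else a.
Arguments lefn W m {k} a.

Lemma skew_lefn W m k (a : 'M[R]_(k, n) -> R) : skew a -> skew (lefn W m a).
Proof. by move=> aS; elim: m => //= m IH; exact: skew_lef. Qed.

Lemma lef_iterE w m k (a : diff_form R n k) p :
  lef_iter w m a p = lefn (gram (w p)) m (a p).
Proof. by elim: m => //= m IH; rewrite /lef_form IH. Qed.

Lemma lefnB W m k (a b : 'M[R]_(k, n) -> R) :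
  lefn W m (fun v => a v - b v) = fun v => lefn W m a v - lefn W m b v.
Proof. by elim: m => //= m ->; rewrite lefB. Qed.

Lemma lefn_mul (w : 'M[R]_(2, n) -> R) m k (a : 'M[R]_(k, n) -> R) (S : 'M[R]_n) v :
  skew w -> skew a -> (forall u, w (u *m S) = w u) ->
  lefn (gram w) m a (v *m S) = lefn (gram w) m (fun u => a (u *m S)) v.
Proof.
move=> wS aS wE; elim: m v => //= m IH v.
rewrite lef_mul//; last exact: skew_lefn.
have -> : (fun u => w (u *m S)) = w by apply/funext.
by congr (lef _ _ v); apply/funext => u; exact: IH.
Qed.

End LefschetzPowers.
Arguments lefn {R n} W m {k} a.

Lemma smooth_form_weight_op {R : realType} n mu g k x (a : diff_form R n k) :
  smooth_form a -> smooth_form (fun p => weight_op mu g x (a p)).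
Proof.
elim: k x a => [|k IH] x a aS /=.
  by apply: (smooth_form_mul (f := fun=> g x)) => //; exact: smooth_cst.
apply: (smooth_form_mul (f := fun=> k.+1%:R^-1)); first exact: smooth_cst.
apply: smooth_form_sum => q.
apply: (@smooth_form_cowedge _ _ k q (fun p => weight_op mu g _ (contr _ (a p)))).
exact/(IH _ (fun p => contr _ (a p)))/smooth_form_contr.
Qed.

Lemma cowedge_mul {R : realType} n k x (a : 'M[R]_(k, n) -> R) (S : 'M[R]_n) v :
  cowedge x a (v *m S) = cowedge (fun u => x (u *m S)) (fun u => a (u *m S)) v.
Proof.
rewrite /cowedge; apply: eq_bigr => i _.
by rewrite /= row_mul !row'Esub -mul_rowsub_mx.
Qed.

Section DiagonalBundle6.
Context {R : realType}.
Variables (t : R) (e : 'I_5 -> 'rV[R]_6) (T : int -> 'M[R]_6).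
Hypothesis t_neq0 : t != 0.
Hypothesis e_fibre : forall j, crd ord0 (e j) = 0.
Hypothesis e_span : forall v : 'rV[R]_6, crd ord0 v = 0 ->
  exists c : 'I_5 -> R, v = \sum_j c j *: e j.
Hypotheses (T0 : T 0 = 1%:M) (TD : forall m m', T (m + m') = T m *m T m').
Hypothesis T_crd : forall m (v : 'rV[R]_6), crd ord0 (v *m T m) = crd ord0 v.
Hypothesis T_e0 : forall m, delta_mx 0 ord0 *m T m = delta_mx 0 ord0 :> 'rV[R]_6.
Hypothesis T_lattice : forall m j, exists z : 'I_5 -> int,
  e j *m T m = \sum_i (z i)%:~R *: e i.
Hypothesis T_det : forall m, \det (T m) = 1.
Variable D : set ('rV[R]_6 -> 'rV[R]_6).
Hypothesis DI : forall k (a : diff_form R 6 k), invariant_form D k a <-> bundle_form t e T a.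
Variable nu : int -> 'rV[R]_6.
Hypothesis T_diag : forall m, T m = diag_mx (nu m).

Local Notation V := 'rV[R]_6.
Local Notation e0 := (delta_mx 0 ord0 : V).
Local Notation x0 := (@crd R 6 ord0).
Local Notation bundle_form := (bundle_form t e T).
Local Notation cohomologous := (cohomologous D).
Local Notation closed_form := (closed_form D).

Let inv_lef := invariant_form_lef DI.

Definition T_inv k (c : 'M[R]_(k, 6) -> R) := skew c /\ forall m v, c (v *m T m) = c v.

Lemma T_inv_closed k (c : 'M[R]_(k, 6) -> R) : T_inv c -> closed_form k (fun _ => c).
Proof. by move=> [cS cT]; exact: (closed_cst DI cS cT). Qed.

Lemma closed_T_inv k (c : 'M[R]_(k, 6) -> R) : closed_form k (fun _ => c) -> T_inv c.
Proof.
move=> [/DI[cS _ cE] _]; split; first exact: (cS.1 0).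
by move=> m v; have := congr1 (fun b => b 0 v) (cE m).
Qed.

Lemma bundle_form_weight_op g k x (a : diff_form R 6 k) : bundle_form a ->
  bundle_form (fun p => weight_op (nu 1) g x (a p)).
Proof.
move=> [aS aP aE]; split; first exact: smooth_form_weight_op.
- by move=> j p; rewrite aP.
- move=> m; apply/funext => p; apply/funext => v; rewrite /pb.
  have aM : multilinear (a (monodromy t T m p)) by case: (aS.1 (monodromy t T m p)).
  have := weight_op_diag (nu 1) g x v (nu m) aM; rewrite -T_diag => <-.
  by rewrite -[fun u => _]/(pb t T m a p) aE.
Qed.

(** The splitting that [closed_constant] asks for comes from the weights: the fixed part plus the
    coboundary of the resolvent part. In degree 0 closed functions are already constant. *)
Lemma closed_T_inv_rep k (a : diff_form R 6 k) : closed_form k a ->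
  exists2 c, T_inv c & cohomologous a (fun _ => c).
Proof.
case: k a => [|k] a aC.
  have [r ->] := closed_degree0 aC; exists (fun=> r); last exact: cohomologous_refl.
  by split=> //; exact: skew_deg0.
have [/DI aB da] := aC.
have [th [eta [thB thF dth etaB aE]]] :=
  closed_fibre_const t_neq0 e_fibre e_span T0 TD T_crd T_e0 T_lattice aB da.
have gB := bundle_form_contr T_e0 thB.
have gF : fibre_const (fun p => contr e0 (th p)) by move=> p u u0; rewrite thF.
have HF : fibre_const (fun p => weight_inv (nu 1) (contr e0 (th p))).
  by move=> p u u0; rewrite gF.
have CF : fibre_const (fun p => weight_res (nu 1) (contr e0 (th p))).
  by move=> p u u0; rewrite gF.
have HB := bundle_form_weight_op (fun y => (y == 1)%:R) 1 gB.
have CB := bundle_form_weight_op (fun y => if y == 1 then 0 else (y - 1)^-1) 1 gB.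
have gS p : skew (contr e0 (th p)) by case: gB => gS _ _; exact: gS.1.
have [||c [h [cS cT hB thE]]] := closed_constant t_neq0 e_fibre TD T_crd T_e0 thB thF dth
  HB HF CB CF.
- by move=> p v; rewrite T_diag; exact: weight_inv_twist.
- move=> p v; rewrite T_diag.
  have := weight_res_twist (nu 1) v (gS p); rewrite /weight_res /weight_inv; lra.
- exists c => //; exists (fun p v => 1 * h p v + 1 * eta p v).
    by apply/DI; exact: bundle_form_lin.
  rewrite extd_lin; [|by case: hB|by case: etaB].
  by apply/funext => p; apply/funext => v; rewrite aE thE; ring.
Qed.

(** An exact constant form is dt /\ B minus its twist, and for a diagonal twist a fixed form of this
    kind is 0. *)
Lemma T_inv_cohomologous k (c c' : 'M[R]_(k, 6) -> R) : T_inv c -> T_inv c' ->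
  cohomologous (fun _ => c) (fun _ => c') -> c = c'.
Proof.
move=> [cS cT] [c'S c'T] cc.
pose d v := c v - c' v.
suff d0 : d = fun=> 0.
  by apply/funext => v; apply/eqP; rewrite -subr_eq0; have /eqP := congr1 (@^~ v) d0.
case: k c c' cS cT c'S c'T cc @d => [|k] c c' cS cT c'S c'T cc d.
  have E : (fun (_ : V) v => c v - c' v) = fun _ _ => 0 := cc.
  exact: (congr1 (fun f : diff_form R 6 0 => f 0) E).
have dS : skew d.
  have := skew_lin 1 (-1) cS c'S; congr skew.
  by apply/funext => v; rewrite /d; ring.
have [b /DI bB bE] := cc.
have dF : fibre_const (fun _ : V => d) by [].
have dT v : d (v *m diag_mx (nu 1)) = d v by rewrite -T_diag /d cT c'T.
have [_ [B [BS dB]]] :=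
  exact_average t_neq0 e_fibre e_span T0 TD T_crd T_lattice dF bB (esym bE).
apply: (weight_inv_coboundary (a := cowedge x0 B) _ dS dT).
  by apply: skew_cowedge => //; exact: covector_crd.
by move=> v; rewrite -T_diag -dB avg_id.
Qed.

Lemma bundle_form_wedge1 (eta : diff_form R 6 1) k (a : diff_form R 6 k) :
  bundle_form eta -> bundle_form a -> bundle_form (wedge1 eta a).
Proof.
move=> [eS eP eE] [aS aP aE]; split; first exact: smooth_form_wedge1.
- by move=> j p; rewrite /wedge1 eP aP.
- move=> m; apply/funext => p; apply/funext => v; rewrite /pb /wedge1 cowedge_mul.
  rewrite -[X in cowedge X]/(pb t T m eta p) -[X in cowedge _ X]/(pb t T m a p).
  by rewrite eE aE.
Qed.

(** If w - w' = d eta, then (w - w') /\ a = d (eta /\ a) for closed [a]. *)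
Lemma cohomologous_lefl (w w' : diff_form R 6 2) k (a : diff_form R 6 k) :
  cohomologous w w' -> closed_form k a ->
  cohomologous (lef_form w a) (lef_form w' a).
Proof.
move=> [eta /DI etaB etaE] [/DI aB da]; exists (wedge1 eta a).
  by apply/DI; exact: bundle_form_wedge1.
rewrite extd_wedge1//; [|by case: etaB|by case: aB]; rewrite etaE.
have -> : (fun p v => w p v - w' p v) = fun p v => 1 * w p v + -1 * w' p v.
  by apply/funext => p; apply/funext => v; ring.
by rewrite lef_form_linl; apply/funext => p; apply/funext => v; ring.
Qed.

Lemma cohomologous_lef_iterl (w w' : diff_form R 6 2) m k (a : diff_form R 6 k) :
  closed_form 2 w -> closed_form 2 w' -> cohomologous w w' -> closed_form k a ->
  cohomologous (lef_iter w m a) (lef_iter w' m a).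
Proof.
move=> wC w'C ww aC; elim: m => [|m IH] /=; first exact: cohomologous_refl.
apply: cohomologous_trans (cohomologous_lef inv_lef wC IH) _.
exact: cohomologous_lefl ww (closed_lef_iter inv_lef _ w'C aC).
Qed.

Lemma lefschetz_map_iso_cst (w : diff_form R 6 2) (w0 : 'M[R]_(2, 6) -> R) m k :
  closed_form 2 w -> T_inv w0 -> cohomologous w (fun _ => w0) ->
  (forall a : 'M[R]_(k, 6) -> R, skew a -> lefn (gram w0) m a = (fun=> 0) -> a = fun=> 0) ->
  (forall c, skew c -> exists2 a : 'M[R]_(k, 6) -> R, skew a & lefn (gram w0) m a = c) ->
  set_bij (dR_cohomology D k) (dR_cohomology D (m.*2 + k)) (lefschetz_map D w m (k := k)).
Proof.
move=> wC w0T ww inj surj; have w0C := T_inv_closed w0T.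
have LE (c : 'M[R]_(k, 6) -> R) : lef_iter (fun _ => w0) m (fun _ : V => c) = fun _ => lefn (gram w0) m c.
  by apply/funext => p; rewrite lef_iterE.
have injB (a b : 'M[R]_(k, 6) -> R) : skew a -> skew b ->
    lefn (gram w0) m a = lefn (gram w0) m b -> a = b.
  move=> aS bS ab; have dS : skew (fun v => a v - b v).
    have := skew_lin 1 (-1) aS bS; congr skew.
    by apply/funext => v; ring.
  have /(inj _ dS) d0 : lefn (gram w0) m (fun v => a v - b v) = fun=> 0.
    by rewrite lefnB ab; apply/funext => v; rewrite subrr.
  by apply/funext => v; apply/eqP; rewrite -subr_eq0; have /eqP := congr1 (@^~ v) d0.
have Lcst a c : closed_form k a -> T_inv c -> cohomologous a (fun _ => c) ->
    cohomologous (lef_iter w m a) (fun _ => lefn (gram w0) m c).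
  move=> aC cT ac; rewrite -LE.
  apply: cohomologous_trans (cohomologous_lef_iterl _ wC w0C ww aC) _.
  exact: (cohomologous_lef_iter inv_lef).
have LT (c : 'M[R]_(k, 6) -> R) : T_inv c -> T_inv (lefn (gram w0) m c).
  move=> cT; apply: closed_T_inv; rewrite -LE.
  exact: (closed_lef_iter inv_lef) w0C (T_inv_closed cT).
apply: (lefschetz_map_iso inv_lef wC).
- move=> a b aC bC ab.
  have [ca caT aca] := closed_T_inv_rep aC; have [cb cbT bcb] := closed_T_inv_rep bC.
  have E : cohomologous (fun _ => lefn (gram w0) m ca) (fun _ => lefn (gram w0) m cb).
    apply: cohomologous_trans (cohomologous_sym (Lcst _ _ aC caT aca)) _.
    exact: cohomologous_trans ab (Lcst _ _ bC cbT bcb).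
  have cE := injB _ _ caT.1 cbT.1 (T_inv_cohomologous (LT _ caT) (LT _ cbT) E).
  by apply: cohomologous_trans aca _; rewrite cE; exact: cohomologous_sym.
- move=> c cC; have [c0 [c0S c0T] cc0] := closed_T_inv_rep cC.
  have [a aS ac] := surj c0 c0S.
  (* The preimage is invariant by injectivity: L^m commutes with the holonomy, and [c0] is
     invariant. *)
  have aT : T_inv a.
    split=> // l v; suff /(congr1 (@^~ v)) : (fun u => a (u *m T l)) = a by [].
    apply: injB => //; first exact: skew_comp.
    apply/funext => u; have [w0S w0E] := w0T.
    by rewrite -lefn_mul// ac.
  exists (fun _ => a); first exact: T_inv_closed.
  apply: cohomologous_trans (Lcst _ _ (T_inv_closed aT) aT (cohomologous_refl _ _)) _.
  by rewrite ac; exact: cohomologous_sym.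
Qed.

Lemma hard_lefschetz_diag (w : diff_form R 6 2) : closed_form 2 w ->
  Defs.nondegenerate w ->
  (forall p, exists S : 'M[R]_6, \det S = 1 /\ forall v, w p (v *m S) = w 0 v) ->
  hard_lefschetz D w.
Proof.
move=> wC wN wS; have [w0 w0T ww] := closed_T_inv_rep wC.
have w0C := T_inv_closed w0T; have WS := skew_gram w0T.1.
have WU : gram w0 \in unitmx.
  (* If w0^3 were 0, then w^3, which is constant, invariant and cohomologous to it, would be 0. *)
  apply: (@lef3_unit _ _ WS (fun=> 1)) => w03.
  apply: (cube_neq0 wC wN).
  have oneC : closed_form 0 (fun _ => fun=> 1).
    by apply: T_inv_closed; split=> //; exact: skew_deg0.
  have cT : T_inv (cube w).
    by split=> [|m v]; [exact: skew_cube wC|exact: (skew_top_T T_det _ _ (skew_cube wC))].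
  apply: (T_inv_cohomologous cT).
    by split=> //; exact: (skew0 6).
  have := cohomologous_lef_iterl 3 wC w0C ww oneC.
  rewrite (lef_iter_cst wC wS) (_ : lef_iter _ 3 _ = fun _ _ => 0).
    by congr (cohomologous _ _); apply/funext => p; apply/funext => v; rewrite mul1r.
  by apply/funext => p; rewrite lef_iterE; exact: w03.
have VS := invmx_skew WU WS; have VW := mulVmx WU.
move=> k k3; apply: (lefschetz_map_iso_cst wC w0T ww).
- case: k k3 => [_ a _|[_ a aS|[_ a aS|[_ a _|//]]]].
  + exact: (lef3_inj WS VS VW).
  + exact: (lef2_inj WS VS VW).
  + exact: (lef1_inj WS VS VW).
  + by [].
- case: k k3 => [_ c cS|[_ c cS|[_ c cS|[_ c cS|//]]]].
  + have [a ac] := lef3_surj WS VS VW cS; exists a => //; exact: skew_deg0.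
  + exact: (lef2_surj WS VS VW).
  + exact: (lef1_surj WS VS VW).
  + by exists c.
Qed.

End DiagonalBundle6.

(** * Matrix exponentials *)

Section MatrixExponential.
Context {R : realType} {n : nat}.
Local Notation M := 'M[R]_n.+1.
Implicit Types A B S : M.

Lemma cvg_mx_coef (u : nat -> M) (L : M) :
  (forall i j, (fun k => u k i j) @ \oo --> L i j) -> u @ \oo --> L.
Proof.
move=> uL; apply/cvg_ballP => r r0.
have H : \forall k \near \oo, forall i j, ball (L i j) r (u k i j).
  apply: filter_forall => i; apply: filter_forall => j.
  exact: (cvg_ball (uL i j) r0).
by apply: filterS H => k H; split.
Qed.

Lemma cvg_lincomb I (s : seq I) (c : I -> R) (u : I -> nat -> R) (L : I -> R) :
  (forall i, u i @ \oo --> L i) ->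
  (fun k => \sum_(i <- s) c i * u i k) @ \oo --> \sum_(i <- s) c i * L i.
Proof.
move=> uL; elim: s => [|i s IH].
  by rewrite big_nil; under eq_fun do rewrite big_nil; exact: cvg_cst.
rewrite big_cons; under eq_fun do rewrite big_cons.
by apply: cvgD => //; apply: cvgMr; exact: uL.
Qed.

Definition exp_entry A i j k : R := k`!%:R^-1 * (A ^+ k) i j.

Lemma series_exp_entry A (t : R) i j :
  (fun k => series (fun l => l`!%:R^-1 *: (t *: A) ^+ l) k i j) =
  pseries (exp_entry A i j) t.
Proof.
apply/funext => k; rewrite /pseries /series /= summxE; apply: eq_bigr => l _.
by rewrite exprZn 2!mxE /exp_entry; ring.
Qed.

Lemma pseries_diffs_exp_entry A i j :
  pseries_diffs (exp_entry A i j) = fun k => k`!%:R^-1 * (A ^+ k.+1) i j.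
Proof.
apply/funext => k; rewrite /pseries_diffs /exp_entry mulrA; congr (_ * _).
by rewrite factS natrM invfM mulrA divff ?mul1r.
Qed.

Let mass A : R := \sum_i \sum_j `|A i j|.

Lemma expmx_bound A k i j : `|(A ^+ k) i j| <= mass A ^+ k.
Proof.
elim: k i j => [|k IH] i j.
  by rewrite !expr0 mxE; case: (_ == _); rewrite ?normr1 ?normr0.
rewrite exprSr mxE; apply: le_trans (ler_norm_sum _ _ _) _.
rewrite exprSr.
have : \sum_l `|A l j| <= mass A.
  rewrite /mass; apply: ler_sum => l _.
  by rewrite (bigD1 j)//= lerDl sumr_ge0.
have mA : 0 <= mass A by apply: sumr_ge0 => l _; exact: sumr_ge0.
move=> /(ler_wpM2l (exprn_ge0 k mA)); apply: le_trans.
rewrite mulr_sumr; apply: ler_sum => l _; rewrite normrM.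
by apply: ler_wpM2r.
Qed.

(** Comparison with the scalar exponential series. The shift m covers the first two formal
    derivatives as well, whose convergence termwise differentiation requires. *)
Lemma cvg_exp_entry A m (K : R) i j :
  cvgn (pseries (fun k => k`!%:R^-1 * (A ^+ (k + m)) i j) K).
Proof.
apply: normed_cvg; have mA : 0 <= mass A.
  by apply: sumr_ge0 => l _; exact: sumr_ge0.
apply: (@series_le_cvg _ _ (fun k => mass A ^+ m * exp_coeff (mass A * `|K|) k)).
- by move=> k; exact: normr_ge0.
- move=> k; rewrite mulr_ge0 ?exprn_ge0// /exp_coeff /= divr_ge0// exprn_ge0//.
  by rewrite mulr_ge0.
- move=> k; rewrite /exp_coeff /= !normrM normfV normrX normr_nat.
  have := expmx_bound A (k + m) i j; set a := `|_| => aE.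
  have -> : mass A ^+ m * ((mass A * `|K|) ^+ k / k`!%:R) =
      k`!%:R^-1 * mass A ^+ (k + m) * `|K| ^+ k by rewrite exprMn exprD; ring.
  apply: ler_wpM2r; first exact: exprn_ge0.
  by apply: ler_wpM2l => //; rewrite invr_ge0.
- rewrite (_ : series _ = mass A ^+ m *: series (exp_coeff (mass A * `|K|))).
    by apply: is_cvgZr; exact: is_cvg_series_exp_coeff.
  apply/funext => k; rewrite -[RHS]/(mass A ^+ m * series _ k).
  by rewrite /series /= mulr_sumr.
Qed.

Lemma mexpE A (t : R) i j : mexp (t *: A) i j = limn (pseries (exp_entry A i j) t).
Proof.
have H : series (fun l => l`!%:R^-1 *: (t *: A) ^+ l) @ \oo -->
    (\matrix_(i, j) limn (pseries (exp_entry A i j) t) : M).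
  apply: cvg_mx_coef => a b; rewrite mxE series_exp_entry.
  have := @cvg_exp_entry A 0 t a b.
  by under [X in pseries X]eq_fun do rewrite addn0.
by rewrite /mexp (cvg_lim _ H) ?mxE.
Qed.

Definition mx_derive (F : R -> M) (t : R) (F' : M) :=
  forall i j, is_derive t (1 : R) (fun s => F s i j) (F' i j).

Lemma mx_derive_mexp A t :
  mx_derive (fun s => mexp (s *: A)) t (mexp (t *: A) *m A).
Proof.
move=> i j; under eq_fun do rewrite mexpE.
have c0 K a b : cvgn (pseries (exp_entry A a b) K).
  by have := @cvg_exp_entry A 0 K a b; under [X in pseries X]eq_fun do rewrite addn0.
have -> : (mexp (t *: A) *m A) i j = limn (pseries (pseries_diffs (exp_entry A i j)) t).
  rewrite pseries_diffs_exp_entry mxE; apply/esym/cvg_lim => //.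
  have -> : pseries (fun k => k`!%:R^-1 * (A ^+ k.+1) i j) t =
      fun k => \sum_l A l j * pseries (exp_entry A i l) t k.
    apply/funext => k; rewrite /pseries /series /=.
    under [RHS]eq_bigr do rewrite mulr_sumr.
    rewrite exchange_big; apply: eq_bigr => q _.
    rewrite exprSr mxE mulr_sumr mulr_suml; apply: eq_bigr => l _.
    by rewrite /exp_entry; ring.
  under [X in _ --> X]eq_bigr do rewrite mexpE mulrC.
  by apply: cvg_lincomb => l; exact: c0.
(* Any radius beyond |t| would serve. *)
apply: (@pseries_snd_diffs _ _ (`|t| + 1)).
- exact: c0.
- rewrite pseries_diffs_exp_entry; have := @cvg_exp_entry A 1 (`|t| + 1) i j.
  by under [X in pseries X]eq_fun do rewrite addn1.
- have -> : pseries_diffs (pseries_diffs (exp_entry A i j)) =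
      fun k => k`!%:R^-1 * (A ^+ (k + 2)) i j.
    rewrite pseries_diffs_exp_entry; apply/funext => k; rewrite /pseries_diffs mulrA addn2.
    by congr (_ * _); rewrite factS natrM invfM mulrA divff ?mul1r.
  exact: cvg_exp_entry.
- by rewrite [X in _ < X]ger0_norm ?addr_ge0// ltrDl.
Qed.

Lemma mexp_comm A B t : A *m B = B *m A -> mexp (t *: A) *m B = B *m mexp (t *: A).
Proof.
move=> AB; have ABk k : A ^+ k *m B = B *m A ^+ k by exact/esym/commrX.
have c0 K a b : cvgn (pseries (exp_entry A a b) K).
  by have := @cvg_exp_entry A 0 K a b; under [X in pseries X]eq_fun do rewrite addn0.
apply/matrixP => i j; rewrite !mxE.
have H1 : (fun k => \sum_l B l j * pseries (exp_entry A i l) t k) @ \oo -->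
    \sum_l mexp (t *: A) i l * B l j.
  under [X in _ --> X]eq_bigr do rewrite mexpE mulrC.
  by apply: cvg_lincomb => l; exact: c0.
have H2 : (fun k => \sum_l B i l * pseries (exp_entry A l j) t k) @ \oo -->
    \sum_l B i l * mexp (t *: A) l j.
  under [X in _ --> X]eq_bigr do rewrite mexpE.
  by apply: cvg_lincomb => l; exact: c0.
rewrite -(cvg_lim _ H1)// -(cvg_lim _ H2)//; congr (limn _); apply/funext => k.
under eq_bigr do rewrite mulr_sumr; under [RHS]eq_bigr do rewrite mulr_sumr.
rewrite exchange_big [RHS]exchange_big; apply: eq_bigr => q _ /=.
have /matrixP/(_ i j) := ABk q; rewrite !mxE => /(congr1 (fun x => q`!%:R^-1 * x * t ^+ q)).
rewrite !mulr_sumr !mulr_suml => E.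
transitivity (\sum_l q`!%:R^-1 * ((A ^+ q) i l * B l j) * t ^+ q).
  by apply: eq_bigr => l _; rewrite /exp_entry; ring.
by rewrite E; apply: eq_bigr => l _; rewrite /exp_entry; ring.
Qed.

Lemma mexp0 : mexp (0 : M) = 1%:M.
Proof.
rewrite /mexp (_ : series _ = fun k => if k is 0 then 0 else 1%:M).
  apply: cvg_lim => //; apply: cvg_near_cst.
  by exists 1%N => // -[].
apply/funext => -[|k]; first by rewrite /series /= big_geq.
rewrite /series /= big_nat_recl//= expr0 fact0 invr1 scale1r big1 ?addr0// => i _.
by rewrite expr0n scaler0.
Qed.

Lemma mx_deriveM F G t F' G' : mx_derive F t F' -> mx_derive G t G' ->
  mx_derive (fun s => F s *m G s) t (F' *m G t + F t *m G').
Proof.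
move=> FD GD i j.
have -> : (fun s => (F s *m G s) i j) = \sum_l (fun s => F s i l * G s l j).
  by apply/funext => s; rewrite mxE fct_sumE.
apply: is_derive_eq; first by apply: is_derive_sum => l; exact: is_deriveM.
rewrite !mxE -big_split; apply: eq_bigr => l _ /=.
by rewrite addrC; congr (_ + _); rewrite mulrC.
Qed.

Lemma mx_derive0 F : (forall t, mx_derive F t 0) -> forall t, F t = F 0.
Proof.
move=> FD t; apply/matrixP => i j.
apply: (is_derive_0_is_cst (f := fun s => F s i j)) => s.
by have := FD s i j; rewrite mxE.
Qed.

(* [F t *m mexp (- t *: A)] has derivative 0. *)
Lemma mexp_unique A F : (forall t, mx_derive F t (F t *m A)) -> F 0 = 1%:M ->
  forall t, F t *m mexp (t *: - A) = 1%:M.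
Proof.
move=> FD F0 t.
have -> : F t *m mexp (t *: - A) = F 0 *m mexp (0 *: - A); last first.
  by rewrite F0 scale0r mexp0 mulmx1.
apply: (mx_derive0 (F := fun s => F s *m mexp (s *: - A))) => s.
have C : mexp (s *: - A) *m A = A *m mexp (s *: - A).
  by apply: mexp_comm; rewrite mulNmx mulmxN.
have := mx_deriveM (FD s) (mx_derive_mexp (- A) s); congr (mx_derive _ _ _).
by rewrite mulmxN C mulmxN mulmxA subrr.
Qed.

Lemma mexpN A t : mexp (t *: A) *m mexp (t *: - A) = 1%:M.
Proof.
apply: (mexp_unique (F := fun s => mexp (s *: A))) => [s|]; first exact: mx_derive_mexp.
by rewrite scale0r mexp0.
Qed.

(** [F t] and the exponential are both inverse to exp(-tA). Closed formulas for exponentials are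
    then checked through their differential equation. *)
Lemma mexp_eq A F : (forall t, mx_derive F t (F t *m A)) -> F 0 = 1%:M ->
  forall t, mexp (t *: A) = F t.
Proof.
move=> FD F0 t; have /mulmx1C E := mexpN A t.
by rewrite -[LHS]mul1mx -(mexp_unique FD F0 t) -mulmxA E mulmx1.
Qed.

Lemma mexpD A B t : A *m B = B *m A ->
  mexp (t *: (A + B)) = mexp (t *: A) *m mexp (t *: B).
Proof.
move=> AB; apply: (mexp_eq (F := fun s => mexp (s *: A) *m mexp (s *: B))) => [s|].
  have := mx_deriveM (mx_derive_mexp A s) (mx_derive_mexp B s); congr (mx_derive _ _ _).
  have C := mexp_comm s (esym AB).
  by rewrite mulmxDr -!mulmxA C.
by rewrite !scale0r mexp0 mulmx1.
Qed.

Lemma mexp_add A s t : mexp ((s + t) *: A) = mexp (s *: A) *m mexp (t *: A).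
Proof.
have := @mexpD (s *: A) (t *: A) 1; rewrite !scale1r -scalerDl => -> //.
by rewrite -!scalemxAl -!scalemxAr scalerA mulrC -scalerA.
Qed.

End MatrixExponential.

Section ExplicitExponentials.
Context {R : realType} {n : nat}.
Implicit Types (A N S : 'M[R]_n.+1).

Lemma mx_derive_lincomb (f g : R -> R) A N S (t df dg : R) :
  is_derive t (1 : R) f df -> is_derive t (1 : R) g dg ->
  mx_derive (fun s => A + f s *: N + g s *: S) t (df *: N + dg *: S).
Proof.
move=> fD gD i j.
have -> : (fun s => (A + f s *: N + g s *: S) i j) =
    cst (A i j) + (N i j *: f + S i j *: g).
  by apply/funext => s; rewrite !mxE !fctE addrA; congr (_ + _ + _); rewrite mulrC.
have -> : (df *: N + dg *: S) i j = 0 + (N i j *: df + S i j *: dg).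
  by rewrite !mxE add0r mulrC [dg * _]mulrC.
have cD := @is_derive_cst R R R (A i j) t 1.
have sD := is_deriveD (is_deriveZ (N i j) fD) (is_deriveZ (S i j) gD).
exact: (is_deriveD cD sD).
Qed.

Lemma mexp_nilpotent N t : N *m N *m N = 0 ->
  mexp (t *: N) = 1%:M + t *: N + (t ^+ 2 / 2) *: (N *m N).
Proof.
move=> N3; apply: (mexp_eq (F := fun s => 1%:M + s *: N + (s ^+ 2 / 2) *: (N *m N))) => [s|]; last first.
  by rewrite scale0r expr2 !mul0r scale0r !addr0.
have gD : is_derive s (1 : R) (fun s => s ^+ 2 / 2) s.
  have -> : (fun s : R => s ^+ 2 / 2) = 2^-1 *: (fun s : R => s ^+ 2).
    by apply/funext => u; rewrite fctE mulrC.
  apply: is_derive_eq; rewrite /GRing.scale /=.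
  by field.
have := mx_derive_lincomb 1%:M N (N *m N) (is_derive_id s (1 : R)) gD.
congr (mx_derive _ _ _).
by rewrite !mulmxDl mul1mx -!scalemxAl N3 scaler0 addr0 scale1r.
Qed.

Lemma mexp_diag (d : 'rV[R]_n.+1) t :
  mexp (t *: diag_mx d) = diag_mx (\row_j expR (t * d ord0 j)).
Proof.
apply: (mexp_eq (F := fun s => diag_mx (\row_j expR (s * d ord0 j)))) => [s i j|]; last first.
  by apply/matrixP => i j; rewrite !mxE mul0r expR0.
rewrite mul_mx_diag !mxE.
have -> : (fun u => diag_mx (\row_k expR (u * d ord0 k)) i j) =
    (i == j)%:R *: (expR \o (d ord0 i *: id)).
  apply/funext => u; rewrite !mxE -[RHS]/((i == j)%:R * expR (d ord0 i * u)).
  by rewrite mulr_natl [u * _]mulrC.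
apply: is_derive_eq; rewrite /GRing.scale /=.
have [->|_] := eqVneq i j; last by rewrite mulr0n !mul0r.
by rewrite mulr1n mul1r mulr1 [s * _]mulrC.
Qed.

(** Rodrigues' formula; S^3 = -S confines the eigenvalues to 0, i and -i. *)
Lemma mexp_rotation S t : S *m S *m S = - S ->
  mexp (t *: S) = 1%:M + sin t *: S + (1 - cos t) *: (S *m S).
Proof.
move=> S3; apply: (mexp_eq (F := fun s => 1%:M + sin s *: S + (1 - cos s) *: (S *m S))) => [s|]; last first.
  by rewrite sin0 cos0 subrr !scale0r !addr0.
have gD : is_derive s (1 : R) (fun s => 1 - cos s) (sin s).
  have -> : (fun s : R => 1 - cos s) = cst 1 - cos by apply/funext.
  by apply: is_derive_eq; rewrite sub0r opprK.
have := mx_derive_lincomb 1%:M S (S *m S) (is_derive_sin s) gD.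
congr (mx_derive _ _ _).
rewrite !mulmxDl mul1mx -!scalemxAl S3; move: (S *m S) => P.
by apply/matrixP => i j; rewrite !mxE; ring.
Qed.

Lemma cos2pi_int (m : int) : cos (2 * pi * m%:~R) = 1 :> R.
Proof.
have H k : cos (2 * pi * k%:R) = 1 :> R.
  have := periodicn (@cosD2pi R) k 0; rewrite add0r cos0; apply: etrans.
  by congr cos; rewrite mulr_natr -[pi *+ 2]mulr_natl.
case: m => k; first exact: H.
by rewrite NegzE mulrNz mulrN cosN; exact: H.
Qed.

Lemma sin2pi_int (m : int) : sin (2 * pi * m%:~R) = 0 :> R.
Proof.
have H k : sin (2 * pi * k%:R) = 0 :> R.
  have := periodicn (@sinD2pi R) k 0; rewrite add0r sin0; apply: etrans.
  by congr sin; rewrite mulr_natr -[pi *+ 2]mulr_natl.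
case: m => k; first exact: H.
by rewrite NegzE mulrNz mulrN sinN (H k.+1) oppr0.
Qed.

Lemma mexp_rotation_turns S (m : int) : S *m S *m S = - S ->
  mexp ((2 * pi * m%:~R) *: S) = 1%:M.
Proof.
by move=> S3; rewrite mexp_rotation// cos2pi_int sin2pi_int subrr !scale0r !addr0.
Qed.

End ExplicitExponentials.

Lemma mulmx_exp_line {R : realType} n (N : 'M[R]_n.+1) (y : 'rV[R]_n.+1) s :
  N *m N *m N = 0 -> y *m N *m N = 0 -> y *m mexp (s *: N) = y + s *: (y *m N).
Proof.
move=> N3 yN2; rewrite (mexp_nilpotent _ N3) !mulmxDr mulmx1 -!scalemxAr mulmxA yN2.
by rewrite scaler0 addr0.
Qed.

(** * The deck groups *)

Section Deck.
Context {R : realType}.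
Implicit Types (A B : 'M[R]_5) (p v g : 'rV[R]_6).

Local Notation e0 := (delta_mx 0 ord0 : 'rV[R]_6).
Local Notation x0 := (@crd R 6 ord0).

Definition extend A : 'M[R]_6 := block_mx (1%:M : 'M[R]_1) 0 0 A.

Definition fibre (y : 'rV[R]_5) : 'rV[R]_6 := row_mx (0 : 'rV[R]_1) y.

Lemma extendM A B : extend (A *m B) = extend A *m extend B.
Proof.
have := mulmx_block (1%:M : 'M[R]_1) 0 0 A (1%:M : 'M[R]_1) 0 0 B.
by rewrite !mul0mx !mulmx0 !mul1mx !addr0 add0r => /esym.
Qed.

Lemma extend1 : extend 1%:M = 1%:M.
Proof. by rewrite /extend -(@scalar_mx_block R 1 5). Qed.

Lemma det_extend A : \det (extend A) = \det A.
Proof. by rewrite /extend (det_ublock (1%:M : 'M[R]_1) 0 A) det1 mul1r. Qed.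

Lemma x0_lsubmx v : lsubmx (v : 'rV[R]_(1 + 5)) 0 0 = x0 v.
Proof. by rewrite mxE /crd; congr (v _ _); apply/val_inj. Qed.

Lemma x0_fibre y : x0 (fibre y) = 0.
Proof. by rewrite -x0_lsubmx /fibre row_mxKl mxE. Qed.

Lemma fibreP v : x0 v = 0 -> v = fibre (rsubmx (v : 'rV[R]_(1 + 5))).
Proof.
move=> v0; have vl : lsubmx (v : 'rV[R]_(1 + 5)) = 0.
  by apply/rowP => j; rewrite ord1 x0_lsubmx v0 mxE.
by rewrite /fibre -vl hsubmxK.
Qed.

Lemma decompose v : v = x0 v *: e0 + fibre (rsubmx (v : 'rV[R]_(1 + 5))).
Proof.
apply/eqP; rewrite addrC -subr_eq; apply/eqP.
rewrite [LHS]fibreP; last by rewrite /crd !mxE eqxx mulr1 subrr.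
congr fibre; apply/rowP => j; rewrite !mxE.
have -> : rshift 1 j == ord0 = false by [].
by rewrite andbF mulr0 subr0.
Qed.

Lemma fibre_extend y A : fibre y *m extend A = fibre (y *m A).
Proof.
have := mul_row_block (0 : 'rV[R]_1) y (1%:M : 'M[R]_1) 0 0 A.
by rewrite !mul0mx mulmx0 addr0 add0r.
Qed.

Lemma e0_extend A : e0 *m extend A = e0.
Proof.
have -> : e0 = row_mx (1%:M : 'M[R]_1) (0 : 'rV[R]_5).
  rewrite -[LHS](hsubmxK (e0 : 'rV[R]_(1 + 5))).
  have -> : lsubmx (e0 : 'rV[R]_(1 + 5)) = 1%:M.
    by apply/rowP => j; rewrite !ord1 x0_lsubmx /crd !mxE eqxx.
  suff -> : rsubmx (e0 : 'rV[R]_(1 + 5)) = 0 by [].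
  by apply/rowP => j; rewrite !mxE (_ : rshift 1 j == ord0 = false) ?andbF.
have := mul_row_block (1%:M : 'M[R]_1) 0 (1%:M : 'M[R]_1) 0 0 A.
by rewrite !mul0mx mulmx0 !addr0 mul1mx.
Qed.

Lemma x0_extend v A : x0 (v *m extend A) = x0 v.
Proof.
rewrite [in LHS](decompose v) mulmxDl -scalemxAl e0_extend fibre_extend.
by rewrite linearD linearZ /= x0_fibre addr0 /crd mxE eqxx -[_ *: _]/(_ * _) mulr1.
Qed.

Lemma fibre_is_linear : linear fibre.
Proof.
move=> a u v; have := @add_row_mx _ 1 1 5 (a *: 0) (a *: u) 0 v.
by rewrite -(@scale_row_mx _ 1 1 5) scaler0 addr0 => ->.
Qed.
HB.instance Definition _ := GRing.isLinear.Build R 'rV[R]_5 'rV[R]_6 _ fibre fibre_is_linear.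

(** Left translations are affine maps of R^6, which makes their pullbacks explicit. *)
Lemma sdmulE B (g : 'rV[R]_(1 + 5)) : sdmul B g = fun h => h *m extend (mexp (x0 g *: B)) + g.
Proof.
apply/funext => h; rewrite /sdmul x0_lsubmx.
have := mul_row_block (lsubmx h) (rsubmx h) (1%:M : 'M[R]_1) 0 0 (mexp (x0 g *: B)).
rewrite mulmx1 !mulmx0 addr0 add0r hsubmxK /extend => ->.
transitivity (row_mx (lsubmx h) (rsubmx h *m mexp (x0 g *: B)) + row_mx (lsubmx g) (rsubmx g)).
  by rewrite add_row_mx [lsubmx g + _]addrC [rsubmx g + _]addrC.
by rewrite hsubmxK.
Qed.

Lemma pullback_affine k (S : 'M[R]_6) c (a : diff_form R 6 k) :
  pullback (fun h => h *m S + c) a = fun p (u : 'M[R]_(k, 6)) => a (p *m S + c) (u *m S).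
Proof.
apply/funext => p; apply/funext => v; rewrite /pullback; congr (a _ _).
by apply/row_matrixP => i; rewrite rowK diff_affine row_mul.
Qed.

Section Quotient.
Variables (G : modified_pair R) (t : R) (L : set 'rV[R]_5) (P : 'M[R]_5).
Hypothesis t_neq0 : t != 0.
Hypotheses (PU : P \in unitmx)
  (LP : L = [set map_mx intr z *m P | z in [set: 'rV[int]_5]])
  (LI : [set x *m mexp (t *: ad_orig G) | x in L] = L).

Local Notation phi s := (mexp (s *: ad_orig G)).

Definition deck_basis (j : 'I_5) : 'rV[R]_6 := fibre (row j P).

Definition deck_holonomy (m : int) : 'M[R]_6 := extend (phi (m%:~R * t)).

Lemma deck_basis_fibre j : x0 (deck_basis j) = 0.
Proof. exact: x0_fibre. Qed.

Lemma fibre_comb (c : 'rV[R]_5) : fibre (c *m P) = \sum_j c 0 j *: deck_basis j.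
Proof. by rewrite mulmx_sum_row linear_sum; apply: eq_bigr => j _; rewrite linearZ. Qed.

Lemma deck_basis_span v : x0 v = 0 -> exists c : 'I_5 -> R, v = \sum_j c j *: deck_basis j.
Proof.
move=> /fibreP ->; set y := rsubmx _.
by exists (fun j => (y *m invmx P) 0 j); rewrite -fibre_comb mulmxKV.
Qed.

Lemma deck_holonomy0 : deck_holonomy 0 = 1%:M.
Proof. by rewrite /deck_holonomy mul0r scale0r mexp0 extend1. Qed.

Lemma deck_holonomyD m m' : deck_holonomy (m + m') = deck_holonomy m *m deck_holonomy m'.
Proof. by rewrite /deck_holonomy intrD mulrDl mexp_add extendM. Qed.

(** phi(t) maps the lattice onto itself, so its inverse preserves the lattice too and the induction
    can run over all integers. *)
Lemma lattice_holonomy (m : int) x : L x -> L (x *m phi (m%:~R * t)).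
Proof.
have Lp y : L y -> L (y *m phi t) by move=> Ly; rewrite -LI; exists y.
have Lm y : L y -> L (y *m phi (- t)).
  rewrite -{1}LI => -[z Lz <-]; rewrite -mulmxA -mexp_add subrr scale0r mexp0.
  by rewrite mulmx1.
elim/int_ind: m x => [|m IH|m IH] x Lx.
- by rewrite mul0r scale0r mexp0 mulmx1.
- by rewrite intS intrD mulrDl mul1r mexp_add mulmxA; exact/IH/Lp.
- by rewrite intS opprD intrD mulrDl rmorphN1 mulN1r mexp_add mulmxA; exact/IH/Lm.
Qed.

Lemma deck_basis_holonomy m j : exists z : 'I_5 -> int,
  deck_basis j *m deck_holonomy m = \sum_i (z i)%:~R *: deck_basis i.
Proof.
have : L (row j P).
  by rewrite LP; exists (delta_mx 0 j) => //; rewrite map_delta_mx -rowE.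
move=> /(lattice_holonomy m); rewrite LP => -[z _ zE].
exists (fun i => z 0 i); rewrite /deck_basis /deck_holonomy fibre_extend -zE fibre_comb.
by apply: eq_bigr => i _; rewrite mxE.
Qed.

(** A deck transformation is an m-fold monodromy followed by a lattice translation. The case m = 0
    gives periodicity and the zero lattice vector gives invariance under [pb]; conversely the two
    compose. *)
Lemma deck_invariant k (a : diff_form R 6 k) :
  invariant_form (deck G t L) k a <-> bundle_form t deck_basis deck_holonomy a.
Proof.
have pbE m (z : 'rV[int]_5) : let g := (m%:~R * t) *: e0 + fibre (map_mx intr z *m P) in
    deck G t L (sdmul (ad_orig G) g) /\
    pullback (sdmul (ad_orig G) g) a = fun p (u : 'M[R]_(k, 6)) =>
      a (monodromy t deck_holonomy m p + fibre (map_mx intr z *m P)) (u *m deck_holonomy m).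
  move=> g; have g0 : x0 g = m%:~R * t.
    by rewrite /g linearD linearZ /= x0_fibre addr0 /crd mxE eqxx -[_ *: _]/(_ * _) mulr1.
  split.
    exists g => //; split; first by exists m; rewrite x0_lsubmx g0 mulrC.
    suff -> : rsubmx (g : 'rV[R]_(1 + 5)) = map_mx intr z *m P by rewrite LP; exists z.
    have := decompose g; rewrite {1}/g g0 => /addrI /(congr1 (@rsubmx R 1 1 5)).
    by rewrite /fibre !row_mxKr.
  rewrite sdmulE pullback_affine g0; apply/funext => p; apply/funext => v.
  by rewrite /monodromy addrA.
split=> [[aS aD]|[aS aP aE]].
  split=> // [j p|m].
    have [gD gE] := pbE 0 (delta_mx 0 j); have := aD _ gD; rewrite gE => /(congr1 (@^~ p)).
    rewrite map_delta_mx -rowE -/(deck_basis j) deck_holonomy0 => <-.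
    apply/funext => v; rewrite mulmx1; congr (a (_ + _) _).
    by rewrite /monodromy deck_holonomy0 mulmx1 mul0r scale0r addr0.
  have [gD gE] := pbE m 0; have := aD _ gD; rewrite gE => {2}<-.
  apply/funext => p; apply/funext => v; rewrite map_mx0 mul0mx linear0 addr0.
  by [].
split=> // _ [g [[m gm] Lg] <-].
move: Lg; rewrite LP => -[z _ zE].
have -> : g = (m%:~R * t) *: e0 + fibre (map_mx intr z *m P).
  by rewrite [LHS]decompose -x0_lsubmx gm zE mulrC.
have [_ ->] := pbE m z; rewrite -[RHS](aE m); apply/funext => p; apply/funext => v.
rewrite /pb fibre_comb.
by under eq_bigr do rewrite mxE; rewrite (periodic_lattice (fun i => z 0 i) _ aP).
Qed.

Hypothesis holonomyE : forall m : int, phi (m%:~R * t) = mexp ((m%:~R * t) *: ad_mod G).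
Hypothesis unimodular : forall s, \det (mexp (s *: ad_mod G)) = 1.
Variable w : diff_form R 6 2.
Hypothesis wM : modified_symplectic G w.

Lemma deck_holonomy_det m : \det (deck_holonomy m) = 1.
Proof. by rewrite /deck_holonomy det_extend holonomyE unimodular. Qed.

Lemma modified_translation g p (u : 'M[R]_(2, 6)) :
  w (p *m extend (mexp (x0 g *: ad_mod G)) + g) (u *m extend (mexp (x0 g *: ad_mod G))) = w p u.
Proof.
have [[[_ wI] _] _] := wM.
have : left_translations (ad_mod G) [set: 'rV[R]_(1 + 5)] (sdmul (ad_mod G) g) by exists g.
by move=> /wI; rewrite sdmulE pullback_affine => /(congr1 (fun b => b p u)).
Qed.

(** Elements of the fibre R^5 act by plain translations, as exp(0) = 1. *)
Lemma modified_fibre_const : fibre_const w.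
Proof.
move=> p u u0; apply/funext => v; have := modified_translation u p v.
by rewrite u0 scale0r mexp0 extend1 !mulmx1.
Qed.

(** Deck transformations are also left translations of the modified group, because the two
    exponentials agree at multiples of the period. *)
Lemma modified_closed : closed_form (deck G t L) 2 w.
Proof.
have [[[wS _] dw] _] := wM; split=> //; apply/deck_invariant; split=> //.
- by move=> j p; rewrite modified_fibre_const// deck_basis_fibre.
- move=> m; apply/funext => p; apply/funext => v.
  rewrite -[RHS](modified_translation ((m%:~R * t) *: e0)).
  have -> : x0 ((m%:~R * t) *: e0) = m%:~R * t by rewrite /crd !mxE eqxx mulr1.
  by rewrite -holonomyE.
Qed.

(** Left translation by [p] in the modified group carries the origin to [p]; S is its linear
    part. *)
Lemma modified_homogeneous p : exists S : 'M[R]_6, [/\ \det S = 1,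
  forall u, w p (u *m S) = w 0 u,
  forall y : 'rV[R]_5, y *m ad_mod G = 0 ->
    y *m mexp (x0 p *: ad_mod G) = y -> fibre y *m S = fibre y &
  forall v, x0 (v *m S) = x0 v].
Proof.
exists (extend (mexp (x0 p *: ad_mod G))); split.
- by rewrite det_extend.
- by move=> v; rewrite -[RHS](modified_translation p) mul0mx add0r.
- by move=> y _ yE; rewrite fibre_extend yE.
- by move=> v; exact: x0_extend.
Qed.

Lemma deck_lefschetz_iso0 : lefschetz_iso (deck G t L) w 0.
Proof.
apply: (lefschetz_iso0 t_neq0 deck_basis_fibre deck_basis_span deck_holonomy0
  deck_holonomyD (fun m v => x0_extend v _) (fun m => e0_extend _) deck_basis_holonomy
  deck_holonomy_det deck_invariant modified_closed wM.2).
by move=> p; have [S [S1 SE _ _]] := modified_homogeneous p; exists S.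
Qed.

Lemma deck_not_lefschetz_iso1 (y eps : 'rV[R]_5) :
  ad_mod G *m ad_mod G *m ad_mod G = 0 -> y *m ad_mod G = eps -> eps *m ad_mod G = 0 ->
  eps != 0 -> ~ lefschetz_iso (deck G t L) w 1.
Proof.
move=> N3 yE eE e0.
have epsE s : eps *m mexp (s *: ad_mod G) = eps.
  by rewrite mulmx_exp_line// eE ?mul0mx// scaler0 addr0.
apply: (lefschetz_not_iso1 (eps := fibre eps) (y := fibre y) t_neq0 deck_basis_fibre
  deck_basis_span deck_holonomy0 deck_holonomyD (fun m v => x0_extend v _)
  (fun m => e0_extend _) deck_basis_holonomy deck_holonomy_det deck_invariant
  modified_closed wM.2 modified_fibre_const).
- move=> p; have [S [S1 SE Se Sx]] := modified_homogeneous p.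
  by exists S; split=> //; exact: Se.
- exact: x0_fibre.
- apply: contra e0 => /eqP /(congr1 (@rsubmx R 1 1 5)); rewrite /fibre row_mxKr => ->.
  by apply/eqP/rowP => j; rewrite !mxE.
- by move=> m; rewrite /deck_holonomy holonomyE fibre_extend epsE.
- move=> m; rewrite /deck_holonomy holonomyE fibre_extend mulmx_exp_line ?yE//.
  by rewrite linearD linearZ.
Qed.

Lemma deck_hard_lefschetz (d : 'rV[R]_5) :
  ad_mod G = diag_mx d -> hard_lefschetz (deck G t L) w.
Proof.
move=> dE.
pose nu (m : int) : 'rV[R]_6 := row_mx (1%:M : 'M[R]_1) (\row_j expR (m%:~R * t * d ord0 j)).
have T_diag m : deck_holonomy m = diag_mx (nu m).
  rewrite /deck_holonomy holonomyE dE mexp_diag /nu (diag_mx_row (1%:M : 'M[R]_1)).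
  suff -> : diag_mx (1%:M : 'M[R]_1) = 1%:M by [].
  by apply/matrixP => i j; rewrite !ord1 !mxE.
apply: (hard_lefschetz_diag t_neq0 deck_basis_fibre deck_basis_span deck_holonomy0
  deck_holonomyD (fun m v => x0_extend v _) (fun m => e0_extend _) deck_basis_holonomy
  deck_holonomy_det deck_invariant T_diag modified_closed wM.2).
by move=> p; have [S [S1 SE _ _]] := modified_homogeneous p; exists S.
Qed.

End Quotient.
End Deck.

(** The truncated exponential series is lower triangular with unit diagonal. *)
Lemma det_mexp_lower {R : realType} n (N : 'M[R]_n.+1) s : N *m N *m N = 0 ->
  (forall i j : 'I_n.+1, (i <= j)%N -> N i j = 0) -> \det (mexp (s *: N)) = 1.
Proof.
move=> N3 Nlow; rewrite (mexp_nilpotent _ N3).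
have N2low (i j : 'I_n.+1) : (i <= j)%N -> (N *m N) i j = 0.
  move=> ij; rewrite mxE big1// => l _.
  have [il|li] := leqP i l; first by rewrite Nlow ?mul0r.
  by rewrite [N l j]Nlow ?mulr0//; exact: leq_trans (ltnW li) ij.
move: (N *m N) N2low => P Plow; rewrite det_trig.
  by rewrite big1// => i _; rewrite !mxE eqxx Nlow// Plow// !mulr0 !addr0.
apply/is_trig_mxP => i j ij; rewrite !mxE Nlow ?Plow ?(ltnW ij)// !mulr0 !addr0.
by rewrite -val_eqE (ltn_eqF ij).
Qed.

Lemma det_mexp_diag {R : realType} n (d : 'rV[R]_n.+1) s :
  \sum_j d ord0 j = 0 -> \det (mexp (s *: diag_mx d)) = 1.
Proof.
move=> d0; rewrite mexp_diag det_diag.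
transitivity (expR (\sum_j s * d ord0 j)); last by rewrite -mulr_sumr d0 mulr0 expR0.
by rewrite expR_sum; apply: eq_bigr => j _; rewrite !mxE.
Qed.

(** * The five groups *)

Section Rotations.
Context {R : realType} {n : nat}.
Implicit Types a b c d : 'I_n.+1.

(** In the row convention the a-th basis vector goes to minus the b-th and the b-th to the a-th, as
    in [X_4, X_6] = -X_5, [X_5, X_6] = X_4. *)
Definition rotation a b : 'M[R]_n.+1 := delta_mx b a - delta_mx a b.

Lemma rotation3 a b : a != b ->
  rotation a b *m rotation a b *m rotation a b = - rotation a b.
Proof.
move=> ab; have ba : b != a by rewrite eq_sym.
have -> : rotation a b *m rotation a b = - (delta_mx b b + delta_mx a a).
  rewrite /rotation !(mulmxBl, mulmxBr) !mul_delta_mx !mul_delta_mx_0//.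
  by rewrite sub0r subr0 opprD.
rewrite /rotation mulNmx !(mulmxDl, mulmxBr) !mul_delta_mx !mul_delta_mx_0//.
by rewrite subr0 sub0r.
Qed.

Lemma rotation_turns a b (m : int) : a != b ->
  mexp ((2 * pi * m%:~R) *: rotation a b) = 1%:M.
Proof. by move=> /rotation3; exact: mexp_rotation_turns. Qed.

Lemma rotation_disjoint a b c d : a != c -> a != d -> b != c -> b != d ->
  rotation a b *m rotation c d = 0.
Proof.
move=> ac ad bc bd; rewrite /rotation !(mulmxBl, mulmxBr) !mul_delta_mx_cond.
by rewrite (negbTE ac) (negbTE ad) (negbTE bc) (negbTE bd) !mulr0n !subr0.
Qed.

Lemma rotation_diag a b (r : 'rV[R]_n.+1) : r 0 a = r 0 b ->
  diag_mx r *m rotation a b = rotation a b *m diag_mx r.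
Proof.
move=> rab.
have E i j x y : r 0 x = r 0 y -> r 0 i * ((i == x) && (j == y))%:R =
    ((i == x) && (j == y))%:R * r 0 j :> R.
  move=> xy; case: (eqVneq i x) => [->|_]; last by rewrite mulr0 mul0r.
  by case: (eqVneq j y) => [->|_]; rewrite ?mulr0 ?mul0r// mulr1 mul1r.
rewrite mul_mx_diag mul_diag_mx; apply/matrixP => i j; rewrite !mxE mulrBr mulrBl.
by congr (_ - _); exact: E.
Qed.

End Rotations.

Local Notation o k := (@Ordinal 5 k isT).

Ltac deltas := rewrite /rotation ?(mulmxDl, mulmxDr, mulmxBl, mulmxBr, mulmxN, mulNmx);
  repeat rewrite ?mul_delta_mx ?mul_delta_mx_0 //
    ?(mulmx0, mul0mx, addr0, add0r, subr0, sub0r, oppr0).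

Section Groups.
Context {R : realType}.
Local Notation J := (@rotation R 4).
Local Notation D i j := (delta_mx (o i) (o j) : 'M[R]_5).

Ltac mx5 := apply/matrixP => - [[|[|[|[|[|?]]]]] ? //] [[|[|[|[|[|?]]]]] ? //];
  rewrite ?mxE /=; ring.

Lemma mod_6_10 : ad_mod (G6_10 R) = D 1 0 + D 2 1.
Proof. mx5. Qed.
Lemma orig_6_10 : ad_orig (G6_10 R) = ad_mod (G6_10 R) + J (o 3) (o 4).
Proof. mx5. Qed.

Lemma mod_5_14 : ad_mod (G5_14_x_R R) = D 1 0.
Proof. mx5. Qed.
Lemma orig_5_14 : ad_orig (G5_14_x_R R) = ad_mod (G5_14_x_R R) + J (o 2) (o 3).
Proof. mx5. Qed.

Lemma mod_5_18 : ad_mod (G5_18_x_R R) = D 2 0 + D 3 1.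
Proof. mx5. Qed.
Lemma orig_5_18 : ad_orig (G5_18_x_R R) =
  ad_mod (G5_18_x_R R) + (J (o 0) (o 1) + J (o 2) (o 3)).
Proof. mx5. Qed.

Definition weights_5_17 (p : R) : 'rV[R]_5 :=
  \row_j [:: p; p; - p; - p; 0]`_j.

Lemma mod_5_17 p r : ad_mod (G5_17_x_R p r) = diag_mx (weights_5_17 p).
Proof. mx5. Qed.
Lemma orig_5_17 p r : ad_orig (G5_17_x_R p r) =
  ad_mod (G5_17_x_R p r) + (J (o 0) (o 1) + r *: J (o 2) (o 3)).
Proof. mx5. Qed.

Lemma mod_3_5 : ad_mod (G3_5_x_R3 R) = diag_mx 0.
Proof. mx5. Qed.
Lemma orig_3_5 : ad_orig (G3_5_x_R3 R) = ad_mod (G3_5_x_R3 R) + J (o 0) (o 1).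
Proof. mx5. Qed.

(** Each original bracket matrix is the modified one plus a commuting sum of rotations, its
    semisimple part with imaginary eigenvalues. At the given periods the rotations complete full
    turns and the two exponentials agree. *)
Lemma mexp_commuting_factor n (A S : 'M[R]_n.+1) s : A *m S = S *m A ->
  mexp (s *: S) = 1%:M -> mexp (s *: (A + S)) = mexp (s *: A).
Proof. by move=> AS S1; rewrite mexpD// S1 mulmx1. Qed.

Lemma holonomy_6_10 (m : int) : mexp ((m%:~R * (2 * pi)) *: ad_orig (G6_10 R)) =
  mexp ((m%:~R * (2 * pi)) *: ad_mod (G6_10 R)).
Proof.
rewrite orig_6_10 mod_6_10; apply: mexp_commuting_factor; first by deltas.
by rewrite mulrC rotation_turns.
Qed.

Lemma holonomy_5_14 (m : int) : mexp ((m%:~R * (2 * pi)) *: ad_orig (G5_14_x_R R)) =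
  mexp ((m%:~R * (2 * pi)) *: ad_mod (G5_14_x_R R)).
Proof.
rewrite orig_5_14 mod_5_14; apply: mexp_commuting_factor; first by deltas.
by rewrite mulrC rotation_turns.
Qed.

Lemma mexp_two_rotations (s r : R) : mexp (s *: J (o 0) (o 1)) = 1%:M ->
  mexp ((s * r) *: J (o 2) (o 3)) = 1%:M ->
  mexp (s *: (J (o 0) (o 1) + r *: J (o 2) (o 3))) = 1%:M.
Proof.
move=> J1 J2; rewrite mexpD ?scalerA ?J1 ?J2 ?mulmx1//.
by rewrite -scalemxAr -scalemxAl !rotation_disjoint// scaler0.
Qed.

Lemma holonomy_5_18 (m : int) : mexp ((m%:~R * (2 * pi)) *: ad_orig (G5_18_x_R R)) =
  mexp ((m%:~R * (2 * pi)) *: ad_mod (G5_18_x_R R)).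
Proof.
rewrite orig_5_18 mod_5_18; apply: mexp_commuting_factor.
  (* The nilpotent part carries one rotation plane to the other: it commutes with the sum of the two
     rotations but not with either one. *)
  by deltas; rewrite addrC.
rewrite -[J (o 2) _]scale1r mexp_two_rotations// ?mulr1 mulrC rotation_turns//.
Qed.

Lemma holonomy_3_5 (m : int) : mexp ((m%:~R * (2 * pi)) *: ad_orig (G3_5_x_R3 R)) =
  mexp ((m%:~R * (2 * pi)) *: ad_mod (G3_5_x_R3 R)).
Proof.
rewrite orig_3_5 mod_3_5; apply: mexp_commuting_factor; first by apply: rotation_diag; rewrite !mxE.
by rewrite mulrC rotation_turns.
Qed.

Lemma holonomy_5_17 (p r : R) (r1 r2 m : int) : r = r1%:~R / r2%:~R -> 0 < r2 ->
  let t := 2 * pi * r2%:~R in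
  mexp ((m%:~R * t) *: ad_orig (G5_17_x_R p r)) =
  mexp ((m%:~R * t) *: ad_mod (G5_17_x_R p r)).
Proof.
move=> rE r2_gt0 t; rewrite orig_5_17 mod_5_17; apply: mexp_commuting_factor.
  rewrite mulmxDr mulmxDl -scalemxAr -scalemxAl !rotation_diag//.
  - by rewrite !mxE.
  - by rewrite !mxE.
have r2_neq0 : r2%:~R != 0 :> R by rewrite intr_eq0 gt_eqF.
(* Over m periods the first rotation makes m r2 turns and the second m r1 turns. *)
apply: mexp_two_rotations.
- rewrite (_ : m%:~R * t = 2 * pi * (m * r2)%:~R) ?rotation_turns//.
  by rewrite intrM /t; ring.
- rewrite (_ : m%:~R * t * r = 2 * pi * (m * r1)%:~R) ?rotation_turns//.
  by rewrite intrM /t rE; field.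
Qed.

Lemma nilpotent_group (G : modified_pair R) (L : set 'rV[R]_5) (w : diff_form R 6 2)
    (y eps : 'rV[R]_5) :
  (forall m : int, mexp ((m%:~R * (2 * pi)) *: ad_orig G) =
     mexp ((m%:~R * (2 * pi)) *: ad_mod G)) ->
  ad_mod G *m ad_mod G *m ad_mod G = 0 ->
  (forall i j : 'I_5, (i <= j)%N -> ad_mod G i j = 0) ->
  y *m ad_mod G = eps -> eps *m ad_mod G = 0 -> eps != 0 ->
  invariant_lattice G (2 * pi) L -> modified_symplectic G w ->
  [/\ ~ hard_lefschetz (deck G (2 * pi) L) w,
      s_lefschetz (deck G (2 * pi) L) w 0,
      ~ s_lefschetz (deck G (2 * pi) L) w 1
    & ~ s_lefschetz (deck G (2 * pi) L) w 2].
Proof.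
move=> GE N3 Nlow yE eE e0 [[P PU LP] LI] wM.
have t0 : 2 * pi != 0 :> R by rewrite mulf_neq0 ?gt_eqF ?pi_gt0.
have Gdet s := det_mexp_lower s N3 Nlow.
have iso0 := deck_lefschetz_iso0 t0 PU LP LI GE Gdet wM.
have niso1 := deck_not_lefschetz_iso1 t0 PU LP LI GE Gdet wM N3 yE eE e0.
split.
- by move=> H; exact/niso1/H.
- by move=> [|k] _.
- by move=> H; exact/niso1/H.
- by move=> H; exact/niso1/H.
Qed.

Lemma diagonal_group (G : modified_pair R) (t : R) (L : set 'rV[R]_5) (w : diff_form R 6 2)
    (d : 'rV[R]_5) :
  t != 0 ->
  (forall m : int, mexp ((m%:~R * t) *: ad_orig G) = mexp ((m%:~R * t) *: ad_mod G)) ->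
  ad_mod G = diag_mx d -> \sum_j d ord0 j = 0 ->
  invariant_lattice G t L -> modified_symplectic G w ->
  hard_lefschetz (deck G t L) w.
Proof.
move=> t0 GE dE d0 [[P PU LP] LI] wM.
have Gdet s : \det (mexp (s *: ad_mod G)) = 1 by rewrite dE det_mexp_diag.
exact: (deck_hard_lefschetz t0 PU LP LI GE Gdet wM dE).
Qed.

End Groups.

Theorem proposition4p2 (R : realType) :
  (forall (G : modified_pair R) (L : set 'rV[R]_5) (w : diff_form R 6 2),
     [\/ G = G6_10 R, G = G5_14_x_R R | G = G5_18_x_R R] ->
     invariant_lattice G (2 * pi) L ->
     modified_symplectic G w ->
     [/\ ~ hard_lefschetz (deck G (2 * pi) L) w,
         s_lefschetz (deck G (2 * pi) L) w 0,
         ~ s_lefschetz (deck G (2 * pi) L) w 1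
       & ~ s_lefschetz (deck G (2 * pi) L) w 2]) /\
  (forall (p r : R) (r1 r2 : int) (L : set 'rV[R]_5) (w : diff_form R 6 2),
     r = r1%:~R / r2%:~R -> r != 0 -> (0 < r2)%R ->
     invariant_lattice (G5_17_x_R p r) (2 * pi * r2%:~R) L ->
     modified_symplectic (G5_17_x_R p r) w ->
     hard_lefschetz (deck (G5_17_x_R p r) (2 * pi * r2%:~R) L) w) /\
  (forall (L : set 'rV[R]_5) (w : diff_form R 6 2),
     invariant_lattice (G3_5_x_R3 R) (2 * pi) L ->
     modified_symplectic (G3_5_x_R3 R) w ->
     hard_lefschetz (deck (G3_5_x_R3 R) (2 * pi) L) w).
Proof.
split; last split.
- move=> G L w [] -> LI wM.
  (* [y] and [eps] are X_2 and X_1. X_3 would not do for [y], since [X_3, X_6] = X_2 is not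
     central. *)
  + apply: (nilpotent_group (y := delta_mx 0 (o 1)) (eps := delta_mx 0 (o 0))
      (@holonomy_6_10 R) _ _ _ _ _ LI wM); rewrite ?mod_6_10.
    * by deltas.
    * by move=> [[|[|[|[|[|?]]]]] ?] [[|[|[|[|[|?]]]]] ?] //; rewrite !mxE /= ?addr0.
    * by deltas.
    * by deltas.
    * by apply/eqP => /rowP/(_ (o 0)) /eqP; rewrite !mxE eqxx oner_eq0.
  + apply: (nilpotent_group (y := delta_mx 0 (o 1)) (eps := delta_mx 0 (o 0))
      (@holonomy_5_14 R) _ _ _ _ _ LI wM); rewrite ?mod_5_14.
    * by deltas.
    * by move=> [[|[|[|[|[|?]]]]] ?] [[|[|[|[|[|?]]]]] ?] //; rewrite !mxE /= ?addr0.
    * by deltas.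
    * by deltas.
    * by apply/eqP => /rowP/(_ (o 0)) /eqP; rewrite !mxE eqxx oner_eq0.
  (* Here the central bracket is [X_3, X_5] = X_1, and X_3 has index 2. *)
  + apply: (nilpotent_group (y := delta_mx 0 (o 2)) (eps := delta_mx 0 (o 0))
      (@holonomy_5_18 R) _ _ _ _ _ LI wM); rewrite ?mod_5_18.
    * by deltas.
    * by move=> [[|[|[|[|[|?]]]]] ?] [[|[|[|[|[|?]]]]] ?] //; rewrite !mxE /= ?addr0.
    * by deltas.
    * by deltas.
    * by apply/eqP => /rowP/(_ (o 0)) /eqP; rewrite !mxE eqxx oner_eq0.
- move=> p r r1 r2 L w rE r0 r2_gt0.
  apply: (diagonal_group (d := weights_5_17 p)).
  + by rewrite !mulf_neq0 ?intr_eq0 ?gt_eqF ?pi_gt0.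
  + by move=> m; exact: (holonomy_5_17 p m rE r2_gt0).
  + exact: mod_5_17.
  (* The trace p + p - p - p vanishes. *)
  + by rewrite !big_ord_recl big_ord0 !mxE /=; ring.
- move=> L w; apply: (diagonal_group (d := 0)).
  + by rewrite mulf_neq0 ?gt_eqF ?pi_gt0.
  + exact: holonomy_3_5.
  + exact: mod_3_5.
  + by rewrite big1// => j _; rewrite mxE.
Qed.
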